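(* Let $N\ge 2$, $1<p<N$, and let $\Omega\subset\mathbb{R}^N$ be a bounded open set with Lipschitz boundary and unit outward normal $\nu$. Let $a:\Omega\times\mathbb{R}^N\to\mathbb{R}^N$ be a Carathéodory function such that, for almost every $x\in\Omega$ and all $\xi\ne\xi'$ in $\mathbb{R}^N$, $$a(x,\xi)\cdot\xi\ge\alpha|\xi|^p,\qquad |a(x,\xi)|\le\beta\big(z(x)+|\xi|^{p-1}\big),\qquad (a(x,\xi)-a(x,\xi'))\cdot(\xi-\xi')>0,$$ for some $\alpha,\beta>0$ and some $0\le z\in L^{\frac{p}{p-1}}(\Omega)$. Let $0\le f\in L^1(\Omega)$, let $\lambda\in L^1(\partial\Omega)$ be not identically null, let $g\in L^1(\partial\Omega)$, and let $\lambda,g\ge0$ $\mathcal{H}^{N-1}$-almost everywhere on $\partial\Omega$. Let $h$ be a continuous function on $(0,\infty)$, finite outside the origin and possibly blowing up at zero, for which the limit $h(0):=\lim_{s\to0}h(s)$ exists (possibly infinite), and such that there exist $\eta\ge0$ and $c_1,s_1>0$ with $h(s)\le c_1s^{-\eta}$ if $s\le s_1$, and $\limsup_{s\to\infty}h(s)<\infty$. Let $\sigma$ be a continuous function with $\sigma(0)=0$ and $\sigma(s)\ge s^{p-1}$ for all $s\ge0$. Assume finally that $\sigma(s)$ is increasing and $h(s)$ is nonincreasing with respect to $s$. Then there is at most one entropy solution to $$\begin{cases}-\operatorname{div}(a(x,\nabla u))=f&\text{in }\Omega,\\ u\ge0&\text{in }\Omega,\\ a(x,\nabla u)\cdot\nu+\lambda\sigma(u)=h(u)g&\text{on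 }\partial\Omega.\end{cases}$$
   Context: $\mathcal{H}^{N-1}$ is the $(N-1)$-dimensional Hausdorff measure, used for Lebesgue spaces on $\partial\Omega$. $T_k(s)=\max(-k,\min(s,k))$ for $k>0$. Gradient: if $u$ is measurable, a.e. finite, and $T_k(u)\in W^{1,p}(\Omega)$ for all $k>0$, then $\nabla u$ denotes the unique measurable vector field $w$ with $\nabla T_k(u)=w\,\chi_{\{|u|\le k\}}$ a.e. in $\Omega$ for every $k>0$. Values of $u$ on $\partial\Omega$ are understood through the traces of the truncations $T_k(u)$. Entropy solution: a measurable function $u$ (with $u\ge0$, as required in the problem), a.e. finite in $\Omega$, with $T_k(u)\in W^{1,p}(\Omega)$ for all $k>0$, such that $a(x,\nabla T_k(u))\in L^{\frac{p}{p-1}}(\Omega)^N$, $\lambda\sigma(u),\,h(u)g\in L^1(\partial\Omega)$, and $$\int_\Omega a(x,\nabla u)\cdot\nabla T_k(u-v)\,dx+\int_{\partial\Omega}\lambda\sigma(u)T_k(u-v)\,d\mathcal{H}^{N-1}=\int_\Omega fT_k(u-v)\,dx+\int_{\partial\Omega}h(u)g\,T_k(u-v)\,d\mathcal{H}^{N-1}$$ for all $v\in W^{1,p}(\Omega)\cap L^\infty(\Omega)$ and all $k>0$.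
   Formalization: Besides ''λ not identically null'', it is assumed that λ is not a.e. zero on the boundary of any connected component of Ω (the same if Ω is connected); otherwise two disjoint balls with λ=0 on one sphere and f=g=0 admit u=0 on one ball and any constant c≥0 on the other. *)

(* Defs.v *)
From HB Require Import structures.
From mathcomp Require Import all_boot all_order all_algebra.
From mathcomp Require Import all_classical all_reals all_analysis.

Set Implicit Arguments.
Unset Strict Implicit.
Unset Printing Implicit Defensive.
Import Order.TTheory GRing.Theory Num.Theory.
Import numFieldNormedType.Exports.

Local Open Scope classical_set_scope.
Local Open Scope ring_scope.

(* The library norm on 'rV[R]_N is the sup norm, hence a separate Euclidean
   norm; the topology is the same. *)
Definition dot {R : realType} {N : nat} (x y : 'rV[R]_N) : R :=
  \sum_(i < N) x ord0 i * y ord0 i.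

Definition enorm {R : realType} {N : nat} (x : 'rV[R]_N) : R :=
  Num.sqrt (dot x x).

Definition boundary {T : topologicalType} (A : set T) : set T :=
  closure A `\` A°.

Section cover_outer.
Context {R : realType} {T : Type}.
Local Open Scope ereal_scope.

Definition cover_outer (c : set T -> \bar R) (X : set T) : \bar R :=
  ereal_inf [set \sum_(n <oo) c (F n) |
    F in [set F : (set T)^nat | X `<=` \bigcup_n F n]].

End cover_outer.

Definition discrete_space (T : Type) : Type := T.

Section discrete_space.
Variable T : pointedType.
HB.instance Definition _ := Pointed.on (discrete_space T).
HB.instance Definition _ := @isMeasurable.Build default_measure_display
  (discrete_space T) [set: set (discrete_space T)] I (fun _ _ => I)
  (fun _ _ => I).
End discrete_space.

Section cover_outer_theory.
Context {R : realType} {T : pointedType}.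
Variable c : set T -> \bar R.
Hypothesis c0 : c set0 = 0%E.
Hypothesis c_ge0 : forall A, (0 <= c A)%E.

Lemma cover_outerE (X : set T) :
  cover_outer c X = mu_ext (c : set (discrete_space T) -> \bar R) X.
Proof.
by congr ereal_inf; apply/seteqP; split => _ [F HF <-];
  exists F => //; case: HF.
Qed.

Lemma cover_outer0 : cover_outer c set0 = 0%E.
Proof. by rewrite cover_outerE mu_ext0. Qed.

Lemma cover_outer_ge0 X : (0 <= cover_outer c X)%E.
Proof. by rewrite cover_outerE mu_ext_ge0. Qed.

Lemma le_cover_outer : {homo cover_outer c : A B / A `<=` B >-> (A <= B)%E}.
Proof. by move=> A B AB; rewrite !cover_outerE le_mu_ext. Qed.

Lemma cover_outer_sigma_subadditive : sigma_subadditive (cover_outer c).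
Proof.
move=> F; rewrite cover_outerE; under eq_eseriesr do rewrite cover_outerE.
exact: mu_ext_sigma_subadditive.
Qed.

End cover_outer_theory.

Section lebesgue.
Context {R : realType} {N : nat}.
Local Notation V := 'rV[R]_N.

(* Volume of a closed box; +oo (the infimum of the empty set) on the other
   nonempty sets, which are thereby excluded from the covers. *)
Definition box_volume (A : set V) : \bar R :=
  ereal_inf [set m | (A = set0 /\ m = 0%E) \/
    exists a b : V, [/\ forall i, a ord0 i <= b ord0 i,
      A = [set x : V | forall i, a ord0 i <= x ord0 i <= b ord0 i] &
      m = (\prod_(i < N) (b ord0 i - a ord0 i))%:E]].

Lemma box_volume_ge0 A : (0 <= box_volume A)%E.
Proof.
apply: le_ereal_inf_tmp => m [[_ ->//]|[a [b [ab _ ->]]]].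
by rewrite lee_fin prodr_ge0// => i _; rewrite subr_ge0.
Qed.

Lemma box_volume0 : box_volume set0 = 0%E.
Proof.
apply/eqP; rewrite eq_le box_volume_ge0 andbT.
by apply: ereal_inf_lbound; left.
Qed.

Definition lebesgue_outer : set V -> \bar R := cover_outer box_volume.

HB.instance Definition _ := isOuterMeasure.Build R V lebesgue_outer
  (cover_outer0 box_volume0 box_volume_ge0) (cover_outer_ge0 box_volume_ge0)
  (@le_cover_outer R V box_volume)
  (cover_outer_sigma_subadditive box_volume_ge0).

End lebesgue.

Definition lebesgue_om (R : realType) (N : nat) :
  {outer_measure set 'rV[R]_N -> \bar R} := @lebesgue_outer R N.

(* R^N with its Lebesgue (Caratheodory) measurable sets *)
Notation lebesgue_space R N := (caratheodory_type (lebesgue_om R N)).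

Definition leb (R : realType) (N : nat) :
  {measure set (lebesgue_space R N) -> \bar R} := lebesgue_om R N.

(* Volume of the Euclidean unit ball of R^n *)
Fixpoint ball_volume (R : realType) (n : nat) : R :=
  match n with
  | 0 => 1
  | 1 => 2
  | (m.+1 as n').+1 => 2 * pi / n'.+1%:R * ball_volume R m
  end.

Section hausdorff.
Context {R : realType} {N : nat} (s : nat).
Local Notation V := 'rV[R]_N.

Definition diam (A : set V) : \bar R :=
  ereal_sup [set (enorm (xy.1 - xy.2))%:E | xy in A `*` A].

Definition hausdorff_gauge (delta : R) (A : set V) : \bar R :=
  ereal_inf [set m | (A = set0 /\ m = 0%E) \/
    [/\ A !=set0, (diam A <= delta%:E)%E &
      m = (ball_volume R s * (fine (diam A) / 2) ^+ s)%:E]].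

Lemma ball_volume_ge0 n : 0 <= ball_volume R n.
Proof.
suff: 0 <= ball_volume R n /\ 0 <= ball_volume R n.+1 by case.
elim: n => [|n [IH1 IH2]]; first by split.
by split => //; rewrite /= !mulr_ge0// pi_ge0.
Qed.

Lemma hausdorff_gauge_ge0 delta A : (0 <= hausdorff_gauge delta A)%E.
Proof.
apply: le_ereal_inf_tmp => m [[_ ->//]|[[x Ax] _ ->]].
rewrite lee_fin mulr_ge0 ?ball_volume_ge0// exprn_ge0// divr_ge0// fine_ge0//.
apply: le_ereal_sup_tmp; exists (enorm (x - x))%:E; first by exists (x, x).
by rewrite lee_fin sqrtr_ge0.
Qed.

Lemma hausdorff_gauge0 delta : hausdorff_gauge delta set0 = 0%E.
Proof.
apply/eqP; rewrite eq_le hausdorff_gauge_ge0 andbT.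
by apply: ereal_inf_lbound; left.
Qed.

Definition hausdorff_outer (A : set V) : \bar R :=
  ereal_sup [set cover_outer (hausdorff_gauge delta) A |
    delta in [set delta : R | 0 < delta]].

Lemma hausdorff_outer_ge0 A : (0 <= hausdorff_outer A)%E.
Proof.
apply: le_ereal_sup_tmp; exists (cover_outer (hausdorff_gauge 1) A).
  by exists 1 => //=.
exact: (cover_outer_ge0 (hausdorff_gauge_ge0 1)).
Qed.

Lemma hausdorff_outer0 : hausdorff_outer set0 = 0%E.
Proof.
apply/eqP; rewrite eq_le hausdorff_outer_ge0 andbT.
apply: ge_ereal_sup => _ [delta _ <-].
by rewrite (cover_outer0 (hausdorff_gauge0 _) (hausdorff_gauge_ge0 _)).
Qed.

Lemma le_hausdorff_outer :
  {homo hausdorff_outer : A B / A `<=` B >-> (A <= B)%E}.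
Proof.
move=> A B AB; apply: ge_ereal_sup => _ [delta d0 <-].
apply: le_ereal_sup_tmp; exists (cover_outer (hausdorff_gauge delta) B).
  by exists delta.
exact: le_cover_outer.
Qed.

Lemma hausdorff_outer_sigma_subadditive : sigma_subadditive hausdorff_outer.
Proof.
move=> F; apply: ge_ereal_sup => _ [delta d0 <-].
apply: le_trans.
  exact: (cover_outer_sigma_subadditive (hausdorff_gauge_ge0 delta)).
apply: lee_nneseries => [n _ _|n _ /=].
  exact: (cover_outer_ge0 (hausdorff_gauge_ge0 delta)).
by apply: ereal_sup_ubound; exists delta.
Qed.

HB.instance Definition _ := isOuterMeasure.Build R V hausdorff_outer
  hausdorff_outer0 hausdorff_outer_ge0 le_hausdorff_outer
  hausdorff_outer_sigma_subadditive.

End hausdorff.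

Definition hausdorff_om (R : realType) (N s : nat) :
  {outer_measure set 'rV[R]_N -> \bar R} := @hausdorff_outer R N s.

Notation hausdorff_space R N s := (caratheodory_type (hausdorff_om R N s)).

Definition hausdorff (R : realType) (N s : nat) :
  {measure set (hausdorff_space R N s) -> \bar R} := hausdorff_om R N s.

(* Surface measure on hypersurfaces of R^N *)
Notation surf R N := (hausdorff R N N.-1).

(* Near each boundary point A lies strictly above, in the direction of a unit
   vector e, the graph of a Lipschitz function gamma on the hyperplane
   orthogonal to e. *)
Definition lipschitz_boundary {R : realType} {N : nat} (A : set 'rV[R]_N) :=
  forall x0, boundary A x0 -> exists (e : 'rV[R]_N) (gamma : 'rV[R]_N -> R)
    (r : R), [/\ dot e e = 1, [lipschitz gamma x | x in setT], 0 < r &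
      forall x, enorm (x - x0) < r ->
        (A x <-> gamma (x - dot x e *: e) < dot x e)].

Definition bounded_lipschitz_open {R : realType} {N : nat}
    (A : set 'rV[R]_N) := [/\ open A, bounded_set A & lipschitz_boundary A].

(* lambda is not almost everywhere zero on the boundary of any connected
   component of A.  If A is connected this just says that lambda is not
   identically null on the boundary of A.  Otherwise it is strictly stronger,
   and needed: for a(x, xi) = |xi|^(p-2) xi, f = g = 0, two disjoint balls and
   lambda vanishing on one of the two spheres, all nonnegative constants on
   that ball (extended by 0 to the other ball) are entropy solutions. *)
Definition nonnull_on_components {R : realType} {N : nat} (A : set 'rV[R]_N)
    (lambda : 'rV[R]_N -> R) :=
  forall x, A x -> ~ {ae surf R N, forall y,
    boundary (connected_component A x) y -> lambda y = 0}.

Definition in_Lp {d} {T : measurableType d} {R : realType}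
    (mu : {measure set T -> \bar R}) (D : set T) (q : R) (f : T -> R) :=
  measurable_fun D f /\ finite_norm mu q%:E (f \_ D).

Definition cvg_Lp {d} {T : measurableType d} {R : realType}
    (mu : {measure set T -> \bar R}) (D : set T) (q : R) (fs : nat -> T -> R)
    (f : T -> R) :=
  'N[mu]_(q%:E)[EFin \o ((fs n \- f)%R \_ D)]%E @[n --> \oo] --> 0%E.

Section sobolev.
Context {R : realType} {N : nat}.
Local Notation V := 'rV[R]_N.
Implicit Types (Omega : set V) (p : R) (v : V -> R) (W : V -> V).

Definition partial (i : 'I_N) v : V -> R :=
  fun x => 'D_(delta_mx ord0 i) v x.

Definition smooth v :=
  forall (s : seq 'I_N) (x : V), differentiable (foldr partial v s) x.

Definition test_function Omega (phi : V -> R) :=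
  smooth phi /\ exists K : set V,
    [/\ compact K, K `<=` Omega & forall x, ~ K x -> phi x = 0].

Definition measurable_field Omega W :=
  forall i, measurable_fun (Omega : set (lebesgue_space R N))
    (fun x => W x ord0 i).

(* v belongs to W^{1,p}(Omega) and W is its weak gradient *)
Definition sobolev_grad Omega p v W :=
  [/\ in_Lp (leb R N) Omega p v,
      forall i, in_Lp (leb R N) Omega p (fun x => W x ord0 i) &
      forall i phi, test_function Omega phi ->
        \int[leb R N]_(x in Omega) (v x * partial i phi x) =
        - \int[leb R N]_(x in Omega) (W x ord0 i * phi x)].

Definition sobolev Omega p v := exists W, sobolev_grad Omega p v W.

(* tau is the trace of v in W^{1,p}(Omega): the trace operator is the
   continuous extension to W^{1,p}(Omega) of the restriction to the boundary
   of functions that are smooth up to the boundary *)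
Definition is_trace Omega p v (tau : V -> R) :=
  in_Lp (surf R N) (boundary Omega) p tau /\
  exists W (phi : nat -> V -> R),
    [/\ sobolev_grad Omega p v W, forall n, smooth (phi n),
        cvg_Lp (leb R N) Omega p phi v,
        forall i, cvg_Lp (leb R N) Omega p (fun n => partial i (phi n))
                    (fun x => W x ord0 i) &
        cvg_Lp (surf R N) (boundary Omega) p phi tau].

Definition trunc (k s : R) : R := Num.max (- k) (Num.min s k).

Definition cut (k : R) (u : V -> R) W : V -> V :=
  fun x => if `|u x| <= k then W x else 0.

(* every T_k(u) belongs to W^{1,p}(Omega), and W is the generalized gradient
   of u *)
Definition truncated_grad Omega p u W :=
  measurable_field Omega W /\
  forall k, 0 < k -> sobolev_grad Omega p (trunc k \o u) (cut k u W).

(* A single boundary function bu, finite like u, whose truncations are the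
   traces of the truncations of u. *)
Definition boundary_value Omega p u (bu : V -> R) :=
  measurable_fun (boundary Omega : set (hausdorff_space R N N.-1)) bu /\
  forall k, 0 < k -> is_trace Omega p (trunc k \o u) (trunc k \o bu).

Definition ess_bounded Omega v :=
  measurable_fun (Omega : set (lebesgue_space R N)) v /\
  exists M : R, {ae leb R N, forall x, Omega x -> `|v x| <= M}.

Definition caratheodory_fun Omega (a : V -> V -> V) :=
  (forall xi, measurable_field Omega (a ^~ xi)) /\
  {ae leb R N, forall x, Omega x -> continuous (a x)}.

(* h takes its values in \bar R because h 0 may be infinite; in
   h (bu x) * (g x)%:E the library convention +oo * 0 = 0 applies.
   In the last clause G is the weak gradient of T_k(u - v) and tau the trace
   of v; both are determined almost everywhere by v. *)
Definition entropy_solution Omega p (a : V -> V -> V) (lambda : V -> R)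
    (sigma : R -> R) (h : R -> \bar R) (f g : V -> R) (u : V -> R) :=
  [/\ measurable_fun (Omega : set (lebesgue_space R N)) u,
      {ae leb R N, forall x, Omega x -> 0 <= u x} &
      exists (Du : V -> V) (bu : V -> R),
      [/\ truncated_grad Omega p u Du /\ boundary_value Omega p u bu,
          forall k, 0 < k -> forall i,
            in_Lp (leb R N) Omega (p / (p - 1))
              (fun x => a x (cut k u Du x) ord0 i),
          (surf R N).-integrable (boundary Omega)
            (fun x => (lambda x * sigma (bu x))%:E),
          (surf R N).-integrable (boundary Omega)
            (fun x => h (bu x) * (g x)%:E)%E &
          forall (v : V -> R) (tau : V -> R) (k : R) (G : V -> V),
            sobolev Omega p v -> ess_bounded Omega v ->
            is_trace Omega p v tau -> 0 < k ->
            sobolev_grad Omega p (fun x => trunc k (u x - v x)) G ->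
            (\int[leb R N]_(x in Omega) (dot (a x (Du x)) (G x))%:E +
             \int[surf R N]_(x in boundary Omega)
               (lambda x * sigma (bu x) * trunc k (bu x - tau x))%:E =
             \int[leb R N]_(x in Omega) (f x * trunc k (u x - v x))%:E +
             \int[surf R N]_(x in boundary Omega)
               (h (bu x) * (g x)%:E * (trunc k (bu x - tau x))%:E))%E]].

End sobolev.

(* Main.v *)
(** Test the entropy equation of [u1] with [T_n u2] and that of [u2] with
    [T_n u1], with [k = 1], add them, and let [n] tend to infinity.  What is not
    controlled by the monotonicity of [a] lives on [{n - 2 < u_i <= n + 1}] and
    is bounded by the energy of [u_i] there, which tends to 0.  As [sigma]
    increases and [h] decreases, the boundary terms have the right sign; hence
    [Du1 = Du2] a.e. where [|u1 - u2| <= 1], and [u1 = u2] a.e. on the part of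
    the boundary where [lambda] does not vanish.  Consequently [T_1 (u1 - u2)]
    is an L^1 limit of functions whose gradients tend to 0, so it is constant on
    each connected component of [Omega]; a trace inequality along interior cones
    shows that its trace is the same constant, which is therefore 0 because
    [lambda] charges the boundary of every component. *)

(* The limit [T_1 (u1 - u2)] does not come with a trace: the trace of [T_1 (u1 - T_n u2)] is
   [T_1 (b1 - T_n b2)], which is the wanted one only where [|b2| <= n]. Approximation is therefore
   stated on a part of the boundary, and the boundary is exhausted by the sets [|b2| <= j]. The
   energy on the window tends to 0 because the equation of [u] tested with [T_(n-2) u] and [k = 3]
   contains [T_3 (u - T_(n-2) u) = T_(n+1) u - T_(n-2) u]: the other terms are integrals of fixed
   integrable functions against factors bounded by 3 that tend to 0 pointwise. A zero gradient is
   exploited through translations: the limit has equal means on the two halves of any box, and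
   repeated halving shows that its deviation from its mean is orthogonal to Lipschitz functions. The
   trace inequality is a count: disjoint columns of cubes over separated boundary points share one
   integral over the open set, which bounds the number of points and hence the Hausdorff measure. *)
Require Import Defs.
From HB Require Import structures.
From mathcomp Require Import all_boot all_order all_algebra.
From mathcomp Require Import all_classical all_reals all_analysis.
From mathcomp Require Import measurable_realfun.
From mathcomp Require Import ring lra.
(* Again, because [hausdorff_space] is also a constant of the topology library. *)
Import Defs.

Set Implicit Arguments.
Unset Strict Implicit.
Unset Printing Implicit Defensive.
Import Order.TTheory GRing.Theory Num.Theory.
Import numFieldNormedType.Exports.

Local Open Scope classical_set_scope.
Local Open Scope ring_scope.

(** * Lebesgue and Hausdorff measurability of Borel sets *)

Section row_vectors.
Context {R : realType} {N : nat}.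
Local Notation V := 'rV[R]_N.
Implicit Types (x y a b : V) (U : set V).

Lemma rV_norm_ltP x e : 0 < e -> (`|x| < e) <-> (forall i, `|x ord0 i| < e).
Proof.
move=> e0; rewrite {1}/Num.norm/= mx_normrE; split.
  by move/bigmax_ltP => [_ xe] i; exact: (xe (ord0, i)).
by move=> xe; apply/bigmax_ltP; split=> //= -[j i] _ /=; rewrite (ord1 j).
Qed.

Lemma rV_norm_leP x e : 0 <= e -> (`|x| <= e) <-> (forall i, `|x ord0 i| <= e).
Proof.
move=> e0; rewrite {1}/Num.norm/= mx_normrE; split.
  by move/bigmax_leP => [_ xe] i; exact: (xe (ord0, i)).
by move=> xe; apply/bigmax_leP; split=> //= -[j i] _ /=; rewrite (ord1 j).
Qed.

Lemma coord_norm_le x i : `|x ord0 i| <= `|x|.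
Proof. by have /rV_norm_leP := lexx `|x|; apply. Qed.

Definition cbox a b : set V :=
  [set x | forall i, a ord0 i <= x ord0 i <= b ord0 i].
Definition obox a b : set V :=
  [set x | forall i, a ord0 i < x ord0 i < b ord0 i].
(** Boxes with rational centre and radius [1 / (n + 1)]: a countable base of the topology, the
    source of every passage below from a local property to a global one. *)
Definition rbox (q : 'rV[rat]_N) (n : nat) : set V :=
  obox (\row_i (ratr (q ord0 i) - n.+1%:R^-1))
       (\row_i (ratr (q ord0 i) + n.+1%:R^-1)).

Lemma rboxP q n x :
  rbox q n x <-> forall i, `|x ord0 i - ratr (q ord0 i)| < n.+1%:R^-1.
Proof.
by split => H i; move: (H i); rewrite !mxE ltr_distl.
Qed.

(** The closed box stays in [U] as well, because [ae_open] works with closed boxes inside the open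
    set. *)
Lemma open_rbox U x : open U -> U x ->
  exists q n, rbox q n x /\ cbox (\row_i (ratr (q ord0 i) - n.+1%:R^-1))
       (\row_i (ratr (q ord0 i) + n.+1%:R^-1)) `<=` U.
Proof.
move=> oU Ux; have /nbhs_ballP[e /= e0 xeU] := open_nbhs_nbhs (conj oU Ux).
(* Both [x] and a point of the closed box are within [1 / (n + 1)] of the centre, whence the factor
   2. *)
have [n ne] : exists n : nat, 2 * n.+1%:R^-1 < e.
  have [n _ /(_ _ (leqnn n)) ne] := near_infty_natSinv_lt (PosNum (divr_gt0 e0 (@ltr0Sn R 1))).
  by exists n; move: ne => /=; rewrite ltr_pdivlMr// mulrC.
have H i : exists q : rat, `|x ord0 i - ratr q| < n.+1%:R^-1.
  have [|q] := @rat_in_itvoo R (x ord0 i - n.+1%:R^-1) (x ord0 i + n.+1%:R^-1).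
    by rewrite ltrD2l gtrN// invr_gt0.
  rewrite in_itv/= => /andP[? ?]; exists q; rewrite ltr_distl.
  by apply/andP; split; rewrite -?ltrBlDr// ltrBlDr.
have [q Hq] := choice H.
exists (\row_i q i), n; split; first by apply/rboxP => i; rewrite mxE.
move=> y yq; apply: xeU; rewrite -ball_normE /ball_/=.
apply/rV_norm_ltP => // i; rewrite !mxE.
move: (Hq i) (yq i); rewrite !mxE !ltr_norml.
move: (ratr _) (_^-1) ne => r d ne /andP[? ?] /andP[? ?].
by apply/andP; split; lra.
Qed.

Lemma open_bigcup_rbox U : open U ->
  U = \bigcup_(qn : 'rV[rat]_N * nat)
    (if `[< rbox qn.1 qn.2 `<=` U >] then rbox qn.1 qn.2 else set0).
Proof.
move=> oU; apply/seteqP; split=> [x Ux|x [[q n] _ /=]].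
  have [q [n [xqn qnU]]] := open_rbox oU Ux.
  exists (q, n) => //=; case: asboolP => // -[] y yq; apply: qnU => i.
  by have /andP[/ltW -> /ltW ->] := yq i.
by case: asboolP => // + xq; exact.
Qed.

End row_vectors.

Section borel_outer_measure.
Context {R : realType} {N : nat} (mu : {outer_measure set 'rV[R]_N -> \bar R}).
Local Notation V := 'rV[R]_N.
Local Notation S := (caratheodory_type mu).

(** Half-spaces generate the Borel sets, so this is all that has to be checked for the Lebesgue and
    the Hausdorff outer measures. *)
Hypothesis mu_half : forall (i : 'I_N) c,
  mu.-caratheodory [set x : V | x ord0 i < c].

Lemma measurable_omE (A : set S) : measurable A = mu.-caratheodory A.
Proof. by []. Qed.

Lemma measurable_coord (i : 'I_N) : measurable_fun setT (fun x : S => x ord0 i).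
Proof.
apply: (measurability _ (RGenCInfty.measurableE R)) => _ [_ [c [->]] <-].
rewrite setTI (_ : _ @^-1` _ = ~` [set x : V | x ord0 i < c]).
  by apply: measurableC; exact: mu_half.
by apply/seteqP; split=> x /=; rewrite in_itv/= andbT leNgt => /negP.
Qed.

Lemma measurable_obox (a b : V) : measurable (obox a b : set S).
Proof.
rewrite (_ : obox a b = \bigcap_(i in [set: 'I_N])
  ((fun x : S => x ord0 i) @^-1` `]a ord0 i, b ord0 i[)).
  apply: fin_bigcap_measurable; first exact: finite_finset.
  by move=> i _; rewrite -[X in measurable X]setTI; apply: measurable_coord.
by apply/seteqP; split=> x H i; move: (H i); rewrite /= in_itv/=; exact.
Qed.

Lemma measurable_open_om (U : set V) : open U -> measurable (U : set S).
Proof.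
move=> /open_bigcup_rbox ->; apply: countable_bigcupT_measurable.
  exact: countableP.
by move=> [q n] /=; case: ifP => _; [exact: measurable_obox|exact: measurable0].
Qed.

Lemma measurable_closed_om (U : set V) : closed U -> measurable (U : set S).
Proof.
by move=> cU; rewrite -(setCK U); apply/measurableC/measurable_open_om/closed_openC.
Qed.

Lemma continuous_measurable_om (f : V -> R) : continuous f ->
  measurable_fun setT (f : S -> R).
Proof.
move=> cf; apply: (measurability _ (RGenOpens.measurableE R)).
move=> _ [_ [a [b ->] <-]]; rewrite setTI; apply: measurable_open_om.
by apply: open_comp => // x _; exact: cf.
Qed.

(** Caratheodory's sigma-algebra is complete: a set of outer measure 0 is itself measurable.
    Almost-everywhere statements can thus be handled as equations on the outer measure. *)
Lemma negligible_om (A : set V) : (mu : {measure set S -> \bar R}).-negligible A <-> mu A = 0%E.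
Proof.
split=> [[B [mB B0 AB]]|A0].
  by apply/eqP; rewrite eq_le outer_measure_ge0 andbT -B0 le_outer_measure.
exists A; split => //; apply: le_caratheodory_measurable => X.
rewrite (_ : mu (X `&` A) = 0%E) ?add0e ?le_outer_measure//.
by apply/eqP; rewrite eq_le outer_measure_ge0 andbT -A0 le_outer_measure.
Qed.

End borel_outer_measure.

(** * Half-spaces are Lebesgue measurable *)

Section lebesgue_half.
Context {R : realType} {N : nat}.
Local Notation V := 'rV[R]_N.
Local Open Scope ereal_scope.

Lemma cover_outer_le (T : Type) (c : set T -> \bar R) (A : set T) :
  c set0 = 0 -> (forall B, 0 <= c B) -> cover_outer c A <= c A.
Proof.
move=> c0 c_ge0; apply: ereal_inf_lbound.
exists (fun n => if n is O then A else set0); first by move=> x Ax; exists O.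
rewrite nneseries_recl//.
by rewrite eseries_cond/= eseries0 ?adde0// => -[|n] //= _; rewrite c0.
Qed.

Lemma lebesgue_outer_box (a b : V) : (forall i, a ord0 i <= b ord0 i)%R ->
  lebesgue_outer (cbox a b) <= (\prod_(i < N) (b ord0 i - a ord0 i))%:E.
Proof.
move=> ab; apply: le_trans (cover_outer_le _ box_volume0 (@box_volume_ge0 R N)) _.
by apply: ereal_inf_lbound; right; exists a, b.
Qed.

Definition upd (a : V) i m : V := (\row_j (if j == i then m else a ord0 j))%R.

Lemma box_volume_split (i : 'I_N) (c : R) (A : set V) :
  lebesgue_outer (A `&` [set x : V | x ord0 i < c]%R) +
  lebesgue_outer (A `&` ~` [set x : V | x ord0 i < c]%R) <= box_volume A.
Proof.
apply: le_ereal_inf_tmp => m [[-> ->]|[a [b [ab -> ->]]]].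
  by rewrite !set0I (outer_measure0 (lebesgue_om R N)) adde0.
(* The cut is made at [c] clamped to the side of the box, so that both pieces are closed boxes, one
   of them flat when the hyperplane misses the box. Their volumes add up exactly. *)
pose m' : R := Num.max (a ord0 i) (Num.min c (b ord0 i)).
have am : (a ord0 i <= m')%R by rewrite le_max lexx.
have mb : (m' <= b ord0 i)%R by rewrite ge_max ab ge_min lexx orbT.
have -> : (\prod_(j < N) (b ord0 j - a ord0 j) =
   \prod_(j < N) (upd b i m' ord0 j - a ord0 j) +
   \prod_(j < N) (b ord0 j - upd a i m' ord0 j))%R.
  rewrite (bigD1 i)//= [X in _ = (X + _)%R](bigD1 i)//= [X in _ = (_ + X)%R](bigD1 i)//= !mxE eqxx.
  rewrite [X in (_ * X + _)%R](eq_bigr (fun j => b ord0 j - a ord0 j))%R; last first.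
    by move=> j /negbTE ji; rewrite mxE ji.
  rewrite [X in (_ + _ * X)%R](eq_bigr (fun j => b ord0 j - a ord0 j))%R; last first.
    by move=> j /negbTE ji; rewrite mxE ji.
  by rewrite -mulrDl; congr (_ * _)%R; lra.
rewrite EFinD; apply: leeD.
  apply: (le_trans _ (lebesgue_outer_box _)); last first.
    by move=> j; rewrite mxE; case: eqP => // ->.
  apply: (le_outer_measure (lebesgue_om R N)) => x [xab /= xc] j.
  have /andP[ax xb] := xab j; rewrite mxE ax/=; case: eqP => [ji|//]; subst j.
  by rewrite /m' le_max le_min (ltW xc) xb orbT.
apply: (le_trans _ (lebesgue_outer_box _)); last first.
  by move=> j; rewrite mxE; case: eqP => // ->.
apply: (le_outer_measure (lebesgue_om R N)) => x [xab /= /negP xc] j.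
have /andP[ax xb] := xab j; rewrite mxE xb andbT; case: eqP => [ji|//]; subst j.
by move: xc; rewrite -leNgt => xc; rewrite /m' ge_max ax ge_min xc.
Qed.

Lemma lebesgue_half (i : 'I_N) (c : R) :
  (lebesgue_om R N).-caratheodory [set x : V | x ord0 i < c]%R.
Proof.
apply: le_caratheodory_measurable => X.
apply: le_ereal_inf_tmp => _ [F XF <-].
set H := [set x : V | x ord0 i < c]%R.
have nn n : 0 <= lebesgue_outer (F n `&` H) by exact: outer_measure_ge0 (lebesgue_om R N) _.
have nn' n : 0 <= lebesgue_outer (F n `&` ~` H) by exact: outer_measure_ge0 (lebesgue_om R N) _.
apply: (@le_trans _ _ (\sum_(n <oo) (lebesgue_outer (F n `&` H) + lebesgue_outer (F n `&` ~` H)))).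
  rewrite nneseriesD//; apply: leeD.
    apply: le_trans (outer_measure_sigma_subadditive (lebesgue_om R N) _).
    by apply: le_outer_measure => x [/XF[n _ Fn] Hx]; exists n.
  apply: le_trans (outer_measure_sigma_subadditive (lebesgue_om R N) _).
  by apply: le_outer_measure => x [/XF[n _ Fn] Hx]; exists n.
apply: lee_nneseries => [n _ _|n _]; first by rewrite adde_ge0.
exact: box_volume_split.
Qed.

End lebesgue_half.

(** * Half-spaces are Hausdorff measurable *)

Section hausdorff_half.
Context {R : realType} {N : nat} (s : nat).
Local Notation V := 'rV[R]_N.
Local Notation H := (@hausdorff_outer R N s).
Local Open Scope ereal_scope.

Lemma coord_enorm_le (x : V) i : (`|x ord0 i| <= enorm x)%R.
Proof.
rewrite -sqrtr_sqr /enorm ler_wsqrtr//.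
rewrite /dot (bigD1 i)//= -expr2 lerDl sumr_ge0// => j _.
by rewrite -expr2 sqr_ge0.
Qed.

(** A set of diameter less than [d - c] cannot meet both [A] and [B], so a fine cover of the union
    splits into a cover of [A] and a cover of [B]. *)
Lemma hausdorff_outerU_far (i : 'I_N) (c d : R) (A B : set V) : (c < d)%R ->
  (forall x, A x -> x ord0 i <= c)%R -> (forall x, B x -> d <= x ord0 i)%R ->
  H A + H B <= H (A `|` B).
Proof.
move=> cd Ac Bd.
pose D := (d - c)%R; have D0 : (0 < D)%R by rewrite subr_gt0.
have key (delta : R) : (0 < delta)%R -> (delta <= D / 2)%R ->
   cover_outer (hausdorff_gauge s delta) A + cover_outer (hausdorff_gauge s delta) B
   <= H (A `|` B).
  move=> delta0 deltaD.
  have gge0 := @hausdorff_gauge_ge0 R N s delta.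
  apply: (@le_trans _ _ (cover_outer (hausdorff_gauge s delta) (A `|` B))); last first.
    by apply: ereal_sup_ubound; exists delta.
  apply: le_ereal_inf_tmp => _ [F ABF <-].
  pose FA n := if `[< F n `&` A !=set0 >] then F n else set0.
  pose FB n := if `[< F n `&` A !=set0 >] then set0 else F n.
  have g0 := @hausdorff_gauge0 R N s delta.
  (* A set of diameter above [delta] has gauge [+oo], as the infimum of the empty set, and makes the
     whole sum infinite. Otherwise every set of the cover is small. *)
  have [[n Fn]|nF] := pselect (exists n, hausdorff_gauge s delta (F n) = +oo).
    by rewrite (eseries_pinfty _ _ Fn) ?leey// => m _; rewrite gt_eqF// (lt_le_trans _ (gge0 _))// ltNy0.
  rewrite (_ : \sum_(n <oo) _ = \sum_(n <oo) (hausdorff_gauge s delta (FA n) + hausdorff_gauge s delta (FB n))); last first.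
    apply: eq_eseriesr => n _; rewrite /FA /FB.
    by case: ifP => _; rewrite g0 ?adde0 ?add0e.
  rewrite nneseriesD//; apply: leeD; apply: ereal_inf_lbound.
    exists FA => // x Ax; have [n _ Fnx] := ABF x (or_introl Ax).
    by exists n => //; rewrite /FA; case: asboolP => // -[]; exists x.
  exists FB => // x Bx; have [n _ Fnx] := ABF x (or_intror Bx).
  exists n => //; rewrite /FB; case: asboolP => // -[y [Fny Ay]].
  exfalso; apply: nF; exists n.
  suff dn : ~ (diam (F n) <= delta%:E).
    rewrite /hausdorff_gauge; apply/ereal_inf_pinfty => m [[F0 _]|[_ /dn//]].
    by rewrite F0 in Fnx.
  move=> dle; have : (enorm (x - y))%:E <= delta%:E.
    by apply: le_trans dle; apply: ereal_sup_ubound; exists (x, y).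
  rewrite lee_fin => xy; have := le_trans (coord_enorm_le (x - y) i) xy.
  rewrite !mxE ler_norml => /andP[_]; have := Ac _ Ay; have := Bd _ Bx.
  by rewrite /D in D0 deltaD; lra.
have [->|H0] := eqVneq (H (A `|` B)) +oo; first by rewrite leey.
have cov_mono (E : set V) (d1 d2 : R) : (d1 <= d2)%R ->
    cover_outer (hausdorff_gauge s d2) E <= cover_outer (hausdorff_gauge s d1) E.
  move=> d12; apply: le_ereal_inf_tmp => _ [F EF <-].
  apply: (@le_trans _ _ (\sum_(n <oo) hausdorff_gauge s d2 (F n))).
    by apply: ereal_inf_lbound; exists F.
  apply: lee_nneseries => [n _ _|n _]; first exact: hausdorff_gauge_ge0.
  apply: ereal_inf_le_tmp => m [[-> ->]|[F0 dF ->]]; [by left|right; split => //].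
  by rewrite (le_trans dF)// lee_fin.
rewrite -leeBrDr; last first.
  rewrite ge0_fin_numE ?hausdorff_outer_ge0// (@le_lt_trans _ _ (H (A `|` B)))//.
    by apply: le_hausdorff_outer => x; right.
  by rewrite ltey.
apply: ge_ereal_sup => _ [d1 /= d10 <-].
rewrite leeBrDr; last first.
  rewrite ge0_fin_numE ?hausdorff_outer_ge0// (@le_lt_trans _ _ (H (A `|` B)))//.
    by apply: le_hausdorff_outer => x; right.
  by rewrite ltey.
have c1fin : cover_outer (hausdorff_gauge s d1) A \is a fin_num.
  rewrite ge0_fin_numE; last exact: cover_outer_ge0 (@hausdorff_gauge_ge0 R N s d1) _.
  apply: (@le_lt_trans _ _ (H (A `|` B))); last by rewrite ltey.
  apply: (@le_trans _ _ (H A)); last by apply: le_hausdorff_outer => x; left.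
  by apply: ereal_sup_ubound; exists d1.
rewrite addeC -leeBrDr//; apply: ge_ereal_sup => _ [d2 /= d20 <-].
rewrite leeBrDr// addeC.
(* The two suprema over scales are approached at [d1] and [d2] separately; a common finer scale
   dominates both and is fine enough for the splitting. *)
pose d3 := Num.min (Num.min d1 d2) (D / 2)%R.
apply: le_trans (key d3 _ _); last 2 first.
- by rewrite !lt_min d10 d20 divr_gt0.
- by rewrite ge_min lexx orbT.
by apply: leeD; apply: cov_mono; rewrite !ge_min lexx ?orbT.
Qed.

(* Caratheodory's shell argument: for X below the hyperplane, the part of X at
   distance in ]1/(n+2), 1/(n+1)] from it has summable measure, as the shells
   of even (resp. odd) index are far apart from each other. *)
Lemma hausdorff_half (i : 'I_N) (c : R) :
  (hausdorff_om R N s).-caratheodory [set x : V | x ord0 i < c]%R.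
Proof.
apply: le_caratheodory_measurable => X; set L := [set x : V | _].
change (H (X `&` L) + H (X `&` ~` L) <= H X).
have mono := @le_hausdorff_outer R N s.
have [->|Xfin] := eqVneq (H X) +oo; first by rewrite leey.
pose t (n : nat) : R := (c - n.+1%:R^-1)%R.
have tS n : (t n < t n.+1)%R.
  by rewrite ltrD2l ltrN2 ltf_pV2 ?posrE// ltr_nat.
have tmono m n : (m <= n)%N -> (t m <= t n)%R.
  by move=> mn; rewrite lerD2l lerN2 lef_pV2 ?posrE// ler_nat.
pose Y n := X `&` [set x : V | x ord0 i <= t n]%R.
pose Sh n := X `&` [set x : V | t n < x ord0 i <= t n.+1]%R.
have HYX n : H (Y n) + H (X `&` ~` L) <= H X.
  apply: (le_trans (hausdorff_outerU_far (c := t n) (d := c) (i := i) _ _ _)).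
  - by rewrite ltrBlDr ltrDl invr_gt0.
  - by move=> x [].
  - by move=> x [_ /negP]; rewrite -leNgt.
  - by apply: mono => x [[]|[]].
have YL n : H (X `&` L) <= H (Y n) + \sum_(n <= k <oo) H (Sh k).
  have sub : X `&` L `<=` Y n `|` \bigcup_(k in ~` `I_n) Sh k.
    move=> x [Xx xc]; have [xt|tx] := leP (x ord0 i) (t n); first by left.
    right.
    have [m tm] : exists m, (x ord0 i <= t m)%R.
      have e0 : (0 < c - x ord0 i)%R by rewrite subr_gt0.
      have [m _ /(_ _ (leqnn m))/= me] := near_infty_natSinv_lt (PosNum e0).
      by exists m; rewrite lerBrDr -lerBrDl ltW.
    pose P m := (x ord0 i <= t m)%R.
    have exP : exists m, P m by exists m.
    case: (ex_minnP exP) => -[|k] Pk kmin.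
      by have := lt_le_trans tx (le_trans Pk (tmono _ _ (leq0n n))); rewrite ltxx.
    have tk : (t k < x ord0 i)%R.
      by rewrite ltNge; apply/negP => /kmin; rewrite ltnn.
    exists k; last by split => //=; rewrite tk.
    rewrite /= => kn; have := lt_le_trans tx (le_trans Pk (tmono _ _ kn)).
    by rewrite ltxx.
  apply: (le_trans (mono _ _ sub)).
  apply: (le_trans (outer_measureU2 (hausdorff_om R N s) _ _)).
  by apply: leeD => //; exact: outer_measure_sigma_subadditive_tail (hausdorff_om R N s) _ _.
(* Among shells of equal parity, the first [n] lie below [t (p + 2n - 1)] and the next one above
   [t (p + 2n)]: the gap allows [hausdorff_outerU_far] to add them up. *)
have shells (p : nat) n : \sum_(k < n) H (Sh (p + k.*2)%N) <= H X.
  suff : \sum_(k < n) H (Sh (p + k.*2)%N) <=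
      H (X `&` [set x : V | x ord0 i <= t (p + n.*2).-1]%R).
    by move/le_trans; apply; apply: mono => x [].
  elim: n => [|n IH]; first by rewrite big_ord0 hausdorff_outer_ge0.
  rewrite big_ord_recr/= doubleS !addnS/=.
  have ShX : Sh (p + n.*2)%N `<=` X `&` [set x : V | x ord0 i <= t (p + n.*2).+1]%R.
    by move=> x [Xx /andP[_ xt]].
  case: n IH ShX => [_|n IH] ShX.
    by rewrite big_ord0 add0e; exact: mono.
  apply: (le_trans (leeD IH (lexx _))).
  apply: (le_trans (hausdorff_outerU_far (c := t (p + n.+1.*2).-1%N)
     (d := t (p + n.+1.*2)%N) (i := i) _ _ _)).
  - by rewrite doubleS !addnS/=.
  - by move=> x [].
  - by move=> x [_ /= /andP[/ltW]].
  - apply: mono => x [[Xx /= xt]|/ShX//]; split=> //=; apply: le_trans xt _.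
    by apply: tmono; rewrite doubleS !addnS/= ltnW// ltnW.
have Shge0 k : 0 <= H (Sh k) by exact: hausdorff_outer_ge0.
have serfin : \sum_(k <oo) H (Sh k) < +oo.
  apply: (@le_lt_trans _ _ (H X + H X)); last first.
    by rewrite lte_add_pinfty// ltey.
  apply: lime_le; first exact: is_cvg_nneseries.
  apply: nearW => n; apply: (@le_trans _ _ (\sum_(0 <= k < n.*2) H (Sh k))).
    by rewrite (@big_cat_nat _ _ _ n 0 n.*2)//= -?addnn ?leq_addr// leeDl// sume_ge0.
  have -> : \sum_(0 <= k < n.*2) H (Sh k) =
     \sum_(k < n) H (Sh (0 + k.*2)%N) + \sum_(k < n) H (Sh (1 + k.*2)%N).
    elim: n => [|n IH]; first by rewrite !big_ord0 big_nil adde0.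
    rewrite doubleS !big_nat_recr//= IH !big_ord_recr/= !add0n !add1n.
    by rewrite -!addeA; congr (_ + _); rewrite addeCA.
  by apply: leeD; exact: shells.
have tail0 := nneseries_tail_cvg serfin (fun k _ => Shge0 k).
have bound n : H (X `&` L) + H (X `&` ~` L) <= H X + \sum_(n <= k <oo) H (Sh k).
  apply: (le_trans (leeD (YL n) (lexx _))).
  by rewrite addeAC; apply: leeD => //; exact: HYX.
have : (H X + \sum_(n <= k <oo) H (Sh k)) @[n --> \oo] --> H X + 0.
  by apply: cvgeD => //; [rewrite fin_num_adde_defl|exact: cvg_cst].
rewrite adde0 => /cvg_lim <-//; apply: lime_ge.
  apply/cvg_ex; exists (H X); rewrite -[X in _ --> X]adde0.
  by apply: cvgeD => //; [rewrite fin_num_adde_defl|exact: cvg_cst].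
exact: nearW.
Qed.
End hausdorff_half.

(** * Translation invariance of the Lebesgue measure *)

Section lebesgue_transl.
Context {R : realType} {N : nat}.
Local Notation V := 'rV[R]_N.
Local Notation S := (lebesgue_space R N).
Local Open Scope ereal_scope.

Definition transl (t : V) (x : V) : V := (x + t)%R.

Lemma box_volume_transl_le t A : box_volume (transl t @^-1` A) <= box_volume A.
Proof.
apply: le_ereal_inf_tmp => m [[-> ->]|[a [b [ab -> ->]]]].
  by rewrite preimage_set0 box_volume0.
apply: ereal_inf_lbound; right; exists (a - t)%R, (b - t)%R; split.
- by move=> i; rewrite !mxE lerD2r.
- by apply/seteqP; split=> x /= H i; move: (H i); rewrite /transl !mxE lerBlDr lerBrDr.
- by congr EFin; apply: eq_bigr => i _; rewrite !mxE opprD addrACA subrr addr0.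
Qed.

Lemma translK t (A : set V) : transl t @^-1` (transl (- t) @^-1` A) = A.
Proof. by rewrite -comp_preimage; apply/seteqP; split=> x; rewrite /= /transl addrK. Qed.

Lemma translNK t (A : set V) : transl (- t) @^-1` (transl t @^-1` A) = A.
Proof. by rewrite -comp_preimage; apply/seteqP; split=> x; rewrite /= /transl subrK. Qed.

Lemma lebesgue_transl_le t (A : set V) :
  lebesgue_outer (transl t @^-1` A) <= lebesgue_outer A.
Proof.
apply: le_ereal_inf_tmp => _ [F AF <-].
apply: (@le_trans _ _ (\sum_(n <oo) box_volume (transl t @^-1` F n))).
  apply: ereal_inf_lbound; exists (fun n => transl t @^-1` F n) => //.
  by move=> x /AF[n _ Fn]; exists n.
by apply: lee_nneseries => [n _ _|n _]; [exact: box_volume_ge0|exact: box_volume_transl_le].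
Qed.

Lemma lebesgue_transl t (A : set V) :
  lebesgue_outer (transl t @^-1` A) = lebesgue_outer A.
Proof.
apply/eqP; rewrite eq_le lebesgue_transl_le/=.
by rewrite -{1}(translNK t A) lebesgue_transl_le.
Qed.

Lemma measurable_transl_set t (A : set S) : measurable A ->
  measurable (transl t @^-1` A : set S).
Proof.
rewrite !measurable_omE => mA X; have HX := mA (transl (- t) @^-1` X).
change (lebesgue_outer X = lebesgue_outer (X `&` transl t @^-1` A) +
  lebesgue_outer (X `&` ~` (transl t @^-1` A))).
rewrite -(lebesgue_transl (- t) X) -(lebesgue_transl (- t) (_ `&` _)).
rewrite -(lebesgue_transl (- t) (_ `&` ~` _)) !preimage_setI preimage_setC.
by rewrite !translNK; exact: HX.
Qed.

Lemma measurable_transl t : measurable_fun [set: S] (transl t : S -> S).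
Proof. by move=> _ A mA; rewrite setTI; exact: measurable_transl_set. Qed.

Lemma ge0_integral_transl t (D : set S) (f : S -> \bar R) :
  measurable D -> measurable_fun D f -> {in D, forall x, 0 <= f x} ->
  \int[leb R N]_(x in transl t @^-1` D) f (x + t)%R = \int[leb R N]_(x in D) f x.
Proof.
move=> mD mf f0.
rewrite -(ge0_integral_pushforward (measurable_transl t))//.
apply: (eq_measure_integral (leb R N)); first exact: measurable_transl.
move=> mt A mA _.
by rewrite /pushforward/=; exact: (lebesgue_transl t A).
Qed.

Lemma integral_transl t (D : set S) (f : S -> \bar R) :
  measurable D -> measurable_fun D f ->
  \int[leb R N]_(x in transl t @^-1` D) f (x + t)%R = \int[leb R N]_(x in D) f x.
Proof.
move=> mD mf; rewrite integralE [RHS]integralE; congr (_ - _).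
  rewrite -(ge0_integral_transl t mD (measurable_funepos mf))//.
  by apply: eq_integral => x _; rewrite !funeposE.
rewrite -(ge0_integral_transl t mD (measurable_funeneg mf))//.
by apply: eq_integral => x _; rewrite !funenegE.
Qed.

Lemma leb_half : forall (i : 'I_N) c,
  (lebesgue_om R N).-caratheodory [set x : V | x ord0 i < c]%R.
Proof. exact: lebesgue_half. Qed.

Lemma leb_ge0 (A : set V) : 0 <= leb R N A.
Proof. exact: outer_measure_ge0 (lebesgue_om R N) A. Qed.

Lemma le_leb (A B : set V) : A `<=` B -> leb R N A <= leb R N B.
Proof. exact: le_outer_measure (lebesgue_om R N) A B. Qed.

Lemma leb_cbox_fin (a b : V) : leb R N (cbox a b) < +oo.
Proof.
have [ab|nab] := pselect (forall i, a ord0 i <= b ord0 i)%R.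
  exact: le_lt_trans (lebesgue_outer_box ab) (ltry _).
rewrite (_ : cbox a b = set0) ?measure0//; apply/seteqP; split=> // x xab.
by apply: nab => i; have /andP[ax xb] := xab i; exact: le_trans ax xb.
Qed.

Lemma leb_cbox_flat (a b : V) i : (b ord0 i <= a ord0 i)%R ->
  leb R N (cbox a b) = 0.
Proof.
move=> bai; apply/eqP; rewrite eq_le leb_ge0 andbT.
have [ab|nab] := pselect (forall i, a ord0 i <= b ord0 i)%R.
  apply: le_trans (lebesgue_outer_box ab) _; rewrite (bigD1 i)//=.
  have /eqP -> : (b ord0 i - a ord0 i == 0)%R by rewrite subr_eq0 eq_le bai ab.
  by rewrite mul0r.
rewrite (_ : cbox a b = set0) ?measure0//; apply/seteqP; split=> // x xab.
by apply: nab => j; have /andP[ax xb] := xab j; exact: le_trans ax xb.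
Qed.

(** The faces of a box are flat closed boxes, which have volume 0. *)
Lemma leb_cbox_obox (a b : V) : leb R N (cbox a b `\` obox a b) = 0.
Proof.
apply/eqP; rewrite eq_le leb_ge0 andbT.
pose F (i : 'I_N) : set V := cbox a (upd b i (a ord0 i)) `|` cbox (upd a i (b ord0 i)) b.
have F0 i : leb R N (F i) = 0.
  apply/eqP; rewrite eq_le leb_ge0 andbT.
  apply: le_trans (outer_measureU2 (lebesgue_om R N) _ _) _.
  rewrite [X in X + _](leb_cbox_flat (i := i)) ?mxE ?eqxx//.
  by rewrite [X in _ + X](leb_cbox_flat (i := i)) ?adde0 ?mxE ?eqxx.
have Fn : cbox a b `\` obox a b `<=` \bigcup_(i in [set: 'I_N]) F i.
  move=> x [xab nx].
  apply: contrapT => nF; apply: nx => i; have /andP[ax xb] := xab i.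
  rewrite !lt_neqAle ax xb !andbT; apply/andP; split; apply/eqP => E; apply: nF; exists i => //.
    left => j; have /andP[axj xbj] := xab j; rewrite mxE axj/=.
    by case: eqP => // ->; rewrite E.
  right => j; have /andP[axj xbj] := xab j; rewrite mxE xbj andbT.
  by case: eqP => // ->; rewrite E.
apply: (@le_trans _ _ (leb R N (\big[setU/set0]_(i < N) F i))).
  apply: le_leb => x /Fn[i _ Fi].
  by rewrite (bigD1 i)//=; left.
elim/big_ind : _ => [|A B HA HB|i _]; first by rewrite measure0.
  apply: le_trans (outer_measureU2 (lebesgue_om R N) _ _) _.
  by rewrite -[leRHS]adde0; exact: leeD.
by rewrite F0.
Qed.

End lebesgue_transl.

(** * Volumes of cubes *)

Section cubes.
Context {R : realType} {N : nat}.
Local Notation V := 'rV[R]_N.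
Local Notation S := (lebesgue_space R N).

(** A closed ball is a cube, since the norm of ['rV[R]_N] is the sup norm; [r] is half of the
    side. *)
Definition cube (c : V) (r : R) : set V := [set x | `|x - c| <= r].

Lemma cubeE c r : 0 <= r -> cube c r = cbox (\row_i (c ord0 i - r)) (\row_i (c ord0 i + r)).
Proof.
move=> r0; apply/seteqP; split => x /=.
  move=> /(rV_norm_leP _ r0) H i; have := H i; rewrite !mxE ler_norml => /andP[? ?].
  by apply/andP; split; lra.
move=> H; apply/rV_norm_leP => // i; have := H i; rewrite !mxE ler_norml => /andP[? ?].
by apply/andP; split; lra.
Qed.

Lemma closed_cube c r : closed (cube c r).
Proof.
apply: (@closed_comp _ _ (fun x : V => `|x - c|) [set s | s <= r]).
  have cB : continuous (fun x : V => x - c).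
    by move=> x; apply: continuousB; [move=> A; exact: id|exact: cst_continuous].
  by move=> x _; apply: continuous_comp; [exact: cB|exact: norm_continuous].
exact: closed_le.
Qed.

Lemma measurable_cube c r : measurable (cube c r : set S).
Proof.
by apply: (measurable_closed_om leb_half); exact: closed_cube.
Qed.

Lemma leb_cube_fin c r : (leb R N (cube c r) < +oo)%E.
Proof.
have [r0|r0] := leP 0 r; first by rewrite cubeE// leb_cbox_fin.
rewrite (_ : cube c r = set0) ?measure0//; apply/seteqP; split=> // x /=.
by move/(le_lt_trans)/(_ r0); rewrite ltNge normr_ge0.
Qed.

Lemma leb_bounded (A : set V) : bounded_set A -> (leb R N A < +oo)%E.
Proof.
move=> [M [_ /(_ (M + 1))]]; rewrite ltrDl ltr01 => /(_ isT) AM.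
apply: le_lt_trans (leb_cube_fin 0 (M + 1)); apply: le_leb => x /AM.
by rewrite /cube/= subr0.
Qed.

Lemma leb_cubeE c r : leb R N (cube c r) = leb R N (cube 0 r).
Proof.
rewrite -[RHS](lebesgue_transl (- c)); congr (leb R N _).
by apply/seteqP; split=> x; rewrite /cube /transl /= subr0.
Qed.

(** Subadditivity over the grid of [(K + 1) ^ N] cubes of half-side [r / (K + 1)]. Together with
    positivity, this inequality plays the part of the formula for the volume of a cube. *)
Lemma leb_cube_div r (K : nat) : 0 < r ->
  (leb R N (cube 0 r) <= (K.+1 ^ N)%:R%:E * leb R N (cube 0 (r / K.+1%:R)))%E.
Proof.
move=> r0; set k : R := K.+1%:R; have k0 : 0 < k by rewrite ltr0n.
pose ctr (j : {ffun 'I_N -> 'I_K.+1}) : V := \row_i (- r + (2 * (j i)%:R + 1) * (r / k)).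
have sub : cube 0 r `<=` \bigcup_(j in [set: {ffun 'I_N -> 'I_K.+1}]) cube (ctr j) (r / k).
  move=> x; rewrite /cube/= subr0 => /(rV_norm_leP _ (ltW r0)) xr.
  have H (i : 'I_N) : exists j : 'I_K.+1,
      `|x ord0 i - (- r + (2 * j%:R + 1) * (r / k))| <= r / k.
    (* The index of the cell is a truncated quotient, which would be [K.+1] on the upper face; that
       face belongs to the last cell. *)
    have [xlt|xge] := ltP (x ord0 i) r; last first.
      have -> : x ord0 i = r by apply/eqP; rewrite eq_le xge andbT (le_trans (ler_norm _)).
      exists ord_max => /=; rewrite (_ : r - _ = r / k) ?gtr0_norm ?divr_gt0//.
      have -> : K%:R = k - 1 :> R by rewrite /k -natr1 addrK.
      by field; rewrite gt_eqF.
    pose y := (x ord0 i + r) * k / (2 * r).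
    have xr' : - r <= x ord0 i by move: (xr i); rewrite ler_norml => /andP[].
    have y0 : 0 <= y.
      by rewrite /y divr_ge0 ?mulr_ge0 ?(ltW k0) ?(ltW r0)//; lra.
    have yk : y < k.
      by rewrite /y ltr_pdivrMr ?mulr_gt0// mulrC ltr_pM2l//; lra.
    have /andP[ty yt] := truncn_itv y0.
    have tK : (Num.truncn y < K.+1)%N by rewrite -(ltr_nat R) (le_lt_trans ty).
    exists (Ordinal tK) => /=.
    have xE : x ord0 i = 2 * (r / k) * y - r.
      by rewrite /y; field; rewrite !gt_eqF.
    rewrite xE (_ : _ - _ = (r / k) * (2 * (y - (Num.truncn y)%:R) - 1)); last by ring.
    rewrite normrM gtr0_norm ?divr_gt0// ler_piMr// ?(divr_ge0 (ltW r0) (ltW k0))//.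
    rewrite ler_norml; move: yt; rewrite -natr1 => yt.
    by apply/andP; split; lra.
  have [j Hj] := choice H.
  exists [ffun i => j i] => //; apply/rV_norm_leP; first by rewrite divr_ge0 ?ltW.
  by move=> i; rewrite !mxE ffunE.
have sub' : cube 0 r `<=`
    \big[setU/set0]_(j : {ffun 'I_N -> 'I_K.+1}) cube (ctr j) (r / k).
  by move=> x /sub[j _ xj]; rewrite (bigD1 j)//=; left.
apply: le_trans (le_leb sub') _.
apply: (@le_trans _ _ (\sum_(j : {ffun 'I_N -> 'I_K.+1}) leb R N (cube (ctr j) (r / k)))%E).
  elim/big_ind2 : _ => [|A x B y HA HB|//]; first by rewrite measure0.
  apply: le_trans (outer_measureU2 (lebesgue_om R N) _ _) _.
  exact: leeD.
rewrite (eq_bigr (fun=> leb R N (cube 0 (r / k)))); last by move=> j _; exact: leb_cubeE.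
have : leb R N (cube 0 (r / k)) \is a fin_num.
  by rewrite ge0_fin_numE ?leb_ge0// leb_cube_fin.
move: (leb R N _) => [m| |]// _.
rewrite -EFinM sumEFin.
rewrite sumr_const card_ffun.
rewrite !card_ord lee_fin.
by rewrite mulr_natl lexx.
Qed.

(* Avoids computing the measure of boxes: if cubes are null, there is nothing
   to prove in the end, and otherwise only their positivity matters. *)
Lemma leb_null_or_pos :
  (forall A : set V, leb R N A = 0%E) \/ (forall r, 0 < r -> (0 < leb R N (cube 0 r))%E).
Proof.
have [pos|npos] := pselect (forall r, 0 < r -> (0 < leb R N (cube 0 r))%E); first by right.
left => A; apply/eqP; rewrite eq_le leb_ge0 andbT.
move/existsNP : npos => [r /not_implyP[r0 /negP]]; rewrite -leNgt => cr.
have cr0 : leb R N (cube 0 r) = 0%E by apply/eqP; rewrite eq_le cr leb_ge0.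
(* If one cube is null, [leb_cube_div] makes its multiples by [K + 1] null too, and these fill the
   space. *)
apply: (@le_trans _ _ (leb R N (\bigcup_K cube 0 (r * K.+1%:R)))).
  apply: le_leb => x _; exists (Num.truncn (`|x| / r)) => //.
  rewrite /cube/= subr0 -ler_pdivrMl// mulrC.
  by rewrite ltW// truncnS_gt.
apply: le_trans (outer_measure_sigma_subadditive (lebesgue_om R N) _) _.
rewrite eseries0// => K _ _; apply/eqP; rewrite eq_le leb_ge0 andbT.
have := @leb_cube_div (r * K.+1%:R) K; rewrite mulr_gt0// => /(_ isT).
by rewrite mulfK// cr0 mule0.
Qed.

End cubes.

(** * Smooth functions and smooth truncations *)

Section smooth_calculus.
Context {R : realType} {N : nat}.
Local Notation V := 'rV[R]_N.
Implicit Types (f g : V -> R) (i : 'I_N).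

(** Coinduction principle: [smooth] is the largest class of differentiable functions stable under
    partial derivatives, so smoothness is proved by exhibiting one such class. *)
Lemma smooth_coind (P : (V -> R) -> Prop) :
  (forall f, P f -> (forall x, differentiable f x) /\ forall i, P (partial i f)) ->
  forall f, P f -> smooth f.
Proof.
move=> Pstep f Pf s; suff : P (foldr partial f s) by move=> /Pstep[].
by elim: s => [//|i s IH] /=; have [] := Pstep _ IH.
Qed.

Lemma smooth_differentiable f x : smooth f -> differentiable f x.
Proof. by move=> /(_ [::] x). Qed.

Lemma smooth_derivable f x v : smooth f -> derivable f x v.
Proof. by move=> /smooth_differentiable fx; exact: diff_derivable. Qed.

Lemma smooth_partial f i : smooth f -> smooth (partial i f).
Proof. by move=> sf s x; have := sf (rcons s i) x; rewrite foldr_rcons. Qed.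

Lemma smooth_continuous f : smooth f -> continuous f.
Proof. by move=> sf x; exact/differentiable_continuous/smooth_differentiable. Qed.

Lemma partialM f g i : smooth f -> smooth g ->
  partial i (fun x => f x * g x) = (fun x => partial i f x * g x + f x * partial i g x).
Proof.
move=> sf sg; apply/funext => x; rewrite /partial deriveM; try exact: smooth_derivable.
by rewrite /GRing.scale/=; ring.
Qed.

Lemma partial_cst (c : R) i : partial i (fun _ : V => c) = fun=> 0.
Proof. by apply/funext => x; rewrite /partial derive_cst. Qed.

Lemma smooth_cst (c : R) : smooth (fun _ : V => c).
Proof.
apply: (@smooth_coind (fun f => exists c, f = fun=> c)); last by exists c.
move=> _ [d ->]; split => [x|i]; first exact: differentiable_cst.
by exists 0; rewrite partial_cst.
Qed.


Section sums.
Variable B : (V -> R) -> Prop.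
(** The derivative of a product or a composition is no longer a single product or composition, but a
    finite sum of them: closing a class [B] under addition makes it stable, as [smooth_coind]
    requires. *)
Inductive sums : (V -> R) -> Prop :=
| sums_base f : B f -> sums f
| sums_add f g : sums f -> sums g -> sums (fun x => f x + g x).

Hypothesis Bdiff : forall g x, B g -> differentiable g x.
Hypothesis Bpartial : forall g i, B g -> sums (partial i g).

Lemma sums_smooth h : sums h -> smooth h.
Proof.
have sdiff f : sums f -> forall x, differentiable f x.
  elim=> [{}f Bf x|{}f g sf IHf sg IHg x]; first exact: Bdiff.
  by apply: differentiableD; [exact: IHf|exact: IHg].
apply: smooth_coind => {}h sh; split; first exact: sdiff.
move=> i; elim: sh => [f Bf|f g sf IHf sg IHg]; first exact: Bpartial.
rewrite (_ : partial i _ = fun x => partial i f x + partial i g x).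
  exact: sums_add.
by apply/funext => x; rewrite /partial deriveD//; exact/diff_derivable/sdiff.
Qed.

End sums.

Lemma smoothD f g : smooth f -> smooth g -> smooth (fun x => f x + g x).
Proof.
move=> sf sg; apply: (@sums_smooth smooth).
- by move=> h x; exact: smooth_differentiable.
- by move=> h i sh; apply/sums_base/smooth_partial.
- by apply: sums_add; apply: sums_base.
Qed.

Lemma smoothM f g : smooth f -> smooth g -> smooth (fun x => f x * g x).
Proof.
move=> sf sg; apply: (@sums_smooth (fun h => exists f g,
  [/\ smooth f, smooth g & h = fun x => f x * g x])).
- move=> _ x [f1 [g1 [sf1 sg1 ->]]].
  by apply: differentiableM; exact: smooth_differentiable.
- move=> _ i [f1 [g1 [sf1 sg1 ->]]]; rewrite partialM//; apply: sums_add; apply: sums_base.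
    by exists (partial i f1), g1; split => //; exact: smooth_partial.
  by exists f1, (partial i g1); split => //; exact: smooth_partial.
- by apply: sums_base; exists f, g.
Qed.

Lemma smoothN f : smooth f -> smooth (fun x => - f x).
Proof.
move=> sf; rewrite (_ : (fun x => - f x) = (fun x => -1 * f x)).
  by apply: smoothM => //; exact: smooth_cst.
by apply/funext => x; rewrite mulN1r.
Qed.

Lemma smoothB f g : smooth f -> smooth g -> smooth (fun x => f x - g x).
Proof. by move=> sf sg; apply: smoothD => //; exact: smoothN. Qed.

Lemma partialB f g i : smooth f -> smooth g ->
  partial i (fun x => f x - g x) = (fun x => partial i f x - partial i g x).
Proof.
by move=> sf sg; apply/funext => x; rewrite /partial deriveB//; exact: smooth_derivable.
Qed.

Lemma smooth_prod (I : Type) (r : seq I) (F : I -> V -> R) :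
  (forall j, smooth (F j)) -> smooth (fun x => \prod_(j <- r) F j x).
Proof.
move=> sF; elim: r => [|j r IH].
  under eq_fun do rewrite big_nil; exact: smooth_cst.
by under eq_fun do rewrite big_cons; exact: smoothM.
Qed.

Lemma smooth_coord (j : 'I_N) : smooth (fun x : V => x ord0 j).
Proof.
apply: (@smooth_coind (fun f => f = (fun x : V => x ord0 j) \/ exists c : R, f = fun=> c)); last by left.
move=> f [->|[c ->]]; (split; [move=> x|move=> i]).
- exact: differentiable_coord.
- right; exists ((delta_mx ord0 i : V) ord0 j); apply/funext => x.
  have @g : {linear V -> R}.
    by exists (fun M : V => M ord0 j); do 2![eexists]; do ?[constructor];
     rewrite ?mxE// => ? *; rewrite ?mxE//; move=> ?; rewrite !mxE.
  rewrite /partial deriveE; last exact: differentiable_coord.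
  by rewrite (_ : (fun x : V => _) = g)// diff_lin//; exact: coord_continuous.
- exact: differentiable_cst.
- by right; exists 0; rewrite partial_cst.
Qed.

Lemma partial_transl f t i : partial i (f \o transl t) = partial i f \o transl t.
Proof.
apply/funext => x; rewrite /partial /derive /=.
suff -> : (fun h : R => h^-1 *: (f (transl t (h *: delta_mx ord0 i + x)) - f (transl t x))) =
  (fun h => h^-1 *: (f (h *: delta_mx ord0 i + transl t x) - f (transl t x))) by [].
by apply/funext => h; rewrite /transl addrA.
Qed.

Lemma smooth_transl f t : smooth f -> smooth (f \o transl t).
Proof.
move=> sf; apply: (@smooth_coind (fun h => exists2 g, smooth g & h = g \o transl t)); last by exists f.
move=> _ [g sg ->]; split => [x|i].
  apply: differentiable_comp; last exact: smooth_differentiable.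
  by apply: differentiableD => //; exact: differentiable_cst.
by exists (partial i g); [exact: smooth_partial|exact: partial_transl].
Qed.

Lemma partial_comp (F : R -> R) f i x d : is_derive (f x) 1 F d ->
  differentiable f x -> partial i (F \o f) x = d * partial i f x.
Proof.
move=> Fd fx; have [Fdv FE] := Fd.
have Fdf : differentiable F (f x) by exact/derivable1_diffP.
rewrite /partial deriveE; last exact: differentiable_comp.
rewrite diff_comp//= diff1E// derive1E FE -deriveE//.
by rewrite mulrC.
Qed.

Definition derivatives (F : nat -> R -> R) :=
  forall n (x : R), is_derive x (1 : R) (F n) (F n.+1 x).

(** The stable class consists of the products of a smooth function with [F m \o f]: by the chain
    rule a derivative is a sum of two of them, with [F m] and [F m.+1]. *)
Lemma smooth_comp (F : nat -> R -> R) f n : derivatives F -> smooth f ->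
  smooth (F n \o f).
Proof.
move=> dF sf; apply: (@sums_smooth (fun h => exists g n, smooth g /\ h = fun x => g x * (F n \o f) x)).
- move=> _ x [g [m [sg ->]]]; apply: differentiableM.
    exact: smooth_differentiable.
  apply: differentiable_comp; first exact: smooth_differentiable.
  by apply/derivable1_diffP; have [] := dF m (f x).
- move=> _ i [g [m [sg ->]]].
  rewrite (_ : partial i _ = fun x => partial i g x * (F m \o f) x +
      (g x * partial i f x) * (F m.+1 \o f) x).
    apply: sums_add; apply: sums_base.
      by exists (partial i g), m; split => //; exact: smooth_partial.
    exists (fun x => g x * partial i f x), m.+1; split => //.
    by apply: smoothM => //; exact: smooth_partial.
  apply/funext => x; have Fd : derivable (F m \o f) x (delta_mx ord0 i).
    apply: diff_derivable; apply: differentiable_comp; first exact: smooth_differentiable.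
    by apply/derivable1_diffP; have [] := dF m (f x).
  have gd : derivable g x (delta_mx ord0 i) by exact: smooth_derivable.
  rewrite /partial (deriveM gd Fd).
  have := @partial_comp (F m) f i x _ (dF m (f x)) (smooth_differentiable x sf).
  by rewrite /partial => ->; rewrite /GRing.scale/=; ring.
- apply: sums_base; exists (fun=> 1), n; split; first exact: smooth_cst.
  by apply/funext => x; rewrite mul1r.
Qed.

End smooth_calculus.

(** * Flat functions and smooth truncations on the line *)

Section one_dimensional.
Context {R : realType}.
Implicit Types (F G : R -> R) (P : {poly R}) (s t x : R).

Definition Cinf F := exists Fs : nat -> R -> R, derivatives Fs /\ Fs 0%N = F.

Lemma CinfD F G : Cinf F -> Cinf G -> Cinf (fun x => F x + G x).
Proof.
move=> [Fs [dF <-]] [Gs [dG <-]]; exists (fun n x => Fs n x + Gs n x); split => // n x.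
by have := dF n x; have := dG n x => *; exact: is_deriveD.
Qed.

Lemma CinfZ F (c : R) : Cinf F -> Cinf (fun x => c * F x).
Proof.
move=> [Fs [dF <-]]; exists (fun n x => c * Fs n x); split => // n x.
by have := dF n x => *; exact: (is_deriveZ c).
Qed.

Lemma Cinf_cst (c : R) : Cinf (fun _ => c).
Proof.
exists (fun n _ => if n is O then c else 0); split => // n x.
by case: n => [|n]; exact: is_derive_cst.
Qed.

Lemma affine_derive (a b x : R) : is_derive x (1 : R) (fun y => a * y + b) a.
Proof.
have h := is_deriveD (is_deriveZ a (is_derive_id x (1 : R))) (is_derive_cst b x (1 : R)).
by apply: is_derive_eq h _; rewrite addr0 /GRing.scale/= mulr1.
Qed.

Lemma Cinf_affine F (a b : R) : Cinf F -> Cinf (fun x => F (a * x + b)).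
Proof.
move=> [Fs [dF <-]]; exists (fun n x => a ^+ n * Fs n (a * x + b)); split; last first.
  by apply/funext => x; rewrite mul1r.
move=> n x; apply: (@is_derive_eq _ _ _ _ _ _ _ (a ^+ n *: (Fs n.+1 (a * x + b) * a))).
  apply: is_deriveZ; apply: (@is_derive1_comp R (Fs n) (fun x => a * x + b)).
    exact: dF.
  exact: affine_derive.
by rewrite /GRing.scale/= exprSr; ring.
Qed.

(** For [P = 1] this is Cauchy's flat function [exp (-1 / x)]. Differentiation stays in the family:
    it replaces [P] by [X^2 (P - P')]. *)
Definition flatp P x := if 0 < x then P.[x^-1] * expR (- x^-1) else 0.

Lemma expR_ge_pow (n : nat) t : 0 <= t -> (t / n.+1%:R) ^+ n.+1 <= expR t.
Proof.
move=> t0; rewrite -[X in expR X](@divfK _ n.+1%:R) ?pnatr_eq0// [X in expR X]mulrC.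
rewrite expRM_natl lerXn2r ?nnegrE ?divr_ge0 ?expR_ge0//.
by rewrite (le_trans _ (expR_ge1Dx _))// lerDr.
Qed.

(** The order 2 is what makes the difference quotient at 0 tend to 0. *)
Lemma flatp_small P : exists2 C, 0 <= C & forall x, 0 < x -> x <= 1 ->
  `|flatp P x| <= C * x ^+ 2.
Proof.
(* The exponential is compared with the power [size P + 2] of [t = 1 / x]: the polynomial uses up
   [size P] of them, and two are left for [x ^+ 2]. *)
pose n := (size P).+1.
pose C0 := \sum_(i < size P) `|P`_i|.
have C00 : 0 <= C0 by rewrite sumr_ge0.
exists (C0 * n.+1%:R ^+ n.+1); first by rewrite mulr_ge0// exprn_ge0.
move=> x x0 x1; rewrite /flatp x0 normrM (ger0_norm (expR_ge0 _)) expRN.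
set t := x^-1; have t1 : 1 <= t by rewrite invf_ge1.
have t0 : 0 < t by rewrite invr_gt0.
have -> : x = t^-1 by rewrite invrK.
have Pt : `|P.[t]| <= C0 * t ^+ (size P).-1.
  rewrite horner_coef (le_trans (ler_norm_sum _ _ _))// mulr_suml ler_sum// => i _.
  rewrite normrM ler_wpM2l// normrX gtr0_norm// ler_weXn2l//.
  by rewrite -ltnS (leq_trans (ltn_ord i))// leqSpred.
have Pt' : `|P.[t]| <= C0 * t ^+ (size P).
  by rewrite (le_trans Pt)// ler_wpM2l// ler_weXn2l// leq_pred.
have et := expR_ge_pow n (ltW t0).
rewrite (le_trans (ler_wpM2r _ Pt'))// ?invr_ge0 ?expR_ge0//.
rewrite -mulrA -[leRHS]mulrA ler_wpM2l// ler_pdivrMr ?expR_gt0//.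
rewrite -ler_pdivrMl; last by rewrite mulr_gt0 ?exprn_gt0 ?invr_gt0.
apply: le_trans et; rewrite expr_div_n [leRHS]mulrC.
rewrite invfM exprVn invrK -mulrA ler_wpM2l ?invr_ge0 ?exprn_ge0//.
by rewrite -exprD add2n.
Qed.

Lemma flatp_derive P x : is_derive x (1 : R) (flatp P) (flatp ('X^2 * (P - P^`())) x).
Proof.
have [x0|x0|->] := ltgtP x 0.
- rewrite {2}/flatp ltNge (ltW x0)/=.
  have d0 : is_derive x (1 : R) (cst (0 : R)) 0 by exact: is_derive_cst.
  apply: near_eq_is_derive d0.
  near=> y; rewrite /flatp ltNge (_ : y <= 0)//; near: y.
  by exists (- x) => //=; [rewrite oppr_gt0|move=> y /=; rewrite ltr_norml => /andP[]; lra].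
- rewrite {2}/flatp x0.
  have dV : is_derive x (1 : R) (fun y : R => y^-1) (- x ^- 2).
    apply: (@is_derive_eq _ _ _ _ _ _ _ (- (x) ^- 2 *: (1 : R))).
      by apply: is_deriveV; rewrite ?gt_eqF//; exact: is_derive_id.
    by rewrite /GRing.scale/= mulr1.
  have d1 : is_derive x (1 : R) (fun y => P.[y^-1]) (P^`().[x^-1] * - x ^- 2).
    exact: (@is_derive1_comp R (horner P) (fun y => y^-1)).
  have d2 : is_derive x (1 : R) (fun y => expR (- y^-1)) (expR (- x^-1) * x ^- 2).
    apply: (@is_derive1_comp R expR (fun y => - y^-1)).
    by apply: (@is_derive_eq _ _ _ _ _ _ _ (- - x ^- 2)); rewrite opprK.
  have d3 : is_derive x (1 : R) (fun x => P.[x^-1] * expR (- x^-1))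
      (('X^2 * (P - P^`())).[x^-1] * expR (- x^-1)).
    apply: (@is_derive_eq _ _ _ _ _ _ _ (P.[x^-1] *: (expR (- x^-1) * x ^- 2) + expR (- x^-1) *: (P^`().[x^-1] * - x ^- 2))).
      exact: is_deriveM.
    rewrite hornerM hornerXn hornerD hornerN exprVn /GRing.scale/=.
    by move: (_ ^-1) (expR _) (P.[_]) (P^`().[_]) => a b c d; ring.
  apply: near_eq_is_derive d3.
  near=> y; rewrite /flatp (_ : 0 < y)//; near: y.
  by exists x => //= y /=; rewrite ltr_norml => /andP[]; lra.
- have [C C0 HC] := flatp_small P.
  rewrite {2}/flatp ltxx.
  have cv : (fun h : R => h^-1 *: (flatp P (h *: (1 : R) + 0) - flatp P 0)) @ 0^' --> (0 : R).
    apply/cvgr0Pnorm_lt => e e0.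
    have eC : 0 < (C + 1)^-1 * e by rewrite mulr_gt0 ?invr_gt0 ?ltr_wpDl.
    near=> h; rewrite addr0 /GRing.scale/= mulr1 {2}/flatp ltxx subr0.
    have [h0|h0] := ltP 0 h; last by rewrite /flatp (ltNge 0 h) h0 mulr0 normr0.
    rewrite normrM gtr0_norm ?invr_gt0// (@le_lt_trans _ _ (C * h))//.
      rewrite ler_pdivrMl// (le_trans (HC _ h0 _))//; last by rewrite mulrCA mulrC -mulrA.
      near: h; apply: filterS (dnbhs0_le (@ltr01 R)) => y.
      exact: le_trans (ler_norm _).
    rewrite (@le_lt_trans _ _ ((C + 1) * h))// ?ler_pM2r ?lerDl// -ltr_pdivlMl ?ltr_wpDl//.
    near: h; apply: filterS (dnbhs0_lt eC) => y.
    exact: le_lt_trans (ler_norm _).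
  apply: DeriveDef; first by apply/cvg_ex; exists 0.
  exact/cvg_lim.
Unshelve. all: by end_near. Qed.

Definition flat := flatp 1.

Lemma Cinf_flat : Cinf flat.
Proof.
exists (fun n => flatp (iter n (fun P => 'X^2 * (P - P^`())) 1)).
by split => // n x; exact: flatp_derive.
Qed.

Lemma flat_gt0 x : 0 < x -> 0 < flat x.
Proof. by move=> x0; rewrite /flat /flatp x0 hornerC mul1r expR_gt0. Qed.

Lemma flat_le0 x : x <= 0 -> flat x = 0.
Proof. by move=> x0; rewrite /flat /flatp ltNge x0. Qed.

Lemma flat_ge0 x : 0 <= flat x.
Proof. by have [/flat_le0 ->//|/flat_gt0/ltW] := leP x 0. Qed.

Lemma flat_le1 x : flat x <= 1.
Proof.
rewrite /flat /flatp; case: ifPn => // x0; rewrite hornerC mul1r.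
by rewrite -expR0 ler_expR oppr_le0 invr_ge0 ltW.
Qed.

Lemma flat_cvg x : 0 < x -> flat (n.+1%:R * x) @[n --> \oo] --> (1 : R).
Proof.
move=> x0.
have -> : (fun n => flat (n.+1%:R * x)) = (fun n => expR (- (x^-1 * n.+1%:R^-1))).
  apply/funext => n; rewrite /flat /flatp mulr_gt0// hornerC mul1r invfM.
  by rewrite mulrC.
rewrite -[X in _ --> X]expR0; apply: continuous_cvg; first exact: continuous_expR.
rewrite -[X in _ --> X]oppr0; apply: cvgN.
rewrite -[X in _ --> X](mulr0 x^-1); apply: cvgM; first exact: cvg_cst.
exact: cvg_harmonic.
Qed.

Lemma flatp_bounded P : exists M, forall x, `|flatp P x| <= M.
Proof.
have [C C0 HC] := flatp_small P.
exists (C + \sum_(i < size P) `|P`_i|) => x.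
have S0 : 0 <= \sum_(i < size P) `|P`_i| by rewrite sumr_ge0.
have [x0|x0] := leP x 0; first by rewrite /flatp (ltNge 0 x) x0 normr0 addr_ge0.
have [x1|x1] := leP x 1.
  rewrite (le_trans (HC _ x0 x1))// (@le_trans _ _ C) ?lerDl//.
  by rewrite ler_piMr// exprn_ile1// ltW.
rewrite /flatp x0 normrM (ger0_norm (expR_ge0 _)) (@le_trans _ _ `|P.[x^-1]|)//.
  by rewrite ler_piMr// -expR0 ler_expR oppr_le0 invr_ge0 ltW.
rewrite (@le_trans _ _ (\sum_(i < size P) `|P`_i|)) ?lerDr//.
rewrite horner_coef (le_trans (ler_norm_sum _ _ _))// ler_sum// => i _.
rewrite normrM ler_piMr// normrX exprn_ile1// gtr0_norm ?invr_gt0//.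
by rewrite invf_le1// ltW.
Qed.

Lemma lipschitz_of_derive F F' M : (forall x, is_derive x (1 : R) F (F' x)) ->
  (forall x, `|F' x| <= M) -> forall a b, `|F a - F b| <= M * `|a - b|.
Proof.
move=> dF bF; suff H a b : a <= b -> `|F a - F b| <= M * `|a - b|.
  move=> a b; have [ab|/ltW ba] := leP a b; first exact: H.
  by rewrite distrC (distrC a b); exact: H.
move=> ab; rewrite distrC (distrC a b).
have [|c _ ->] := @MVT_segment R F F' a b ab (fun x _ => dF x).
  apply/continuous_subspaceT => x; apply/differentiable_continuous/derivable1_diffP.
  by have [] := dF x.
by rewrite normrM ler_wpM2r.
Qed.

(** [softplus] is a smooth approximation of [max x 0], uniformly within [ln 2], with derivative
    [logistic]. As [logistic' = logistic (1 - logistic)], all further derivatives are polynomials in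
    [logistic]. *)
Definition logistic x := 1 - (1 + expR x)^-1.
Definition softplus x := ln (1 + expR x).

Lemma expR1_gt0 x : 0 < 1 + expR x. Proof. by rewrite addr_gt0// expR_gt0. Qed.

Lemma logistic_derive x :
  is_derive x (1 : R) logistic (logistic x * (1 - logistic x)).
Proof.
have e0 := expR1_gt0 x.
have d1 : is_derive x (1 : R) (fun y => 1 + expR y) (expR x).
  by apply: (@is_derive_eq _ _ _ _ _ _ _ (0 + expR x)); rewrite add0r.
have d2 : is_derive x (1 : R) (fun y => (1 + expR y)^-1) (- (1 + expR x) ^- 2 *: expR x).
  by apply: is_deriveV; rewrite ?gt_eqF.
apply: (@is_derive_eq _ _ _ _ _ _ _ (0 - (- (1 + expR x) ^- 2 *: expR x))).
rewrite /logistic /GRing.scale/=; field; rewrite gt_eqF//.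
Qed.

Lemma softplus_derive x : is_derive x (1 : R) softplus (logistic x).
Proof.
have e0 := expR1_gt0 x.
have d1 : is_derive x (1 : R) (fun y => 1 + expR y) (expR x).
  by apply: (@is_derive_eq _ _ _ _ _ _ _ (0 + expR x)); rewrite add0r.
apply: (@is_derive_eq _ _ _ _ _ _ _ ((1 + expR x)^-1 * expR x)).
  by apply: is_derive1_comp; exact: is_derive1_ln.
by rewrite /logistic; field; rewrite gt_eqF.
Qed.

Lemma Cinf_softplus : Cinf softplus.
Proof.
pose Q n : {poly R} := iter n (fun Q => Q^`() * ('X - 'X^2)) 'X.
exists (fun n x => if n is m.+1 then (Q m).[logistic x] else softplus x).
split => // -[|n] x; first by rewrite /Q/= hornerX; exact: softplus_derive.
apply: (@is_derive_eq _ _ _ _ _ _ _ ((Q n)^`().[logistic x] * (logistic x * (1 - logistic x)))).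
  by apply: is_derive1_comp; exact: logistic_derive.
by rewrite /Q/= hornerM hornerD hornerN hornerX hornerXn; ring.
Qed.

Lemma logistic_ge0 x : 0 <= logistic x.
Proof. by rewrite subr_ge0 invf_le1 ?expR1_gt0// lerDl expR_ge0. Qed.

Lemma logistic_le1 x : logistic x <= 1.
Proof. by rewrite lerBlDr lerDl invr_ge0 ltW// expR1_gt0. Qed.

Lemma le_logistic x y : x <= y -> logistic x <= logistic y.
Proof.
move=> xy; rewrite lerD2l lerN2 lef_pV2 ?posrE ?expR1_gt0//.
by rewrite lerD2l ler_expR.
Qed.

Lemma logisticN x : logistic (- x) = 1 - logistic x.
Proof.
rewrite /logistic expRN; have := expR_gt0 x => e0; have := expR1_gt0 x => e1.
by field; rewrite !gt_eqF// addrC.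
Qed.

Lemma logistic_near1 x : 0 < x -> 1 - logistic x <= x^-1.
Proof.
move=> x0; rewrite /logistic subKr lef_pV2 ?posrE ?expR1_gt0//.
by have := expR_ge1Dx x; lra.
Qed.

(** The value 1/2 at 0 is the limit of the rescaled [logistic] there, so that convergence holds at
    every point. *)
Definition heaviside x : R := if 0 < x then 1 else if x == 0 then 2^-1 else 0.

Lemma logistic_cvg x : logistic (n.+1%:R * x) @[n --> \oo] --> heaviside x.
Proof.
have pos y : 0 < y -> logistic (n.+1%:R * y) @[n --> \oo] --> (1 : R).
  move=> y0; apply/cvgrPdist_le => e e0.
  have ey : 0 < e / y^-1 by rewrite divr_gt0 ?invr_gt0.
  near=> n.
  rewrite ger0_norm ?subr_ge0 ?logistic_le1//.
  rewrite (le_trans (logistic_near1 _)) ?mulr_gt0// invfM -ler_pdivlMr ?invr_gt0//.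
  by near: n; apply: filterS (near_infty_natSinv_lt (PosNum ey)) => m /ltW.
rewrite /heaviside; have [x0|x0|<-] := ltgtP 0 x; first exact: pos.
  rewrite (_ : (fun n => _) = (fun n => 1 - logistic (n.+1%:R * - x))).
    rewrite -[X in _ --> X](subrr 1); apply: cvgB; first exact: cvg_cst.
    by apply: pos; rewrite oppr_gt0.
  by apply/funext => n; rewrite -logisticN mulrN opprK.
rewrite (_ : (fun n => _) = cst 2^-1); first exact: cvg_cst.
by apply/funext => n; rewrite mulr0 /logistic expR0/=; field.
Unshelve. all: by end_near. Qed.

Lemma softplus_bounds x : Num.max x 0 <= softplus x <= Num.max x 0 + ln 2.
Proof.
have e0 := expR_gt0 x; apply/andP; split.
  rewrite ge_max; apply/andP; split.
    by rewrite -{1}(expRK x) ler_ln ?posrE ?expR1_gt0// lerDr.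
  by rewrite ln_ge0// lerDl ltW.
rewrite -(expRK (Num.max x 0)) -lnM ?posrE ?expR_gt0// ler_ln ?posrE ?expR1_gt0 ?mulr_gt0 ?expR_gt0//.
rewrite mulr_natr mulr2n; apply: lerD; last by rewrite ler_expR le_max lexx.
by rewrite -expR0 ler_expR le_max lexx orbT.
Qed.

(** From [trunc k x = max (x + k) 0 - max (x - k) 0 - k], where [max y 0] is replaced by
    [softplus (m y) / m] with [m = n + 1]; the error is uniform, of order [1 / m]. *)
Definition smooth_trunc (k : R) (n : nat) x :=
  n.+1%:R^-1 * (softplus (n.+1%:R * x + n.+1%:R * k) -
                softplus (n.+1%:R * x + n.+1%:R * - k)) - k.

Definition smooth_trunc' (k : R) (n : nat) x :=
  logistic (n.+1%:R * (x + k)) - logistic (n.+1%:R * (x - k)).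

(** The limit of the derivatives of the smooth truncations: the derivative of [trunc k], with the
    value 1/2 at its two corners when [0 < k]. [level_null] exploits that this value is not 1. *)
Definition theta (k x : R) := heaviside (x + k) - heaviside (x - k).

Lemma Cinf_smooth_trunc k n : Cinf (smooth_trunc k n).
Proof.
rewrite /smooth_trunc; apply: CinfD; last exact: Cinf_cst.
apply/CinfZ/CinfD; first exact/Cinf_affine/Cinf_softplus.
rewrite (_ : (fun x => - _) = (fun x => -1 * softplus (n.+1%:R * x + n.+1%:R * - k))).
  by apply/CinfZ/Cinf_affine/Cinf_softplus.
by apply/funext => x; rewrite mulN1r.
Qed.

Lemma smooth_trunc_derive k n x :
  is_derive x (1 : R) (smooth_trunc k n) (smooth_trunc' k n x).
Proof.
have da c : is_derive x (1 : R) (fun y => softplus (n.+1%:R * y + c)) (logistic (n.+1%:R * x + c) * n.+1%:R).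
  apply: (@is_derive1_comp R softplus (fun y => n.+1%:R * y + c)).
    exact: softplus_derive.
  exact: affine_derive.
have d1 := da (n.+1%:R * k); have d2 := da (n.+1%:R * - k).
apply: (@is_derive_eq _ _ _ _ _ _ _ (n.+1%:R^-1 *: (logistic (n.+1%:R * x + n.+1%:R * k) * n.+1%:R - logistic (n.+1%:R * x + n.+1%:R * - k) * n.+1%:R) - 0)).
by rewrite subr0 -mulrBl /GRing.scale/= [_ * _%:R]mulrC mulKf// -!mulrDr.
Qed.

Lemma smooth_trunc'_ge0 k n x : 0 <= k -> 0 <= smooth_trunc' k n x.
Proof.
move=> k0; rewrite subr_ge0 le_logistic// ler_pM2l//; lra.
Qed.

Lemma smooth_trunc'_le1 k n x : smooth_trunc' k n x <= 1.
Proof. by rewrite /smooth_trunc'; have := logistic_le1 (n.+1%:R * (x + k)); have := logistic_ge0 (n.+1%:R * (x - k)); lra. Qed.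

Lemma smooth_trunc'_norm k n x : 0 <= k -> `|smooth_trunc' k n x| <= 1.
Proof. by move=> k0; rewrite ger0_norm ?smooth_trunc'_ge0// smooth_trunc'_le1. Qed.

Lemma logistic_lipschitz a b : `|logistic a - logistic b| <= 1 * `|a - b|.
Proof.
apply: (lipschitz_of_derive logistic_derive) => x.
have := logistic_ge0 x; have := logistic_le1 x; move: (logistic x) => t t1 t0.
rewrite ger0_norm ?mulr_ge0 ?subr_ge0//; nra.
Qed.

Lemma smooth_trunc'_lipschitz k n a b :
  `|smooth_trunc' k n a - smooth_trunc' k n b| <= 2 * n.+1%:R * `|a - b|.
Proof.
have H c : `|logistic (n.+1%:R * (a + c)) - logistic (n.+1%:R * (b + c))| <= n.+1%:R * `|a - b|.
  rewrite (le_trans (logistic_lipschitz _ _))// mul1r -mulrBr normrM (ger0_norm (ler0n _ _)).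
  by rewrite opprD addrACA subrr addr0.
have := H k; have := H (- k); rewrite /smooth_trunc'.
set a1 := logistic _; set a2 := logistic _; set a3 := logistic _; set a4 := logistic _.
move=> h1 h2; rewrite (_ : a3 - a1 - (a4 - a2) = (a3 - a4) - (a1 - a2)); last by ring.
by rewrite (le_trans (ler_normB _ _))// -mulrA mulr_natl mulr2n lerD.
Qed.

Lemma smooth_trunc_cvg' k x : smooth_trunc' k n x @[n --> \oo] --> theta k x.
Proof. by apply: cvgB; exact: logistic_cvg. Qed.

Lemma smooth_trunc_near k n x : 0 <= k ->
  `|smooth_trunc k n x - trunc k x| <= ln 2 / n.+1%:R.
Proof.
move=> k0; have -> : trunc k x = Num.max (x + k) 0 - Num.max (x - k) 0 - k.
  rewrite /trunc; have [xk|kx] := leP x k.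
    rewrite [Num.max (x - k) 0]max_r ?subr_le0// subr0.
    have [h|h] := leP (- k) x; first by rewrite max_l; lra.
    by rewrite max_r; lra.
  rewrite max_r; last by lra.
  by rewrite !max_l; lra.
have := softplus_bounds (n.+1%:R * x + n.+1%:R * k).
have := softplus_bounds (n.+1%:R * x + n.+1%:R * - k).
have mm c : Num.max (n.+1%:R * x + n.+1%:R * c) 0 = n.+1%:R * Num.max (x + c) 0.
  by rewrite -mulrDr -{1}(mulr0 n.+1%:R) maxr_pMr.
rewrite !mm.
rewrite /smooth_trunc; set m : R := n.+1%:R.
have m0 : 0 < m by rewrite ltr0n.
set A := Num.max _ _; set B := Num.max _ _; set a := softplus _; set b := softplus _.
move=> /andP[b1 b2] /andP[a1 a2].
rewrite [X in `|X|](_ : _ = m^-1 * ((b - a) - (m * B - m * A))); last first.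
  by field; rewrite gt_eqF.
rewrite normrM gtr0_norm ?invr_gt0// mulrC ler_pM2r ?invr_gt0// ler_norml.
by apply/andP; split; lra.
Qed.

End one_dimensional.

(** * Integration *)

Section real_integrals.
Context d {T : measurableType d} {R : realType}.
Variable (mu : {measure set T -> \bar R}).
Implicit Types (D : set T) (f g : T -> R).

Definition L1 D f := mu.-integrable D (EFin \o f).

Lemma L1_measurable D f : measurable D -> L1 D f -> measurable_fun D f.
Proof. by move=> mD /measurable_int /measurable_EFinP. Qed.

Lemma L1D D f g : measurable D -> L1 D f -> L1 D g -> L1 D (fun x => f x + g x).
Proof. by move=> mD If Ig; have := integrableD mD If Ig. Qed.

Lemma L1B D f g : measurable D -> L1 D f -> L1 D g -> L1 D (fun x => f x - g x).
Proof. by move=> mD If Ig; have := integrableB mD If Ig. Qed.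

Lemma L1Z D f (c : R) : measurable D -> L1 D f -> L1 D (fun x => c * f x).
Proof. by move=> mD If; have := integrableZl mD c If. Qed.

Lemma L1N D f : measurable D -> L1 D f -> L1 D (fun x => - f x).
Proof.
move=> mD /(@L1Z _ _ (-1) mD); rewrite (_ : (fun x => -1 * f x) = (fun x => - f x))//.
by apply/funext => x; rewrite mulN1r.
Qed.

Lemma L1_norm D f : L1 D f -> L1 D (fun x => `|f x|).
Proof. by move=> If; exact: integrable_norm If. Qed.

Lemma L1_sum D (I : Type) (r : seq I) (F : I -> T -> R) : measurable D ->
  (forall i, L1 D (F i)) -> L1 D (fun x => \sum_(i <- r) F i x).
Proof.
move=> mD IF; elim: r => [|i r IH].
  under eq_fun do rewrite big_nil.
  exact: integrable0.
by under eq_fun do rewrite big_cons; exact: L1D.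
Qed.

Lemma L1_le D f g : measurable D -> measurable_fun D f ->
  (forall x, D x -> `|f x| <= g x) -> L1 D g -> L1 D f.
Proof.
move=> mD mf fg; apply: le_integrable => //; first exact/measurable_EFinP.
by move=> x Dx /=; rewrite lee_fin (le_trans (fg _ Dx))// ler_norm.
Qed.

Lemma L1_mul D f (h : T -> R) (M : R) : measurable D -> measurable_fun D h ->
  (forall x, D x -> `|h x| <= M) -> L1 D f -> L1 D (fun x => h x * f x).
Proof.
move=> mD mh hM If; apply: (@L1_le _ _ (fun x => M * `|f x|)) => //.
- by apply: measurable_funM => //; exact: L1_measurable.
- by move=> x Dx; rewrite normrM ler_wpM2r// hM.
- exact/L1Z/L1_norm.
Qed.

Lemma L1_bounded D f (M : R) : measurable D -> (mu D < +oo)%E ->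
  measurable_fun D f -> (forall x, D x -> `|f x| <= M) -> L1 D f.
Proof.
move=> mD fD mf fM; apply: measurable_bounded_integrable => //.
exists M; split; first exact: num_real.
by move=> M' MM' x Dx /=; exact: le_trans (fM _ Dx) (ltW MM').
Qed.

Lemma L1S D E f : measurable D -> measurable E -> D `<=` E -> L1 E f -> L1 D f.
Proof. by move=> mD mE DE; exact: integrableS. Qed.

Lemma EFin_Rintegral D f : measurable D -> L1 D f ->
  (\int[mu]_(x in D) f x)%:E = (\int[mu]_(x in D) (f x)%:E)%E.
Proof. by move=> mD If; rewrite /Rintegral fineK// integrable_fin_num. Qed.

Lemma Rintegral_ae D f g : measurable D -> measurable_fun D f -> measurable_fun D g ->
  {ae mu, forall x, D x -> f x = g x} ->
  \int[mu]_(x in D) f x = \int[mu]_(x in D) g x.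
Proof.
move=> mD mf mg fg; congr fine; apply: ae_eq_integral => //; try exact/measurable_EFinP.
by apply: filterS fg => x h Dx; rewrite /= h.
Qed.

Lemma L1_ae D f g : measurable D -> measurable_fun D g ->
  {ae mu, forall x, D x -> f x = g x} -> L1 D f -> L1 D g.
Proof.
move=> mD mg fg If; have mf := L1_measurable mD If.
apply/integrableP; split; first exact/measurable_EFinP.
have [_] := integrableP _ _ _ If; rewrite (ae_eq_integral (abse \o (EFin \o g)))//.
- by do 2 apply: measurableT_comp => //.
- by do 2 apply: measurableT_comp => //.
- by apply: filterS fg => x h Dx; rewrite /= h.
Qed.

Lemma le_Rint_norm D f g : measurable D -> L1 D f -> L1 D g ->
  \int[mu]_(x in D) `|f x + g x| <= \int[mu]_(x in D) `|f x| + \int[mu]_(x in D) `|g x|.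
Proof.
move=> mD If Ig; rewrite -RintegralD//; [|exact: L1_norm|exact: L1_norm].
apply: le_Rintegral => //.
- exact/L1_norm/L1D.
- by apply: L1D => //; exact: L1_norm.
- by move=> x Dx; exact: ler_normD.
Qed.

Lemma Rint_dominated D (fs : nat -> T -> R) f g : measurable D ->
  (forall n, measurable_fun D (fs n)) -> measurable_fun D f ->
  {ae mu, forall x, D x -> fs n x @[n --> \oo] --> f x} ->
  L1 D g -> {ae mu, forall x, D x -> forall n, `|fs n x| <= g x} ->
  [/\ L1 D f, \int[mu]_(x in D) `|fs n x - f x| @[n --> \oo] --> (0 : R) &
     \int[mu]_(x in D) fs n x @[n --> \oo] --> \int[mu]_(x in D) f x].
Proof.
move=> mD mfs mf cv Ig dom.
have dom' : {ae mu, forall x n, D x -> (`|(EFin \o fs n) x| <= (EFin \o g) x)%E}.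
  by apply: filterS dom => x h n Dx /=; rewrite lee_fin h.
have cv' : {ae mu, forall x, D x -> (EFin \o fs n) x @[n --> \oo] --> (EFin \o f) x}.
  by apply: filterS cv => x h Dx /=; apply: cvg_EFin; [exact: nearW|exact: h].
have [If c1 c2] := @dominated_convergence _ _ _ mu D mD (fun n => EFin \o fs n)
  (EFin \o f) (EFin \o g) (fun n => proj2 (measurable_EFinP _ _) (mfs n))
  (proj2 (measurable_EFinP _ _) mf) cv' Ig dom'.
split => //.
  exact: (fine_cvg c1).
by move: c2; rewrite -EFin_Rintegral// => c2; exact: (fine_cvg c2).
Qed.

Lemma Rint_eq0_ae D f : measurable D -> L1 D f ->
  {ae mu, forall x, D x -> 0 <= f x} -> \int[mu]_(x in D) f x <= 0 ->
  {ae mu, forall x, D x -> f x = 0}.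
Proof.
move=> mD If f0 int0.
have mf := L1_measurable mD If.
have fE : \int[mu]_(x in D) `|f x| = \int[mu]_(x in D) f x.
  apply: Rintegral_ae => //; first exact: measurableT_comp.
  by apply: filterS f0 => x h Dx; rewrite ger0_norm ?h.
have : (\int[mu]_(x in D) `|(f x)%:E|)%E = 0%E.
  transitivity (\int[mu]_(x in D) `|f x|)%:E.
    by rewrite EFin_Rintegral//; exact: L1_norm.
  congr EFin; apply/eqP; rewrite eq_le {1}fE int0/=.
  exact: Rintegral_ge0.
have mEf : measurable_fun D (EFin \o f) by exact/measurable_EFinP.
move/(ae_eq_integral_abs mu mD mEf) => ae0.
by apply: filterS ae0 => x h Dx; have /= := h Dx => -[].
Qed.

Lemma ae_le_Rintegral D f g : measurable D -> L1 D f -> L1 D g ->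
  {ae mu, forall x, D x -> f x <= g x} ->
  \int[mu]_(x in D) f x <= \int[mu]_(x in D) g x.
Proof.
move=> mD If Ig fg; have mf := L1_measurable mD If; have mg := L1_measurable mD Ig.
have mm : measurable_fun D (fun x => Num.min (f x) (g x)) by exact: measurable_minr.
have aem : {ae mu, forall x, D x -> f x = Num.min (f x) (g x)}.
  by apply: filterS fg => x h Dx; rewrite min_l// h.
rewrite (Rintegral_ae mD mf mm aem); apply: le_Rintegral => //; first exact: L1_ae If.
by move=> x Dx; rewrite ge_min lexx orbT.
Qed.

End real_integrals.

(** * Derivatives along lines, integrals of partial derivatives *)

Section lines.
Context {R : realType} {N : nat}.
Local Notation V := 'rV[R]_N.
Implicit Types (f : V -> R) (x v : V).

Lemma derive_partial f v x : differentiable f x ->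
  'D_v f x = \sum_(i < N) v ord0 i * partial i f x.
Proof.
move=> df; rewrite deriveE// {1}[v]row_sum_delta linear_sum/=.
by apply: eq_bigr => i _; rewrite linearZ/= -deriveE.
Qed.

Lemma line_derive f x v (t : R) : smooth f ->
  is_derive t (1 : R) (fun s => f (x + s *: v)) ('D_v f (x + t *: v)).
Proof.
move=> sf; have dv : derivable f (x + t *: v) v by exact: smooth_derivable.
have E : (fun h : R => h^-1 *: (((fun s : R => f (x + s *: v)) \o shift t) (h *: (1 : R)) - f (x + t *: v))) =
   (fun h : R => h^-1 *: ((f \o shift (x + t *: v)) (h *: v) - f (x + t *: v))).
  apply/funext => h /=; congr (_ *: (f _ - _)).
  by rewrite [h%:A]mulr1 scalerDl addrCA.
split; first by rewrite /derivable E.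
by rewrite /derive E.
Qed.

Lemma line_mvt f x v (t : R) : smooth f -> 0 <= t ->
  exists2 s, 0 <= s <= t & f (x + t *: v) - f x = t * 'D_v f (x + s *: v).
Proof.
move=> sf t0; have [|s s0t E] := @MVT_segment R (fun s => f (x + s *: v))
    (fun s => 'D_v f (x + s *: v)) 0 t t0 (fun s _ => line_derive x v s sf).
  apply/continuous_subspaceT => s; apply/differentiable_continuous/derivable1_diffP.
  by have [] := line_derive x v s sf.
exists s; first by move: s0t; rewrite in_itv.
by move: E; rewrite scale0r addr0 subr0 mulrC.
Qed.

Lemma smooth_measurable f (D : set (lebesgue_space R N)) : smooth f -> measurable_fun D f.
Proof.
move=> sf; apply: measurable_funTS.
by apply: (continuous_measurable_om leb_half); exact: smooth_continuous.
Qed.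

Lemma compact_cube (K : set V) : compact K -> exists2 r, 0 < r & K `<=` cube 0 r.
Proof.
move=> /compact_bounded[M [_ HM]]; exists (Num.max M 0 + 1).
  by rewrite ltr_wpDl// le_max lexx orbT.
move=> x /(HM (Num.max M 0 + 1)); rewrite /cube/= subr0; apply.
by rewrite (@le_lt_trans _ _ (Num.max M 0)) ?le_max ?lexx// ltrDl.
Qed.

Lemma cube_compact (c : V) r : compact (cube c r).
Proof.
apply: bounded_closed_compact; last exact: closed_cube.
exists (`|c| + r); split; first exact: num_real.
move=> M rM x xc /=; rewrite (le_trans _ (ltW rM))//.
by rewrite -(subrK c x) addrC (le_trans (ler_normD _ _))// lerD2l.
Qed.

Lemma continuous_bounded_compact f (K : set V) : continuous f -> compact K ->
  exists2 M, 0 <= M & forall x, K x -> `|f x| <= M.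
Proof.
move=> cf cK.
have /compact_bounded[M [_ HM]] : compact (f @` K).
  by apply: continuous_compact => //; exact: continuous_subspaceT.
exists (Num.max M 0 + 1); first by rewrite addr_ge0// le_max lexx orbT.
move=> x Kx; apply: (HM (Num.max M 0 + 1)); last by exists x.
by rewrite (@le_lt_trans _ _ (Num.max M 0)) ?le_max ?lexx// ltrDl.
Qed.

Lemma support_bounded f (K : set V) : continuous f -> compact K ->
  (forall x, ~ K x -> f x = 0) -> exists2 M, 0 <= M & forall x, `|f x| <= M.
Proof.
move=> cf cK f0; have [M M0 HM] := continuous_bounded_compact cf cK.
exists M => // x; have [/HM//|nK] := pselect (K x).
by rewrite f0// normr0.
Qed.

Lemma partial_support f (K : set V) i x : compact K ->
  (forall x, ~ K x -> f x = 0) -> ~ K x -> partial i f x = 0.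
Proof.
move=> cK f0 nK.
have oK : open (~` K) by apply: closed_openC; apply: compact_closed => //; exact: Rhausdorff.
have e : \forall y \near x, cst (0 : R) y = f y.
  have := open_nbhs_nbhs (conj oK nK).
  by apply: filterS => y /f0 ->.
have [] := near_eq_is_derive e (is_derive_cst (0 : R) x (delta_mx ord0 i)).
by [].
Qed.

Lemma L1_support f (K : set V) (D : set (lebesgue_space R N)) :
  continuous f -> compact K -> (forall x, ~ K x -> f x = 0) ->
  measurable D -> L1 (leb R N) D f.
Proof.
move=> cf cK f0 mD; have [r r0 Kr] := compact_cube cK.
have [M M0 HM] := support_bounded cf cK f0.
have mf E : measurable_fun (E : set (lebesgue_space R N)) f.
  by apply: measurable_funTS; exact: (continuous_measurable_om leb_half).
apply: (@L1S _ _ _ _ _ setT) => //.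
have : L1 (leb R N) (cube 0 r) f.
  apply: (@L1_bounded _ _ _ _ _ _ M) => //; first exact: measurable_cube.
  exact: leb_cube_fin.
rewrite /L1 (integrable_mkcond _ (measurable_cube 0 r)).
rewrite (_ : _ \_ _ = EFin \o f)//; apply/funext => x; rewrite /patch.
case: ifPn => //; rewrite notin_setE => nx /=; rewrite f0// => /Kr.
exact: nx.
Qed.

Lemma Rintegral_transl f t : L1 (leb R N) setT f ->
  \int[leb R N]_(x in setT) f (x + t) = \int[leb R N]_(x in setT) f x.
Proof.
move=> If; rewrite /Rintegral; congr fine.
rewrite -(integral_transl t measurableT (measurable_int _ If)).
by rewrite preimage_setT.
Qed.

(** The difference quotients of [f] have integral 0 by translation invariance. They converge to the
    partial derivative and are dominated by a constant on a cube around the supports. *)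
Lemma Rintegral_partial0 f (K : set V) i : smooth f -> compact K ->
  (forall x, ~ K x -> f x = 0) ->
  \int[leb R N]_(x in setT) partial i f x = 0.
Proof.
move=> sf cK f0.
have [r r0 Kr] := compact_cube cK.
have cf := smooth_continuous sf.
have spf := @smooth_partial _ _ f i sf.
have [M M0 HM] := support_bounded (smooth_continuous spf) cK (fun x => @partial_support f K i x cK f0).
pose e : V := delta_mx ord0 i.
have e1 : `|e| <= 1.
  apply/rV_norm_leP => // j; rewrite mxE; case: eqP => _ /=; rewrite ?andbT ?andbF ?normr0//.
  by case: eqP => _; rewrite ?normr0 ?normr1.
pose q (n : nat) x := n.+1%:R * (f (x + n.+1%:R^-1 *: e) - f x).
have If : L1 (leb R N) setT f by exact: (L1_support cf cK).
have Ift t : L1 (leb R N) setT (fun x => f (x + t)).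
  have st := @smooth_transl _ _ f t sf.
  have [Mf _ HMf] := support_bounded cf cK f0.
  apply: (@L1_support (f \o transl t) (cube 0 (r + `|t|))).
  - exact: smooth_continuous.
  - exact: cube_compact.
  - move=> x nx; apply: f0 => /Kr; rewrite /cube/= subr0 => h; apply: nx.
    rewrite /cube/= subr0 -(addrK t x) (le_trans (ler_normB _ _))//.
    by rewrite lerD2r.
  - exact: measurableT.
have q0 n : \int[leb R N]_(x in setT) q n x = 0.
  rewrite /q RintegralZl//; last exact: L1B.
  apply/eqP; rewrite mulf_eq0; apply/orP; right; apply/eqP.
  apply: (etrans (RintegralB measurableT (Ift _) If)).
  by apply/eqP; rewrite subr_eq0; apply/eqP; exact: Rintegral_transl.
have qE n x : exists2 s, 0 <= s <= n.+1%:R^-1 & q n x = partial i f (x + s *: e).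
  have [|s s01 E] := @line_mvt f x e n.+1%:R^-1 sf; first by rewrite invr_ge0.
  by exists s => //; rewrite /q E mulrA mulfV// mul1r.
have [||||||_ _] := @Rint_dominated _ _ R (leb R N) setT q (partial i f)
    (fun x => if x \in cube 0 (r + 1) then M else 0).
- exact: measurableT.
- move=> n; apply: (L1_measurable measurableT); apply: L1Z => //; exact: L1B.
- exact: smooth_measurable.
- apply/aeW => x _; apply/cvgrPdist_lt => eps eps0.
  have /cvgrPdist_lt/(_ _ eps0)/nbhs_ballP[dl /= dl0 Hdl] := smooth_continuous spf (x := x).
  near=> n; have [s /andP[s0 sn] ->] := qE n x.
  apply: Hdl; rewrite -ball_normE /ball_/= opprD addNKr normrN normrZ ger0_norm//.
  rewrite (@le_lt_trans _ _ (s * 1)) ?ler_wpM2l// mulr1 (le_lt_trans sn)//.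
  by near: n; exact: (near_infty_natSinv_lt (PosNum dl0)).
- have := @L1_bounded _ _ _ (leb R N) (cube 0 (r + 1)) (cst M) M (measurable_cube 0 (r + 1)) (leb_cube_fin _ _).
  move=> /(_ (measurable_cst _)) H.
  have : L1 (leb R N) (cube 0 (r + 1)) (cst M).
    by apply: H => x _; rewrite /= ger0_norm.
  rewrite /L1 (integrable_mkcond _ (measurable_cube 0 (r + 1))).
  rewrite (_ : _ \_ _ = EFin \o (fun x => if x \in cube 0 (r + 1) then M else 0))//.
  by apply/funext => x; rewrite /patch /=; case: ifP.
- apply/aeW => x _ n; case: ifPn => [_|].
    by have [s _ ->] := qE n x.
  rewrite notin_setE => nx.
  have nK y : `|y| <= n.+1%:R^-1 -> ~ K (x + y).
    move=> yn /Kr; rewrite /cube/= subr0 => h; apply: nx.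
    rewrite /cube/= subr0 -(addrK y x) (le_trans (ler_normB _ _))// lerD//.
    by rewrite (le_trans yn)// invf_le1// ler1n.
  rewrite /q !f0 ?subrr ?mulr0 ?normr0//.
    by rewrite -(addr0 x); apply: nK; rewrite normr0.
  by apply: nK; rewrite normrZ ger0_norm// ler_piMr.
by move=> cv; have /cvg_lim := cv; rewrite (_ : (fun n => _) = cst 0) ?lim_cst// => [<-//|]; apply/funext => n; rewrite q0.
Unshelve. all: by end_near. Qed.
End lines.

(** * Smooth approximations of indicators of boxes *)

Section bump.
Context {R : realType} {N : nat}.
Local Notation V := 'rV[R]_N.
Implicit Types (a b x : V).

Lemma compact_cbox a b : compact (cbox a b).
Proof.
rewrite (_ : cbox a b = [set v : V | forall i, `[a ord0 i, b ord0 i]%classic (v ord0 i)]).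
  exact: (@rV_compact R N (fun i => `[a ord0 i, b ord0 i]%classic) (fun i => @segment_compact R _ _)).
by apply/seteqP; split => x H i; move: (H i); rewrite /= in_itv.
Qed.

(** Each face contributes a flat factor that vanishes outside the box and tends to 1 inside it, so
    these smooth functions tend to the indicator of the open box. *)
Definition bump a b (n : nat) x : R :=
  \prod_(i < N) (flat (n.+1%:R * (x ord0 i - a ord0 i)) *
                 flat (n.+1%:R * (b ord0 i - x ord0 i))).

Lemma smooth_comp_Cinf (F : R -> R) (f : V -> R) : Cinf F -> smooth f -> smooth (F \o f).
Proof. by move=> [Fs [dF <-]] sf; exact: smooth_comp. Qed.

Lemma smooth_bump a b n : smooth (bump a b n).
Proof.
apply: smooth_prod => i; apply: smoothM.
  apply: (@smooth_comp_Cinf _ (fun x => n.+1%:R * (x ord0 i - a ord0 i))); first exact: Cinf_flat.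
  by apply: smoothM; [exact: smooth_cst|apply: smoothB; [exact: smooth_coord|exact: smooth_cst]].
apply: (@smooth_comp_Cinf _ (fun x => n.+1%:R * (b ord0 i - x ord0 i))); first exact: Cinf_flat.
by apply: smoothM; [exact: smooth_cst|apply: smoothB; [exact: smooth_cst|exact: smooth_coord]].
Qed.

Lemma bump_ge0 a b n x : 0 <= bump a b n x.
Proof. by apply: prodr_ge0 => i _; rewrite mulr_ge0// flat_ge0. Qed.

Lemma bump_le1 a b n x : bump a b n x <= 1.
Proof.
by apply: prodr_ile1 => i _; rewrite mulr_ge0 ?flat_ge0//= mulr_ile1 ?flat_ge0 ?flat_le1.
Qed.

Lemma bump_out a b n x : ~ obox a b x -> bump a b n x = 0.
Proof.
move=> /existsNP[i /negP]; rewrite negb_and -!leNgt => xi.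
rewrite /bump (bigD1 i)//=.
case/orP: xi => xi; last rewrite [X in _ * X * _]flat_le0 ?mulr0 ?mul0r//.
  by rewrite flat_le0 ?mul0r// mulr_ge0_le0// subr_le0.
by rewrite mulr_ge0_le0// subr_le0.
Qed.

Lemma bump_cvg a b x : bump a b n x @[n --> \oo] --> (\1_(obox a b) x : R).
Proof.
have [xab|xab] := pselect (obox a b x); last first.
  rewrite indicE memNset// (_ : (fun n => _) = cst 0); first exact: cvg_cst.
  by apply/funext => n; rewrite bump_out.
rewrite indicE mem_set//= /bump.
have H (r : seq 'I_N) : \prod_(i <- r) (flat (n.+1%:R * (x ord0 i - a ord0 i)) *
    flat (n.+1%:R * (b ord0 i - x ord0 i))) @[n --> \oo] --> (1 : R).
  elim: r => [|i r IH].
    by under eq_cvg do rewrite big_nil; exact: cvg_cst.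
  rewrite (_ : (fun n : nat => _) = (fun n : nat => flat (n.+1%:R * (x ord0 i - a ord0 i)) *
    flat (n.+1%:R * (b ord0 i - x ord0 i)) *
    \prod_(i <- r) (flat (n.+1%:R * (x ord0 i - a ord0 i)) *
    flat (n.+1%:R * (b ord0 i - x ord0 i))))); last first.
    by apply/funext => n; rewrite big_cons.
  have /andP[ai bi] := xab i.
  rewrite -[X in _ --> X]mulr1; apply: cvgM; last exact: IH.
  rewrite -[X in _ --> X]mulr1; apply: cvgM; apply: flat_cvg; by rewrite subr_gt0.
exact: H.
Qed.

(** The complement of a union is an intersection: the product of the [1 - bump] approximates the
    indicator of the complement of [m] boxes. *)
Definition ubump (ab : nat -> V * V) (m n : nat) x : R :=
  1 - \prod_(j < m) (1 - bump (ab j).1 (ab j).2 n x).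

Lemma smooth_ubump ab m n : smooth (ubump ab m n).
Proof.
apply: smoothB; first exact: smooth_cst.
by apply: smooth_prod => j; apply: smoothB; [exact: smooth_cst|exact: smooth_bump].
Qed.

Lemma ubump01 ab m n x : 0 <= ubump ab m n x <= 1.
Proof.
have H : 0 <= \prod_(j < m) (1 - bump (ab j).1 (ab j).2 n x) <= 1.
  elim/big_ind : _ => [|u v /andP[? ?] /andP[? ?]|j _]; first by rewrite ler01 lexx.
    by rewrite mulr_ge0//= mulr_ile1.
  by have := bump_ge0 (ab j).1 (ab j).2 n x; have := bump_le1 (ab j).1 (ab j).2 n x; lra.
by rewrite /ubump; lra.
Qed.

Definition uobox (ab : nat -> V * V) (m : nat) : set V :=
  [set x | exists2 j, (j < m)%N & obox (ab j).1 (ab j).2 x].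

Lemma ubump_cvg ab m x : ubump ab m n x @[n --> \oo] --> (\1_(uobox ab m) x : R).
Proof.
have H : \prod_(j < m) (1 - bump (ab j).1 (ab j).2 n x) @[n --> \oo] -->
   (\prod_(j < m) (1 - \1_(obox (ab j).1 (ab j).2) x) : R).
  elim: m => [|m IH].
    under eq_cvg do rewrite big_ord0.
    by rewrite big_ord0; exact: cvg_cst.
  under eq_cvg do rewrite big_ord_recr/=.
  rewrite big_ord_recr/=; apply: cvgM; first exact: IH.
  by apply: cvgB; [exact: cvg_cst|exact: bump_cvg].
have -> : \1_(uobox ab m) x = 1 - \prod_(j < m) (1 - \1_(obox (ab j).1 (ab j).2) x) :> R.
  have [[j jm xj]|nx] := pselect (uobox ab m x).
    rewrite indicE mem_set; last by exists j.
    by rewrite (bigD1 (Ordinal jm))//= indicE mem_set//= subrr mul0r subr0.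
  rewrite indicE memNset//= big1 ?subrr// => j _.
  rewrite indicE memNset//= ?subr0// => xj; apply: nx.
  by exists j.
by apply: cvgB => //; exact: cvg_cst.
Qed.

Lemma test_function_support (Om : set V) a b n (f : V -> R) : cbox a b `<=` Om ->
  smooth f -> test_function Om (fun x => f x * bump a b n x).
Proof.
move=> abO sf; split; first by apply: smoothM => //; exact: smooth_bump.
exists (cbox a b); split => //; first exact: compact_cbox.
move=> x nx; rewrite bump_out ?mulr0// => xab; apply: nx => i.
by have /andP[/ltW -> /ltW ->] := xab i.
Qed.

End bump.

Section tails.
Context d {T : measurableType d} {R : realType} (nu : {measure set T -> \bar R}).
Implicit Types (D : set T) (f : T -> R) (M e : R).

Definition tail f M x := if `|f x| <= M then 0 else `|f x|.

Lemma L1_indic D (A : set T) : measurable D -> measurable A -> (nu A < +oo)%E ->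
  L1 nu D (\1_A : T -> R).
Proof.
move=> mD mA Afin; apply: (@L1S _ _ _ _ _ setT) => //.
apply/integrableP; split; first by apply/measurable_EFinP; exact: measurable_indic.
rewrite (eq_integral (fun x => (\1_A x : R)%:E)); last first.
  by move=> x _ /=; rewrite ger0_norm// indicE.
by rewrite integral_indic// setIT.
Qed.

Lemma ae_imp (P Q : T -> Prop) : (forall x, P x -> Q x) ->
  {ae nu, forall x, P x} -> {ae nu, forall x, Q x}.
Proof. by move=> PQ; apply: filterS. Qed.

Lemma ae_imp2 (P Q Z : T -> Prop) : (forall x, P x -> Q x -> Z x) ->
  {ae nu, forall x, P x} -> {ae nu, forall x, Q x} -> {ae nu, forall x, Z x}.
Proof. by move=> PQ h1 h2; apply: filterS2 h1 h2. Qed.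

Lemma ae_imp3 (P Q Z Y : T -> Prop) : (forall x, P x -> Q x -> Z x -> Y x) ->
  {ae nu, forall x, P x} -> {ae nu, forall x, Q x} -> {ae nu, forall x, Z x} ->
  {ae nu, forall x, Y x}.
Proof. by move=> PQ h1 h2 h3; apply: filterS3 h1 h2 h3. Qed.

Lemma tail_ge0 f M x : 0 <= tail f M x.
Proof. by rewrite /tail; case: ifP. Qed.

Lemma tail_le f M x : tail f M x <= `|f x|.
Proof. by rewrite /tail; case: ifP. Qed.

Lemma norm_tail f M x : 0 <= M -> `|f x| <= M + tail f M x.
Proof. by move=> M0; rewrite /tail; case: ifPn; rewrite ?addr0 ?lerDr. Qed.

Lemma measurable_tail D f M : measurable D -> measurable_fun D f ->
  measurable_fun D (tail f M).
Proof.
move=> mD mf; have mnf : measurable_fun D (fun x => `|f x|) by exact: measurableT_comp.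
apply: measurable_fun_if => //; first exact: measurable_fun_ler.
by apply: measurable_funS mnf => //; exact: subIsetl.
Qed.

Lemma L1_tail_fun D f M : measurable D -> L1 nu D f -> L1 nu D (tail f M).
Proof.
move=> mD If; apply: (@L1_le _ _ _ _ _ _ (fun x => `|f x|)) => //.
- by apply: measurable_tail => //; exact: L1_measurable If.
- by move=> x Dx; rewrite ger0_norm ?tail_ge0// tail_le.
- exact: L1_norm.
Qed.

Lemma L1_tail D f e : measurable D -> L1 nu D f -> 0 < e ->
  exists2 M, 0 <= M & \int[nu]_(x in D) tail f M x < e.
Proof.
move=> mD If e0; have mf := L1_measurable mD If.
have [||||||_ _] := @Rint_dominated _ _ R nu D (fun n => tail f n%:R)
  (cst 0) (fun x => `|f x|).
- exact: mD.
- by move=> n; exact: measurable_tail.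
- exact: measurable_cst.
- apply: aeW => x Dx; apply: cvg_near_cst; near=> n.
  rewrite /tail (_ : `|f x| <= n%:R)//; near: n; exact: nbhs_infty_ger.
- exact: L1_norm.
- by apply: aeW => x Dx n; rewrite ger0_norm ?tail_ge0// tail_le.
rewrite Rintegral_cst// mul0r => /cvgrPdist_lt/(_ _ e0)[n _ /(_ n (leqnn n))].
rewrite sub0r normrN => h; exists n%:R => //.
exact: le_lt_trans (ler_norm _) h.
Unshelve. all: by end_near. Qed.

End tails.

Lemma box_volume_fin {R : realType} {N : nat} (A : set 'rV[R]_N) :
  (box_volume A < +oo)%E -> A = set0 \/ exists a b, A = cbox a b.
Proof.
move=> bA; have [?|A0] := pselect (A = set0); [by left|right].
apply: contrapT => nA; move: bA; rewrite (_ : box_volume A = +oo%E) ?ltxx//.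
apply/ereal_inf_pinfty => m [[/A0//]|[a [b [_ AE _]]]].
by case: nA; exists a, b.
Qed.

(** * The fundamental lemma of the calculus of variations *)

Section fundamental_lemma.
Context {R : realType} {N : nat}.
Local Notation V := 'rV[R]_N.
Local Notation S := (lebesgue_space R N).
Local Notation mu := (leb R N).
Variables (Om : set V) (W : V -> R).
Hypothesis N0 : (0 < N)%N.
Hypothesis oO : open Om.
Let mO : measurable (Om : set S) := measurable_open_om leb_half oO.
Hypothesis IW : L1 mu Om W.

Let mW : measurable_fun (Om : set S) W := L1_measurable mO IW.

Let mind (A : set S) (D : set S) : measurable A -> measurable_fun D (\1_A : S -> R).
Proof. by move=> mA; apply: measurable_funTS; exact: measurable_indic. Qed.

Let ind01 (A : set V) x : `|\1_A x : R| <= 1.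
Proof. by rewrite indicE; case: (_ \in _); rewrite ?normr0 ?normr1. Qed.

Let IWind (A : set S) : measurable A -> L1 mu Om (fun x => \1_A x * W x).
Proof. by move=> mA; apply: (@L1_mul _ _ _ _ _ _ _ 1) => //; exact: mind. Qed.

Hypothesis W0 : forall psi, test_function Om psi ->
  \int[mu]_(x in Om) (W x * psi x) = 0.

Variables (a b : V).
Hypothesis abO : cbox a b `<=` Om.

(** [W] has integral 0 against test functions, hence on finite unions of boxes, on countable ones,
    and on measurable sets, each case being a limit of the preceding one. The factor [bump a b]
    gives the test functions a compact support in [Om]. *)
Let Rint_obox_union (ab : nat -> V * V) m :
  \int[mu]_(x in Om) (\1_(uobox ab m `&` obox a b) x * W x) = 0.
Proof.
pose psi n x := ubump ab m n x * bump a b n x.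
have mU : measurable (uobox ab m `&` obox a b : set S).
  apply: measurableI; last exact: (measurable_obox leb_half).
  rewrite (_ : uobox ab m = \bigcup_(j in `I_m) obox (ab j).1 (ab j).2).
    by apply: bigcup_measurable => j _; exact: (measurable_obox leb_half).
  by apply/seteqP; split => x [j jm xj]; exists j.
have spsi n : smooth (psi n) by apply: smoothM; [exact: smooth_ubump|exact: smooth_bump].
have psi1 n x : `|psi n x| <= 1.
  have /andP[u0 u1] := ubump01 ab m n x.
  by rewrite normrM !ger0_norm ?bump_ge0// mulr_ile1 ?bump_ge0 ?bump_le1.
have [||||||_ _] := @Rint_dominated _ _ R mu Om (fun n x => psi n x * W x)
  (fun x => \1_(uobox ab m `&` obox a b) x * W x) (fun x => `|W x|).
- exact: mO.
- by move=> n; apply: measurable_funM => //; exact: smooth_measurable.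
- by apply: measurable_funM => //; exact: mind.
- apply: aeW => x Ox; apply: cvgM; last exact: cvg_cst.
  rewrite indicI; apply: cvgM; [exact: ubump_cvg|exact: bump_cvg].
- exact: L1_norm.
- by apply: aeW => x Ox n; rewrite normrM ler_piMl.
move=> /cvg_lim <- //; rewrite (_ : (fun n => _) = cst 0) ?lim_cst//.
apply/funext => n; rewrite -[RHS](W0 (test_function_support n abO (smooth_ubump ab m n))).
by apply: eq_Rintegral => x _; rewrite mulrC.
Qed.

Let Rint_obox_bigcup (ab : nat -> V * V) :
  \int[mu]_(x in Om) (\1_((\bigcup_j obox (ab j).1 (ab j).2) `&` obox a b) x * W x) = 0.
Proof.
have mU m : measurable (uobox ab m `&` obox a b : set S).
  apply: measurableI; last exact: (measurable_obox leb_half).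
  rewrite (_ : uobox ab m = \bigcup_(j in `I_m) obox (ab j).1 (ab j).2).
    by apply: bigcup_measurable => j _; exact: (measurable_obox leb_half).
  by apply/seteqP; split => x [j jm xj]; exists j.
have mUU : measurable ((\bigcup_j obox (ab j).1 (ab j).2) `&` obox a b : set S).
  apply: measurableI; last exact: (measurable_obox leb_half).
  by apply: bigcup_measurable => j _; exact: (measurable_obox leb_half).
have [||||||_ _] := @Rint_dominated _ _ R mu Om (fun m x => \1_(uobox ab m `&` obox a b) x * W x)
  (fun x => \1_((\bigcup_j obox (ab j).1 (ab j).2) `&` obox a b) x * W x) (fun x => `|W x|).
- exact: mO.
- by move=> n; apply: measurable_funM => //; exact: mind.
- by apply: measurable_funM => //; exact: mind.
- apply: aeW => x Ox; apply: cvgM; last exact: cvg_cst.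
  apply: cvg_near_cst.
  have [[[j _ xj] xab]|nx] := pselect (((\bigcup_j obox (ab j).1 (ab j).2) `&` obox a b) x).
    near=> m; have jm : (j < m)%N by near: m; exact: nbhs_infty_gt.
    by rewrite !indicE !mem_set//; split => //; exists j.
  near=> m; rewrite !indicE !memNset// => -[[j _ xj] xab]; apply: nx.
  by split => //; exists j.
- exact: L1_norm.
- by apply: aeW => x Ox n; rewrite normrM ler_piMl.
move=> /cvg_lim <- //; rewrite (_ : (fun n => _) = cst 0) ?lim_cst//.
by apply/funext => n; exact: Rint_obox_union.
Unshelve. all: by end_near. Qed.

(** Outer regularity, read off the definition of the measure as an infimum over covers by closed
    boxes. Opening the boxes removes only their faces, which accounts for the null set [A \ U]. *)
Let approx_by_boxes (A : set S) (e : R) : measurable A -> A `<=` obox a b -> 0 < e ->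
  exists ab : nat -> V * V, let U := (\bigcup_j obox (ab j).1 (ab j).2) `&` obox a b in
    mu (A `\` U) = 0%E /\ (mu (U `\` A) <= e%:E)%E.
Proof.
move=> mA Aab e0.
have Afin : (mu A < +oo)%E.
  apply: le_lt_trans (leb_cbox_fin a b); apply: le_leb => x /Aab xab i.
  by have /andP[/ltW -> /ltW ->] := xab i.
have Afin' : mu A \is a fin_num by rewrite ge0_fin_numE ?leb_ge0.
have [_ [F AF <-] Fe] := lb_ereal_inf_adherent e0 Afin'.
have bge0 n : (0 <= box_volume (F n))%E by exact: box_volume_ge0.
have bfin n : (box_volume (F n) < +oo)%E.
  apply: (@le_lt_trans _ _ (\sum_(k <oo) box_volume (F k))%E); last first.
    by apply: lt_trans Fe _; rewrite lte_add_pinfty ?ltry.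
  apply: le_trans (nneseries_lim_ge n.+1 _); last by move=> *; exact: box_volume_ge0.
  by rewrite big_nat_recr//= leeDr// sume_ge0.
have H n : exists ab : V * V, F n `<=` cbox ab.1 ab.2 /\
    (mu (cbox ab.1 ab.2) <= box_volume (F n))%E.
  have [F0|F0] := pselect (F n = set0).
    (* An empty set of the cover is replaced by a box reduced to a point, which is flat because
       [0 < N]. *)
    exists (0, 0); rewrite F0; split; first exact: sub0set.
    rewrite (leb_cbox_flat (i := Ordinal N0)) ?mxE//.
    by rewrite box_volume_ge0.
  have [//|[c [d FE]]] := box_volume_fin (bfin n).
  exists (c, d); rewrite /= -FE; split => //.
  exact: cover_outer_le box_volume0 (@box_volume_ge0 R N).
have [ab Hab] := choice H.
exists ab => U.
have mU : measurable (U : set S).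
  apply: measurableI; last exact: (measurable_obox leb_half).
  by apply: bigcup_measurable => j _; exact: (measurable_obox leb_half).
have AU0 : mu (A `\` U) = 0%E.
  apply/eqP; rewrite eq_le leb_ge0 andbT.
  apply: (@le_trans _ _ (mu (\bigcup_n (cbox (ab n).1 (ab n).2 `\` obox (ab n).1 (ab n).2)))).
    apply: le_leb => x [Ax nUx]; have [n _ Fnx] := AF x Ax.
    exists n => //; split; first exact: (Hab n).1.
    by move=> xn; apply: nUx; split; [exists n|exact: Aab].
  apply: le_trans (outer_measure_sigma_subadditive (lebesgue_om R N) _) _.
  by rewrite eseries0// => n _ _; exact: leb_cbox_obox.
split => //.
have Ufin : (mu U <= mu A + e%:E)%E.
  apply: (@le_trans _ _ (\sum_(n <oo) box_volume (F n))%E); last exact: ltW.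
  apply: (@le_trans _ _ (mu (\bigcup_n cbox (ab n).1 (ab n).2))).
    apply: le_leb => x [[n _ xn] _]; exists n => // i.
    by have /andP[/ltW -> /ltW ->] := xn i.
  apply: le_trans (outer_measure_sigma_subadditive (lebesgue_om R N) _) _.
  apply: lee_nneseries => [n _ _|n _]; first exact: leb_ge0.
  exact: (Hab n).2.
have UAE : mu (U `&` A) = mu A.
  apply/eqP; rewrite eq_le le_leb /=; last by apply: subIsetr.
  rewrite -[leRHS]adde0 -AU0 -[in leLHS](setUIDK A U) setIC.
  exact: (outer_measureU2 (lebesgue_om R N)).
have : (mu A + mu (U `\` A) <= mu A + e%:E)%E.
  by apply: le_trans Ufin; rewrite -[leLHS]addeC -[X in (_ + X)%E]UAE -measureDI.
by rewrite leeD2lE.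
Qed.

Let Rint_measurable0 (A : set S) : measurable A -> A `<=` obox a b ->
  \int[mu]_(x in Om) (\1_A x * W x) = 0.
Proof.
move=> mA Aab; apply/eqP; rewrite -normr_le0; apply/ler_addgt0Pr => e e0.
rewrite add0r; have e20 : 0 < e / 2 by rewrite divr_gt0.
have [M M0 HM] := L1_tail mO IW e20.
(* On [U \ A] the integral of [|W|] is at most [M] times the measure of this set plus the tail of
   [W]; each part is made at most [e / 2]. *)
have dl0 : 0 < e / 2 / (M + 1) by rewrite divr_gt0// ltr_wpDl.
have [ab [AU UA]] := approx_by_boxes mA Aab dl0.
set U := (\bigcup_j obox (ab j).1 (ab j).2) `&` obox a b in AU UA.
have mU : measurable (U : set S).
  apply: measurableI; last exact: (measurable_obox leb_half).
  by apply: bigcup_measurable => j _; exact: (measurable_obox leb_half).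
have mUA : measurable (U `\` A : set S) by exact: measurableD.
have UAfin : (mu (U `\` A) < +oo)%E by rewrite (le_lt_trans UA)// ltry.
pose g := @tail _ S _ W M.
have Ig : L1 mu Om g by exact: L1_tail_fun.
have Iind : L1 mu Om (\1_(U `\` A) : S -> R).
  by apply: L1_indic.
have -> : \int[mu]_(x in Om) (\1_A x * W x) =
    - \int[mu]_(x in Om) (\1_(U `\` A) x * W x).
  apply/eqP; rewrite -addr_eq0 -RintegralD//; [|exact: IWind|exact: IWind].
  apply/eqP; rewrite -[RHS](Rint_obox_bigcup ab).
  apply: (Rintegral_ae mO).
  - by apply: measurable_funD; apply: measurable_funM => //; exact: mind.
  - by apply: measurable_funM => //; exact: mind.
  - apply: (@negligibleS _ _ _ mu (A `\` U)); last by apply/negligible_om.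
    move=> x /not_implyP[Ox]; rewrite -mulrDl => H; apply: contrapT => nAU; apply: H.
    congr (_ * _); rewrite -/U !indicE.
    have [Ax|Ax] := pselect (A x); have [Ux|Ux] := pselect (U x).
    - by rewrite (mem_set Ax) (mem_set Ux) memNset ?addr0// => -[].
    - by case: nAU.
    - by rewrite (memNset Ax) (mem_set Ux) mem_set ?add0r.
    - by rewrite (memNset Ax) (memNset Ux) memNset ?addr0// => -[].
rewrite normrN (le_trans (le_normr_Rintegral _ _))//; first exact: IWind.
apply: (@le_trans _ _ (\int[mu]_(x in Om) (M * \1_(U `\` A) x + g x))).
  apply: le_Rintegral => //; first exact/L1_norm/IWind.
    by apply: L1D => //; exact: L1Z.
  move=> x Ox; rewrite normrM indicE; case: (_ \in _).
    by rewrite normr1 mul1r mulr1 norm_tail.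
  by rewrite normr0 mul0r mulr0 add0r tail_ge0.
rewrite RintegralD//; last exact: L1Z.
rewrite RintegralZl// (splitr e) lerD ?(ltW HM)//.
rewrite (@le_trans _ _ (M * (e / 2 / (M + 1))))//; last first.
  by rewrite mulrCA ler_piMr ?(ltW e20)// ler_pdivrMr ?ltr_wpDl// mul1r lerDl.
rewrite ler_wpM2l// -lee_fin EFin_Rintegral// integral_indic//.
by apply: le_trans UA; apply: le_leb; exact: subIsetl.
Qed.

Lemma fundamental_lemma_box : {ae mu, forall x, obox a b x -> W x = 0}.
Proof.
have obO : obox a b `<=` Om.
  by move=> x xab; apply: abO => i; have /andP[/ltW -> /ltW ->] := xab i.
have mob := measurable_obox leb_half a b.
(* Integrating over the part of the box where [s * W > 0] shows that this set is null; the two signs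
   together give [W = 0]. *)
have key (s : R) : s = 1 \/ s = -1 ->
    {ae mu, forall x, Om x -> \1_(obox a b) x * Num.max (s * W x) 0 = 0}.
  move=> s1.
  have msW : measurable_fun (Om : set S) (fun x => s * W x) by exact: measurable_funM.
  pose A := obox a b `&` (Om `&` (fun x => s * W x) @^-1` `]0, +oo[).
  have mA : measurable (A : set S) by apply: measurableI => //; exact: msW.
  have IA : L1 mu Om (fun x => \1_A x * (s * W x)).
    by under eq_fun do rewrite mulrCA; apply: L1Z => //; exact: IWind.
  have E x : Om x -> \1_A x * (s * W x) = \1_(obox a b) x * Num.max (s * W x) 0.
    move=> Ox; have [xab|xab] := pselect (obox a b x); last first.
      by rewrite !indicE !memNset ?mul0r// => -[].
    rewrite [\1_(obox a b) x]indicE mem_set//= mul1r.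
    have [sW|sW] := ltP 0 (s * W x).
      by rewrite indicE mem_set ?mul1r//; split => //; split => //=; rewrite in_itv/= andbT.
    rewrite indicE memNset ?mul0r// => -[_ [_]] /=.
    by rewrite in_itv/= andbT ltNge sW.
  have A0 : \int[mu]_(x in Om) (\1_A x * (s * W x)) = 0.
    under eq_Rintegral do rewrite mulrCA.
    rewrite RintegralZl//; last exact: IWind.
    by rewrite Rint_measurable0 ?mulr0//; exact: subIsetl.
  have := @Rint_eq0_ae _ _ _ mu Om _ mO IA.
  rewrite A0 lexx => /(_ _ isT).
  have nn : {ae mu, forall x, Om x -> 0 <= \1_A x * (s * W x)}.
    by apply: aeW => x Ox; rewrite E// mulr_ge0// ?le_max ?lexx ?orbT// indicE.
  by move=> /(_ nn); apply: filterS => x h Ox; rewrite -E// h.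
have h1 := key 1 (or_introl erefl); have h2 := key (-1) (or_intror erefl).
apply: (ae_imp2 _ h1 h2) => x {}h1 {}h2 xab; have Ox := obO _ xab.
have := h1 Ox; have := h2 Ox; rewrite indicE mem_set//= !mul1r mulN1r => e2 e1.
have : W x <= 0 by rewrite -e1 le_max lexx.
have : - W x <= 0 by rewrite -e2 le_max lexx.
by rewrite oppr_le0 => w1 w2; apply/eqP; rewrite eq_le w1 w2.
Qed.

End fundamental_lemma.

Section fundamental_lemma_open.
Context {R : realType} {N : nat}.
Local Notation V := 'rV[R]_N.

Lemma ae_open (Om : set V) (P : V -> Prop) : open Om ->
  (forall a b, cbox a b `<=` Om -> {ae leb R N, forall x, obox a b x -> P x}) ->
  {ae leb R N, forall x, Om x -> P x}.
Proof.
move=> oO H; pose lo (qn : 'rV[rat]_N * nat) : V := \row_i (ratr (qn.1 ord0 i) - qn.2.+1%:R^-1).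
pose hi (qn : 'rV[rat]_N * nat) : V := \row_i (ratr (qn.1 ord0 i) + qn.2.+1%:R^-1).
pose B (k : nat) : set V := if unpickle k is Some qn then
  (if `[< cbox (lo qn) (hi qn) `<=` Om >] then [set x | obox (lo qn) (hi qn) x /\ ~ P x] else set0)
  else set0.
apply: (@negligibleS _ _ _ (leb R N) (\bigcup_k B k)).
  move=> x /not_implyP[Ox nP]; have [q [n [xq qO]]] := open_rbox oO Ox.
  by exists (pickle (q, n)) => //; rewrite /B pickleK; case: asboolP.
apply: negligible_bigcup => k; rewrite /B; case: (unpickle k) => [qn|]; last exact: negligible_set0.
case: asboolP => [/H|_]; last exact: negligible_set0.
by apply: negligibleS => x [xq nP] /(_ xq).
Qed.

Lemma fundamental_lemma (Om : set V) (W : V -> R) : (0 < N)%N -> open Om ->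
  L1 (leb R N) Om W ->
  (forall psi, test_function Om psi -> \int[leb R N]_(x in Om) (W x * psi x) = 0) ->
  {ae leb R N, forall x, Om x -> W x = 0}.
Proof. by move=> N0 oO IW W0; apply: ae_open => // a b abO; exact: fundamental_lemma_box abO. Qed.

End fundamental_lemma_open.

(** * From L^q to L^1 and to convergence in measure *)

Section Lp_facts.
Context d {T : measurableType d} {R : realType} (mu : {measure set T -> \bar R}).
Implicit Types (D : set T) (f g : T -> R).

Lemma Lnorm_restrict D f (q : R) : 0 < q -> measurable D ->
  ('N[mu]_(q%:E)[EFin \o (f \_ D)] `^ q)%E = (\int[mu]_(x in D) (`|f x| `^ q)%:E)%E.
Proof.
move=> q0 mD; rewrite poweR_Lnorm ?gt_eqF// [RHS]integral_mkcond.
apply: eq_integral => x _; rewrite /= /patch; case: ifP => // _.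
by rewrite normr0 powR0// gt_eqF.
Qed.

Lemma in_Lp_powR D f (q : R) : 0 < q -> measurable D -> in_Lp mu D q f ->
  L1 mu D (fun x => `|f x| `^ q).
Proof.
move=> q0 mD [mf fin]; apply/integrableP; split.
  apply/measurable_EFinP; apply: (measurableT_comp (measurable_powR q)).
  exact: measurableT_comp.
rewrite (eq_integral (fun x => (`|f x| `^ q)%:E)); last first.
  by move=> x _ /=; rewrite ger0_norm// powR_ge0.
rewrite -(Lnorm_restrict _ q0 mD); move: fin; rewrite /finite_norm.
have := Lnorm_ge0 mu q%:E (EFin \o (f \_ D)).
by case: ('N[mu]_ _ [_])%E => // r _ _; rewrite poweR_EFin ltry.
Qed.

(** If [|t| > e], then [(|t| / e) ^ (q - 1) >= 1]. On sets of finite measure this does the work of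
    Hoelder's inequality, with [e] chosen before the L^q norm is made small; it serves again to turn
    a small energy into a small L^1 norm of the gradient. *)
Lemma le_norm_powR (t q e : R) : 1 <= q -> 0 < e ->
  `|t| <= e + e `^ (1 - q) * `|t| `^ q.
Proof.
move=> q1 e0; have [te|et] := leP `|t| e.
  by rewrite (le_trans te)// lerDl mulr_ge0// powR_ge0.
apply: (@le_trans _ _ (e `^ (1 - q) * `|t| `^ q)); last by rewrite lerDr ltW.
have t0 : 0 < `|t| by exact: lt_trans et.
have -> : `|t| `^ q = `|t| * `|t| `^ (q - 1).
  by rewrite -{2}(powRr1 (ltW t0)) -powRD ?(gt_eqF t0) ?implybT// addrC subrK.
rewrite mulrCA ler_peMr ?(ltW t0)//.
have -> : e `^ (1 - q) = (e `^ (q - 1))^-1 by rewrite -powRN opprB.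
rewrite mulrC ler_pdivlMr ?powR_gt0// mul1r.
by rewrite ge0_ler_powR ?nnegrE ?subr_ge0 ?(ltW e0) ?(ltW t0) ?(ltW et).
Qed.

Lemma in_Lp_L1 D f (q : R) : 1 <= q -> measurable D -> (mu D < +oo)%E ->
  in_Lp mu D q f -> L1 mu D f.
Proof.
move=> q1 mD Dfin fq; have Iq := in_Lp_powR (lt_le_trans ltr01 q1) mD fq.
apply: (@L1_le _ _ _ _ _ _ (fun x => 1 + 1 `^ (1 - q) * `|f x| `^ q)) => //.
- by case: fq.
- by move=> x Dx; exact: le_norm_powR.
- apply: L1D => //; last exact: L1Z.
  by apply: (@L1_bounded _ _ _ _ _ _ 1) => // x _; rewrite /= normr1.
Qed.

Lemma cvg_Lp_powR D (fs : nat -> T -> R) f (q e : R) : 0 < q -> measurable D ->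
  cvg_Lp mu D q fs f -> 0 < e ->
  \forall n \near \oo, (\int[mu]_(x in D) (`|fs n x - f x| `^ q)%:E <= e%:E)%E.
Proof.
move=> q0 mD cv e0.
have e'0 : 0 < e `^ q^-1 by rewrite powR_gt0.
have := cv; rewrite /cvg_Lp => /fine_cvgP[fin /cvgrPdist_le/(_ _ e'0) cv'].
near=> n.
rewrite -(@Lnorm_restrict D (fs n \- f)%R q q0 mD).
have : `|0 - fine ('N[mu]_(q%:E)[EFin \o ((fs n \- f)%R \_ D)])%E| <= e `^ q^-1.
  by near: n.
have : ('N[mu]_(q%:E)[EFin \o ((fs n \- f)%R \_ D)])%E \is a fin_num by near: n.
have := Lnorm_ge0 mu q%:E (EFin \o ((fs n \- f)%R \_ D)).
case: ('N[mu]_ _ [_])%E => // r; rewrite lee_fin /= => r0 _.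
rewrite sub0r normrN ger0_norm// => re; rewrite lee_fin.
rewrite (@le_trans _ _ ((e `^ q^-1) `^ q))//.
  by rewrite ge0_ler_powR ?nnegrE ?(ltW q0) ?(ltW e'0).
by rewrite -powRrM mulVf ?gt_eqF// powRr1// ltW.
Unshelve. all: by end_near. Qed.

Lemma cvg_Lp_L1 D (fs : nat -> T -> R) f (q e : R) : 1 <= q -> measurable D ->
  (mu D < +oo)%E -> (forall n, L1 mu D (fs n)) -> L1 mu D f ->
  cvg_Lp mu D q fs f -> 0 < e ->
  \forall n \near \oo, \int[mu]_(x in D) `|fs n x - f x| <= e.
Proof.
move=> q1 mD Dfin Ifs If cv e0; have q0 := lt_le_trans ltr01 q1.
pose m := fine (mu D); have m0 : 0 <= m by rewrite fine_ge0.
pose d1 := e / 2 / (m + 1); have d10 : 0 < d1 by rewrite !divr_gt0// ltr_wpDl.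
pose c := d1 `^ (1 - q); have c0 : 0 < c by rewrite powR_gt0.
have ec0 : 0 < e / 2 / c by rewrite !divr_gt0.
have nr := cvg_Lp_powR q0 mD cv ec0.
near=> n.
have In : L1 mu D (fun x => fs n x - f x) by exact: L1B.
have h : (\int[mu]_(x in D) (`|fs n x - f x| `^ q)%:E <= (e / 2 / c)%:E)%E by near: n.
have mg : measurable_fun D (fun x => `|fs n x - f x| `^ q).
  apply: (measurableT_comp (measurable_powR q)); apply: measurableT_comp => //.
  exact: L1_measurable In.
have Iq : L1 mu D (fun x => `|fs n x - f x| `^ q).
  apply/integrableP; split; first exact/measurable_EFinP.
  rewrite (eq_integral (fun x => (`|fs n x - f x| `^ q)%:E)); last first.
    by move=> x _ /=; rewrite ger0_norm// powR_ge0.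
  exact: le_lt_trans h (ltry _).
have Icst : L1 mu D (cst d1).
  by apply: (@L1_bounded _ _ _ _ _ _ d1) => // x _; rewrite /= ger0_norm// ltW.
apply: (@le_trans _ _ (\int[mu]_(x in D) (d1 + c * `|fs n x - f x| `^ q))).
  apply: le_Rintegral => //; first exact: L1_norm.
    by apply: L1D => //; exact: L1Z.
  by move=> x Dx; exact: le_norm_powR.
rewrite RintegralD//; last exact: L1Z.
rewrite Rintegral_cst// RintegralZl// (splitr e) lerD//.
  rewrite -/m /d1 -mulrA ler_piMr ?divr_ge0 ?(ltW e0)//.
  by rewrite mulrC ler_pdivrMr ?ltr_wpDl// mul1r lerDl.
rewrite -ler_pdivlMl// mulrC -lee_fin EFin_Rintegral//.
Unshelve. all: by end_near. Qed.

(** Chebyshev's inequality at the level [e]. This is the form in which traces are carried along. *)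
Lemma cvg_Lp_measure D (fs : nat -> T -> R) f (q e : R) : 0 < q -> measurable D ->
  (forall n, measurable_fun D (fs n)) -> measurable_fun D f ->
  cvg_Lp mu D q fs f -> 0 < e ->
  \forall n \near \oo, (mu (D `&` [set x | `|fs n x - f x| > e]%R) < e%:E)%E.
Proof.
move=> q0 mD mfs mf cv e0.
pose c := e `^ q; have c0 : 0 < c by rewrite powR_gt0.
have ec0 : 0 < c * (e / 2) by rewrite mulr_gt0 ?divr_gt0.
have nr := cvg_Lp_powR q0 mD cv ec0.
near=> n.
have h : (\int[mu]_(x in D) (`|fs n x - f x| `^ q)%:E <= (c * (e / 2))%:E)%E by near: n.
have mg0 : measurable_fun D (fun x => `|fs n x - f x|).
  by apply: measurableT_comp => //; exact: measurable_funB.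
have mg : measurable_fun D (fun x => `|fs n x - f x| `^ q).
  exact: (measurableT_comp (measurable_powR q)).
pose A := D `&` [set x | `|fs n x - f x| > e]%R.
have mA : measurable A.
  rewrite (_ : A = D `&` (fun x => `|fs n x - f x|) @^-1` `]e, +oo[); first exact: mg0.
  by apply/seteqP; split => x /= [Dx]; rewrite in_itv/= andbT.
have : (c%:E * mu A <= (c * (e / 2))%:E)%E.
  apply: le_trans h; rewrite -(integral_cst mu mA).
  apply: (@le_trans _ _ (\int[mu]_(x in A) (`|fs n x - f x| `^ q)%:E)%E).
    apply: ge0_le_integral => //.
    - by move=> x _; rewrite lee_fin powR_ge0.
    - by apply/measurable_EFinP; apply: measurable_funS mg => //; exact: subIsetl.
    - move=> x [Dx /= ex]; rewrite lee_fin ge0_ler_powR ?nnegrE ?(ltW q0) ?(ltW e0)//.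
      exact: ltW.
  apply: ge0_subset_integral => //.
  - exact/measurable_EFinP.
  - exact: subIsetl.
rewrite -/A; case: (mu A) => [m| |]; last by rewrite ltNyr.
  rewrite -EFinM lee_fin lte_fin ler_pM2l// => me.
  by rewrite (le_lt_trans me)// ltr_pdivrMr// ltr_pMr// ltr1n.
by rewrite gt0_muley ?lte_fin// leye_eq.
Unshelve. all: by end_near. Qed.

End Lp_facts.

Section abstract_estimates.
Context d {T : measurableType d} {R : realType} (mu : {measure set T -> \bar R}).
Variables (D : set T) (mD : measurable D) (Dfin : (mu D < +oo)%E).
Implicit Types (f g v w : T -> R).

Lemma L1_lipschitz_comp (F : R -> R) (M : R) v : continuous F ->
  (forall a b, `|F a - F b| <= M * `|a - b|) -> L1 mu D v -> L1 mu D (F \o v).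
Proof.
move=> cF FM Iv; have mv := L1_measurable mD Iv.
apply: (@L1_le _ _ _ _ _ _ (fun x => `|F 0| + M * `|v x|)) => //.
- by apply: (measurableT_comp _ mv); exact: continuous_measurable_fun.
- move=> x Dx /=; rewrite -[X in `|X|](subrK (F 0)) addrC (le_trans (ler_normD _ _))//.
  by rewrite lerD2l (le_trans (FM _ _))// subr0.
- apply: L1D => //; last by apply: L1Z => //; exact: L1_norm.
  by apply: (@L1_bounded _ _ _ _ _ _ `|F 0|) => // x _; rewrite /= normr_id.
Qed.

Lemma measurable_comp_continuous (F : R -> R) v : continuous F ->
  measurable_fun D v -> measurable_fun D (F \o v).
Proof. by move=> cF mv; apply: (measurableT_comp _ mv); exact: continuous_measurable_fun. Qed.

Lemma lipschitz_continuous (F : R -> R) (M : R) :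
  (forall a b, `|F a - F b| <= M * `|a - b|) -> continuous F.
Proof.
move=> FM x; apply/cvgrPdist_lt => e e0; near=> y.
rewrite (le_lt_trans (FM _ _))// (@le_lt_trans _ _ ((`|M| + 1) * `|x - y|))//.
  by rewrite ler_wpM2r// (le_trans (ler_norm _))// lerDl.
rewrite -ltr_pdivlMl ?ltr_wpDl//; near: y.
by apply: cvgr_dist_lt => //; rewrite mulr_gt0 ?invr_gt0 ?ltr_wpDl.
Unshelve. all: by end_near. Qed.

(** In [F'(f) g - F'(v) w = F'(f) (g - w) + (F'(f) - F'(v)) w] the product in the last term is not
    controlled by L^1 norms alone: where [|w| <= m] the Lipschitz bound of [F'] is used, elsewhere
    its boundedness and the tail of [w]. *)
Lemma chain_estimate (F' : R -> R) (M K m : R) f v g w : 0 <= m -> 0 <= K ->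
  (forall a, `|F' a| <= M) -> (forall a b, `|F' a - F' b| <= K * `|a - b|) ->
  L1 mu D f -> L1 mu D v -> L1 mu D g -> L1 mu D w ->
  \int[mu]_(x in D) `|F' (f x) * g x - F' (v x) * w x| <=
  M * \int[mu]_(x in D) `|g x - w x| + (K * m * \int[mu]_(x in D) `|f x - v x|
   + 2 * M * \int[mu]_(x in D) tail w m x).
Proof.
move=> m0 K0 FM FK If Iv Ig Iw.
have cF' := lipschitz_continuous FK.
have M0 : 0 <= M by exact: le_trans (FM 0).
have mf := L1_measurable mD If; have mv := L1_measurable mD Iv.
have I1 : L1 mu D (fun x => `|g x - w x|) by apply/L1_norm/L1B.
have I2 : L1 mu D (fun x => `|f x - v x|) by apply/L1_norm/L1B.
have I3 : L1 mu D (tail w m) by exact: L1_tail_fun.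
have Z1 := L1Z M mD I1; have Z2 := L1Z (K * m) mD I2; have Z3 := L1Z (2 * M) mD I3.
rewrite -!RintegralZl// -(RintegralD mD Z2 Z3) -(RintegralD mD Z1 (L1D mD Z2 Z3)).
apply: le_Rintegral => //.
- apply/L1_norm/L1B => //; apply: (L1_mul mD (M := M)) => //.
  + exact: (measurable_comp_continuous cF').
  + exact: (measurable_comp_continuous cF').
- exact: (L1D mD Z1 (L1D mD Z2 Z3)).
move=> x Dx.
rewrite (_ : _ - _ = F' (f x) * (g x - w x) + (F' (f x) - F' (v x)) * w x); last by ring.
rewrite (le_trans (ler_normD _ _))// lerD//; first by rewrite normrM ler_wpM2r.
rewrite normrM (le_trans (ler_wpM2l _ (norm_tail w x m0)))// mulrDr lerD//.
  by rewrite mulrAC ler_wpM2r.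
rewrite ler_wpM2r ?tail_ge0// (le_trans (ler_normB _ _))//.
by rewrite mulr_natl mulr2n lerD.
Qed.

Lemma tail_mono w m m' x : m <= m' -> tail w m' x <= tail w m x.
Proof.
move=> mm; rewrite /tail; case: ifPn => h'; case: ifPn => h //.
by rewrite (le_trans h mm) in h'.
Qed.

Lemma Rint_triangle f g w : L1 mu D f -> L1 mu D g -> L1 mu D w ->
  \int[mu]_(x in D) `|f x - w x| <=
  \int[mu]_(x in D) `|f x - g x| + \int[mu]_(x in D) `|g x - w x|.
Proof.
move=> If Ig Iw.
apply: le_trans (le_Rint_norm mD (L1B mD If Ig) (L1B mD Ig Iw)).
apply: le_Rintegral => //.
- exact/L1_norm/L1B.
- by apply: L1_norm; apply: L1D => //; exact: L1B.
- by move=> x Dx; rewrite addrA subrK.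
Qed.

End abstract_estimates.

(** * Limits of smooth functions with their gradients and traces *)

Section approximable.
Context {R : realType} {N : nat}.
Local Notation V := 'rV[R]_N.
Local Notation S := (lebesgue_space R N).
Local Notation mu := (leb R N).
Local Notation H := (hausdorff_om R N N.-1).
Variables (Om : set V) (oO : open Om) (bO : bounded_set Om) (N0 : (0 < N)%N).
Implicit Types (E : set V) (v tau phi psi : V -> R) (W : V -> V).

Let mO : measurable (Om : set S) := measurable_open_om leb_half oO.
Let Ofin : (mu Om < +oo)%E := leb_bounded bO.

(* A substitute for [sobolev_grad] and [is_trace] that only asks for L^1
   convergence of values and gradients, and for convergence in measure of the
   traces, on the part [E] of the boundary: it is stable under composition with
   truncations and under limits. *)
Definition appr E v W tau :=
  [/\ L1 mu Om v, forall i, L1 mu Om (fun x => W x ord0 i) &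
  forall e, 0 < e -> exists phi, [/\ smooth phi,
    \int[mu]_(x in Om) `|phi x - v x| <= e,
    forall i, \int[mu]_(x in Om) `|partial i phi x - W x ord0 i| <= e &
    (H (E `&` [set x | e < `|phi x - tau x|]%R) <= e%:E)%E]].

Lemma smooth_L1 phi : smooth phi -> L1 mu Om phi.
Proof.
move=> sp; have [M [_ HM]] := bO.
have Osub : Om `<=` cube 0 (M + 1).
  by move=> x /(HM (M + 1)); rewrite /cube/= subr0; apply; rewrite ltrDl.
have [B B0 HB] := continuous_bounded_compact (smooth_continuous sp) (@cube_compact _ _ 0 (M + 1)).
apply: (@L1_bounded _ _ _ _ _ _ B) => //; first exact: smooth_measurable.
by move=> x /Osub/HB.
Qed.

Lemma Rintegral_test phi (K : set V) : compact K -> K `<=` Om ->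
  (forall x, ~ K x -> phi x = 0) ->
  \int[mu]_(x in Om) phi x = \int[mu]_(x in setT) phi x.
Proof.
move=> cK KO phi0; rewrite Rintegral_mkcond; congr Rintegral.
apply/funext => x; rewrite /patch; case: ifPn => //; rewrite notin_setE => nO.
by rewrite phi0// => /KO.
Qed.

Lemma smooth_ibp phi psi i : smooth phi -> test_function Om psi ->
  \int[mu]_(x in Om) (phi x * partial i psi x) =
  - \int[mu]_(x in Om) (partial i phi x * psi x).
Proof.
move=> sphi [spsi [K [cK KO psi0]]].
have sdphi := @smooth_partial _ _ _ i sphi; have sdpsi := @smooth_partial _ _ _ i spsi.
apply/eqP; rewrite -addr_eq0 addrC; apply/eqP.
rewrite -RintegralD//; [|by apply: smooth_L1; exact: smoothM|by apply: smooth_L1; exact: smoothM].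
have := @Rintegral_partial0 R N _ K i (smoothM sphi spsi) cK.
rewrite partialM// => <-; last by move=> x nK; rewrite psi0// mulr0.
apply: (Rintegral_test cK KO) => x nK.
by rewrite psi0// (partial_support i cK psi0 nK) !mulr0 addr0.
Qed.

Lemma test_bounded psi : test_function Om psi -> exists2 M, 0 <= M & forall x, `|psi x| <= M.
Proof.
by move=> [sp [K [cK KO p0]]]; apply: (support_bounded _ cK p0); exact: smooth_continuous.
Qed.

Lemma test_partial_bounded psi i : test_function Om psi ->
  exists2 M, 0 <= M & forall x, `|partial i psi x| <= M.
Proof.
move=> [sp [K [cK KO p0]]]; apply: (support_bounded _ cK).
  exact/smooth_continuous/smooth_partial.
by move=> x; exact: partial_support.
Qed.

Lemma Rint_mul_bound (f g h : V -> R) (M : R) : L1 mu Om f -> L1 mu Om g ->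
  measurable_fun (Om : set S) h -> (forall x, `|h x| <= M) ->
  `|\int[mu]_(x in Om) (f x * h x) - \int[mu]_(x in Om) (g x * h x)| <=
  M * \int[mu]_(x in Om) `|f x - g x|.
Proof.
move=> If Ig mh hM.
have Im (k : V -> R) : L1 mu Om k -> L1 mu Om (fun x => k x * h x).
  by move=> Ik; under eq_fun do rewrite mulrC; exact: (L1_mul mO mh (fun x _ => hM x) Ik).
have Ifg := L1B mO If Ig.
rewrite -RintegralB//; [|exact: Im|exact: Im].
under eq_Rintegral do rewrite -mulrBl.
rewrite (le_trans (le_normr_Rintegral mO (Im _ Ifg)))//.
rewrite -RintegralZl//; last exact: L1_norm.
apply: le_Rintegral => //.
- exact/L1_norm/Im.
- exact/L1Z/L1_norm.
- by move=> x Ox; rewrite normrM mulrC ler_wpM2r.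
Qed.

Lemma appr_ibp E v W tau psi i : appr E v W tau -> test_function Om psi ->
  \int[mu]_(x in Om) (v x * partial i psi x) =
  - \int[mu]_(x in Om) (W x ord0 i * psi x).
Proof.
move=> [Iv IW ap] tpsi; have spsi := tpsi.1.
have [M M0 HM] := test_bounded tpsi.
have [M' M'0 HM'] := test_partial_bounded i tpsi.
apply/eqP; rewrite -subr_eq0 opprK -normr_le0; apply/ler_addgt0Pr => e e0.
rewrite add0r; pose e' := e / (M' + M + 1).
have MM : 0 < M' + M + 1 by rewrite ltr_wpDl// addr_ge0.
have e'0 : 0 < e' by rewrite divr_gt0.
have [phi [sphi h1 h2 _]] := ap _ e'0.
have sd := @smooth_partial _ _ _ i sphi; have sdp := @smooth_partial _ _ _ i spsi.
have b1 := Rint_mul_bound (smooth_L1 sphi) Iv (@smooth_measurable _ _ _ Om sdp) HM'.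
have b2 := Rint_mul_bound (smooth_L1 sd) (IW i) (@smooth_measurable _ _ _ Om spsi) HM.
move: b1 b2; rewrite (smooth_ibp i sphi tpsi).
set a := \int[mu]_(x in Om) (v x * _); set b := \int[mu]_(x in Om) (W x ord0 i * _).
set c := \int[mu]_(x in Om) (partial i phi x * _) => b1 b2.
rewrite (_ : a + b = - (- c - a) - (c - b)); last by ring.
rewrite (le_trans (ler_normB _ _))// normrN.
apply: (@le_trans _ _ (M' * e' + M * e')).
  apply: lerD; first by rewrite (le_trans b1)// ler_wpM2l.
  by rewrite (le_trans b2)// ler_wpM2l.
rewrite -mulrDl /e' mulrCA ler_piMr ?(ltW e0)// ler_pdivrMr// mul1r lerDl//.
Qed.

Lemma weak_grad_unique v W W' (p : R) : 1 <= p ->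
  sobolev_grad Om p v W -> sobolev_grad Om p v W' ->
  {ae mu, forall x, Om x -> forall i, W x ord0 i = W' x ord0 i}.
Proof.
move=> p1 [_ LW gW] [_ LW' gW'].
have IW i := in_Lp_L1 p1 mO Ofin (LW i).
have IW' i := in_Lp_L1 p1 mO Ofin (LW' i).
have H i : {ae mu, forall x, Om x -> W x ord0 i - W' x ord0 i = 0}.
  apply: (fundamental_lemma N0 oO (L1B mO (IW i) (IW' i))) => psi tpsi.
  have [M M0 HM] := test_bounded tpsi.
  have Im (k : V -> R) : L1 mu Om k -> L1 mu Om (fun x => k x * psi x).
    move=> Ik; under eq_fun do rewrite mulrC.
    by apply: (L1_mul mO _ (fun x _ => HM x) Ik); exact: smooth_measurable tpsi.1.
  under eq_Rintegral do rewrite mulrBl.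
  rewrite RintegralB//; [|exact: Im|exact: Im].
  by apply/eqP; rewrite subr_eq0 -eqr_opp -gW// -gW'.
have : {ae mu, forall x, forall i, Om x -> W x ord0 i - W' x ord0 i = 0}.
  apply: (@negligibleS _ _ _ mu (\bigcup_(k in [set: nat]) if insub k is Some i then [set x | ~ (Om x -> W x ord0 i - W' x ord0 i = 0)] else set0)).
    by move=> x /existsNP[i Hi]; exists (i : nat) => //; rewrite valK.
  apply: negligible_bigcup => k; case: insubP => [i _ _|_]; last exact: negligible_set0.
  exact: H.
apply: ae_imp => x h Ox i; apply/eqP; rewrite -subr_eq0; apply/eqP; exact: h.
Qed.

End approximable.

Lemma measurable_boundary {R : realType} {N : nat} (s : nat) (Om : set 'rV[R]_N) :
  measurable (boundary Om : set (hausdorff_space R N s)).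
Proof.
apply: measurableD.
- by apply: (measurable_closed_om (hausdorff_half s)); exact: closed_closure.
- by apply: (measurable_open_om (hausdorff_half s)); exact: open_interior.
Qed.

Section dominated_everywhere.
Context d {T : measurableType d} {R : realType} (mu : {measure set T -> \bar R}).
Variables (D : set T) (mD : measurable D).

Lemma Rint_dominated_near (fs : nat -> T -> R) f g (e : R) :
  (forall n, measurable_fun D (fs n)) -> L1 mu D g ->
  (forall x, D x -> fs n x @[n --> \oo] --> f x) ->
  (forall n x, D x -> `|fs n x| <= g x) -> 0 < e ->
  L1 mu D f /\ \forall n \near \oo, \int[mu]_(x in D) `|fs n x - f x| <= e.
Proof.
move=> mfs Ig cv fg e0.
have mf : measurable_fun D f by exact: (measurable_fun_cvg mfs).
have [||If + _] := @Rint_dominated _ _ _ mu D fs f g mD mfs mf _ Ig.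
- exact: aeW.
- by apply: aeW => x Dx n; exact: fg.
move=> /cvgrPdist_le/(_ _ e0) h; split=> //; apply: filterS h => n; rewrite sub0r normrN.
exact: le_trans (ler_norm _).
Qed.

End dominated_everywhere.

(** * Truncations and their derivatives *)

Section truncation.
Context {R : realType}.
Implicit Types k s t : R.

Lemma truncE k s : 0 <= k -> trunc k s = if s < - k then - k else if k < s then k else s.
Proof.
move=> k0; rewrite /trunc /Num.max /Num.min.
have [sk|ks] := ltP s k; have [h1|h1] := ltP s (- k); repeat case: ifPn => //;
  rewrite -?leNgt => *; try lra.
Qed.

Lemma trunc_norm k s : 0 <= k -> `|trunc k s| <= k.
Proof.
move=> k0; rewrite truncE// ler_norml.
by case: ifPn; [|case: ifPn]; rewrite -?leNgt; lra.
Qed.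

Lemma trunc_lipschitz k s t : 0 <= k -> `|trunc k s - trunc k t| <= 1 * `|s - t|.
Proof.
move=> k0; rewrite mul1r !truncE// ler_norml.
have := ler_norm (s - t); have := ler_norm (- (s - t)); rewrite normrN => h1 h2.
by repeat (let h := fresh in case: ifPn; rewrite -?leNgt; move=> h); lra.
Qed.

Lemma trunc_continuous k : 0 <= k -> continuous (trunc k).
Proof. by move=> k0; apply: (lipschitz_continuous (M := 1)) => s t; exact: trunc_lipschitz. Qed.

Lemma trunc_id k s : `|s| <= k -> trunc k s = s.
Proof.
move=> sk; rewrite truncE ?(le_trans _ sk)//; move: sk; rewrite ler_norml => /andP[h1 h2].
by rewrite !ltNge h1 h2.
Qed.

Lemma thetaE k s : 0 < k ->
  theta k s = if `|s| < k then 1 else if `|s| == k then 2^-1 else 0.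
Proof.
move=> k0; rewrite /theta /heaviside subr_gt0 subr_eq0 addr_eq0 -(ltrBlDr 0) sub0r ltr_norml eqr_norml (ltW k0) andbT.
by have [a|a|a] := ltgtP s k; have [b|b|b] := ltgtP s (- k) => //=; lra.
Qed.

Lemma theta_norm k s : 0 < k -> `|theta k s| <= 1.
Proof. by move=> k0; rewrite thetaE//; case: ifP => _; [|case: ifP => _]; rewrite ger0_norm//; lra. Qed.

End truncation.

Lemma measurable_theta d (T : measurableType d) (R : realType) (D : set T) (k : R) (v : T -> R) :
  measurable_fun D v -> measurable_fun D (fun x => theta k (v x)).
Proof.
move=> mv; apply: (measurable_fun_cvg (h := fun n x => smooth_trunc' k n (v x))).
  move=> n; apply: (measurable_comp_continuous _ mv).
  by apply: lipschitz_continuous => a b; exact: smooth_trunc'_lipschitz.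
by move=> x _; exact: smooth_trunc_cvg'.
Qed.

(** * Closure properties of [appr] *)

Section appr_closure.
Context {R : realType} {N : nat}.
Local Notation V := 'rV[R]_N.
Local Notation S := (lebesgue_space R N).
Local Notation mu := (leb R N).
Local Notation H := (hausdorff_om R N N.-1).
Variables (Om : set V) (oO : open Om) (bO : bounded_set Om) (N0 : (0 < N)%N).
Implicit Types (E : set V) (v tau phi psi : V -> R) (W : V -> V).

Let mO : measurable (Om : set S) := measurable_open_om leb_half oO.
Let Ofin : (mu Om < +oo)%E := leb_bounded bO.

Lemma appr_trace p v W tau : 1 < p -> sobolev_grad Om p v W -> is_trace Om p v tau ->
  appr Om (boundary Om) v W tau.
Proof.
move=> p1 gW [[mtau _] [W' [phi [gW' sphi cv cW cb]]]].
have p1' := ltW p1; have p0 := lt_trans ltr01 p1.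
have [Lv LW _] := gW; have [_ LW' _] := gW'.
have Iv := in_Lp_L1 p1' mO Ofin Lv.
have IW i := in_Lp_L1 p1' mO Ofin (LW i); have IW' i := in_Lp_L1 p1' mO Ofin (LW' i).
(* [is_trace] brings its own weak gradient [W'], which has to be identified with the given one. *)
have WW' := weak_grad_unique oO bO N0 p1' gW' gW.
split=> // e e0.
have Iphi n := smooth_L1 oO bO (sphi n).
have Idphi i n := smooth_L1 oO bO (@smooth_partial _ _ _ i (sphi n)).
have nv := cvg_Lp_L1 p1' mO Ofin Iphi Iv cv e0.
have nW : \forall n \near \oo, forall i,
    \int[mu]_(x in Om) `|partial i (phi n) x - W' x ord0 i| <= e.
  by apply: filter_forall => i; exact: (cvg_Lp_L1 p1' mO Ofin (Idphi i) (IW' i) (cW i) e0).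
have mphi n : measurable_fun (boundary Om : set (hausdorff_space R N N.-1)) (phi n).
  apply: measurable_funTS; apply: (continuous_measurable_om (hausdorff_half _)).
  exact: smooth_continuous.
have nb := cvg_Lp_measure p0 (measurable_boundary _ Om) mphi mtau cb e0.
near \oo => n.
exists (phi n); split.
- exact: sphi.
- by near: n.
- move=> i; rewrite (_ : \int[mu]_(x in Om) _ =
    \int[mu]_(x in Om) `|partial i (phi n) x - W' x ord0 i|).
    by move: i; near: n.
  have mi (Z : V -> V) : L1 mu Om (fun x => Z x ord0 i) ->
      measurable_fun (Om : set S) (fun x => `|partial i (phi n) x - Z x ord0 i|).
    by move=> IZ; apply: (L1_measurable mO (L1_norm (L1B mO (Idphi i n) IZ))).
  apply: (Rintegral_ae mO (mi _ (IW i)) (mi _ (IW' i))).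
  by apply: ae_imp WW' => x h Ox; rewrite h.
- by apply: ltW; near: n.
Unshelve. all: by end_near. Qed.

Lemma H_triangle E (f g h : V -> R) (e1 e2 : R) :
  (H (E `&` [set x | e1 + e2 < `|f x - h x|]%R) <=
   H (E `&` [set x | e1 < `|f x - g x|]%R) + H (E `&` [set x | e2 < `|g x - h x|]%R))%E.
Proof.
apply: le_trans (outer_measureU2 _ _ _); apply: le_outer_measure => x [Ex /= hx].
have [h1|h1] := ltP e1 `|f x - g x|; first by left.
right; split=> //=; rewrite ltNge; apply/negP => h2; move: hx; rewrite ltNge => /negP; apply.
by rewrite (le_trans _ (lerD h1 h2))// (le_trans _ (ler_normD _ _))// addrA subrK.
Qed.

Lemma apprS E E' v W tau : E' `<=` E -> appr Om E v W tau -> appr Om E' v W tau.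
Proof.
move=> EE [Iv IW ap]; split=> // e /ap[phi [? ? ? h]]; exists phi; split=> //.
by apply: le_trans h; apply: le_outer_measure => x [/EE].
Qed.

Lemma appr_eq E v W tau v' W' tau' : (forall x, v x = v' x) ->
  (forall x i, W x ord0 i = W' x ord0 i) -> (forall x, E x -> tau x = tau' x) ->
  appr Om E v W tau -> appr Om E v' W' tau'.
Proof.
move=> /funext -> WW tt [Iv IW ap]; split=> //.
  by move=> i; rewrite (_ : (fun x => _) = (fun x => W x ord0 i))//; apply/funext => x; rewrite WW.
move=> e /ap[phi [? ? h3 h4]]; exists phi; split=> //.
  by move=> i; rewrite (le_trans _ (h3 i))//; under eq_Rintegral do rewrite -WW.
apply: le_trans h4; apply: le_outer_measure => x [Ex /=]; rewrite -tt// => h; by split.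
Qed.

Lemma appr_sub E v W tau v' W' tau' : appr Om E v W tau -> appr Om E v' W' tau' ->
  appr Om E (fun x => v x - v' x) (fun x => W x - W' x) (fun x => tau x - tau' x).
Proof.
move=> [Iv IW ap] [Iv' IW' ap'].
have WE i : (fun x => (W x - W' x) ord0 i) = (fun x => W x ord0 i - W' x ord0 i).
  by apply/funext => x; rewrite !mxE.
have key (f g f' g' : V -> R) (e : R) : L1 mu Om f -> L1 mu Om g -> L1 mu Om f' -> L1 mu Om g' ->
    \int[mu]_(x in Om) `|f x - g x| <= e / 2 -> \int[mu]_(x in Om) `|f' x - g' x| <= e / 2 ->
    \int[mu]_(x in Om) `|f x - f' x - (g x - g' x)| <= e.
  move=> If Ig If' Ig' h1 h2.
  have := le_Rint_norm mO (L1B mO If Ig) (L1N mO (L1B mO If' Ig')).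
  rewrite (_ : (fun x => `|f x - g x - (f' x - g' x)|) = (fun x => `|f x - f' x - (g x - g' x)|)); last first.
    by apply/funext => x; congr (`|_|); ring.
  move=> /le_trans; apply; rewrite (splitr e); apply: lerD => //.
  by under eq_Rintegral do rewrite normrN.
split; [exact: L1B| by move=> i; rewrite WE; exact: L1B|].
move=> e e0; have e20 : 0 < e / 2 by rewrite divr_gt0.
have [phi [s1 a1 b1 c1]] := ap _ e20; have [psi [s2 a2 b2 c2]] := ap' _ e20.
exists (fun x => phi x - psi x); split.
- exact: smoothB.
- by apply: key => //; exact: smooth_L1.
- move=> i; under eq_Rintegral => x _ do rewrite (partialB i s1 s2) !mxE.
  by apply: key => //; apply: smooth_L1 => //; exact: smooth_partial.
- rewrite {2}(splitr e) EFinD; apply: le_trans (leeD c1 c2).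
  apply: le_trans (outer_measureU2 _ _ _); apply: le_outer_measure => x [Ex /= hx].
  have [h1|h1] := ltP (e / 2) `|phi x - tau x|; first by left.
  right; split=> //=; rewrite ltNge; apply/negP => h2; move: hx; rewrite ltNge => /negP; apply.
  rewrite (_ : _ - _ - _ = (phi x - tau x) - (psi x - tau' x)); last by ring.
  by rewrite (le_trans (ler_normB _ _))// (splitr e) lerD.
Qed.

Lemma appr_closed E v W tau : L1 mu Om v -> (forall i, L1 mu Om (fun x => W x ord0 i)) ->
  (forall e, 0 < e -> exists v' W' tau', [/\ appr Om E v' W' tau',
    \int[mu]_(x in Om) `|v' x - v x| <= e,
    forall i, \int[mu]_(x in Om) `|W' x ord0 i - W x ord0 i| <= e &
    (H (E `&` [set x | e < `|tau' x - tau x|]%R) <= e%:E)%E]) -> appr Om E v W tau.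
Proof.
move=> Iv IW cl; split=> // e e0; have e20 : 0 < e / 2 by rewrite divr_gt0.
have [v' [W' [tau' [[Iv' IW' ap] a1 b1 c1]]]] := cl _ e20.
have [phi [s2 a2 b2 c2]] := ap _ e20; exists phi; split=> //.
- rewrite (le_trans (Rint_triangle mO _ Iv' Iv))//; first exact: smooth_L1.
  by rewrite (splitr e) lerD.
- move=> i; rewrite (le_trans (Rint_triangle mO _ (IW' i) (IW i)))//.
    by apply: smooth_L1 => //; exact: smooth_partial.
  by rewrite (splitr e) lerD.
- rewrite {1 2}(splitr e) EFinD; apply: le_trans (leeD c2 c1); exact: H_triangle.
Qed.

Lemma Rint_lipschitz (F : R -> R) (M : R) (f g : V -> R) : continuous F ->
  (forall a b, `|F a - F b| <= M * `|a - b|) -> L1 mu Om f -> L1 mu Om g ->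
  \int[mu]_(x in Om) `|F (f x) - F (g x)| <= M * \int[mu]_(x in Om) `|f x - g x|.
Proof.
move=> cF FM If Ig.
have I1 := L1_lipschitz_comp mO Ofin cF FM If; have I2 := L1_lipschitz_comp mO Ofin cF FM Ig.
have I3 : L1 mu Om (fun x => `|f x - g x|) by exact/L1_norm/L1B.
rewrite -RintegralZl//; apply: le_Rintegral => //.
- exact: (L1_norm (L1B mO I1 I2)).
- exact: L1Z.
Qed.

Lemma appr_comp (F F' : R -> R) (M K : R) E v W tau : 0 <= K -> Cinf F ->
  (forall x, is_derive x (1 : R) F (F' x)) -> (forall x, `|F' x| <= M) ->
  (forall a b, `|F' a - F' b| <= K * `|a - b|) -> appr Om E v W tau ->
  appr Om E (F \o v) (fun x => F' (v x) *: W x) (F \o tau).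
Proof.
move=> K0 CF dF F'M F'K [Iv IW ap].
have M0 : 0 <= M by exact: le_trans (F'M 0).
have FM := lipschitz_of_derive dF F'M.
have cF := lipschitz_continuous FM; have cF' := lipschitz_continuous F'K.
have WE i : (fun x => (F' (v x) *: W x) ord0 i) = (fun x => F' (v x) * W x ord0 i).
  by apply/funext => x; rewrite mxE.
split; [exact: (L1_lipschitz_comp mO Ofin cF FM Iv)| |].
  move=> i; rewrite WE; apply: (L1_mul mO (M := M)) (IW i) => //.
  exact: (measurable_comp_continuous cF' (L1_measurable mO Iv)).
move=> e e0.
(* The level [m] of the tails is fixed first, the same for all coordinates; only then is the
   precision [e'] chosen, since the estimate contains [K * m * e']. *)
have [m m0 Hm] : exists2 m, 0 <= m &
    forall i : 'I_N, 2 * M * \int[mu]_(x in Om) tail (fun x : S => W x ord0 i) m x <= e / 2.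
  have t0 : 0 < e / 2 / (2 * M + 1) by rewrite !divr_gt0// ltr_wpDl ?mulr_ge0.
  have /choice[ms Hms] (i : 'I_N) : exists m, 0 <= m /\
      \int[mu]_(x in Om) tail (fun x : S => W x ord0 i) m x < e / 2 / (2 * M + 1).
    by have [m m0 Hm] := L1_tail mO (IW i) t0; exists m.
  have ms0 i := (Hms i).1.
  exists (\sum_i ms i); first by apply: sumr_ge0 => i _.
  move=> i; apply: (@le_trans _ _ (2 * M * (e / 2 / (2 * M + 1)))).
    rewrite ler_wpM2l ?mulr_ge0//; apply: le_trans (ltW (Hms i).2).
    apply: le_Rintegral => //; [exact: L1_tail_fun|exact: L1_tail_fun|].
    by move=> x _; apply: tail_mono; rewrite (bigD1 i)//= lerDl sumr_ge0.
  rewrite mulrCA ler_piMr ?divr_ge0 ?(ltW e0)// ler_pdivrMr ?mul1r ?ltr_wpDl ?mulr_ge0//.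
  by rewrite lerDl.
pose C := M + K * m + 1; have C0 : 0 < C by rewrite ltr_wpDl// addr_ge0// mulr_ge0.
pose e' := Num.min e (e / 2 / C).
have e'0 : 0 < e' by rewrite lt_min e0 !divr_gt0.
have e'e : e' <= e by rewrite ge_min lexx.
have e'C : e' * C <= e / 2 by rewrite -ler_pdivlMr// ge_min lexx orbT.
have Ce' : (M + K * m) * e' <= e / 2.
  by apply: le_trans e'C; rewrite mulrC ler_wpM2l ?(ltW e'0)// /C lerDl.
have Me' : M * e' <= e.
  rewrite (@le_trans _ _ ((M + K * m) * e'))//; last by rewrite (le_trans Ce')// ler_pdivrMr// mulr_natr mulr2n lerDl ltW.
  by rewrite ler_wpM2r ?(ltW e'0)// lerDl mulr_ge0.
have [phi [sphi a1 b1 c1]] := ap _ e'0.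
have Iphi := smooth_L1 oO bO sphi.
exists (F \o phi); split.
- exact: smooth_comp_Cinf.
- by rewrite (le_trans (Rint_lipschitz cF FM Iphi Iv))// (le_trans _ Me')// ler_wpM2l.
- move=> i; have Idphi := smooth_L1 oO bO (@smooth_partial _ _ _ i sphi).
  rewrite (_ : (fun x => `|_|) = (fun x => `|F' (phi x) * partial i phi x - F' (v x) * W x ord0 i|)); last first.
    by apply/funext => x; rewrite mxE (partial_comp i (dF _))//; exact: smooth_differentiable.
  rewrite (le_trans (chain_estimate mO m0 K0 F'M F'K Iphi Iv Idphi (IW i)))// addrA (splitr e) lerD//.
  apply: le_trans Ce'; rewrite mulrDl lerD// ler_wpM2l// mulr_ge0//.
- apply: (@le_trans _ _ e'%:E); last by rewrite lee_fin.
  apply: le_trans c1; apply: le_outer_measure => x [Ex /= h]; split=> //=.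
  rewrite ltNge; apply/negP => h'; move: h; rewrite ltNge => /negP; apply.
  by rewrite (le_trans (FM _ _))// (le_trans _ Me')// ler_wpM2l.
Qed.

(** [trunc k] has corners, so [appr_comp] is applied to smooth truncations and the limit is taken
    with [appr_closed]: values and traces converge uniformly, gradients by domination, as
    [smooth_trunc'] tends to [theta k] everywhere. *)
Lemma appr_trunc (k : R) E v W tau : 0 < k -> appr Om E v W tau ->
  appr Om E (trunc k \o v) (fun x => theta k (v x) *: W x) (trunc k \o tau).
Proof.
move=> k0 av; have [Iv IW _] := av; have k0' := ltW k0.
have mv := L1_measurable mO Iv.
have WE (f : V -> R) i : (fun x => (f x *: W x) ord0 i) = (fun x => f x * W x ord0 i).
  by apply/funext => x; rewrite mxE.
have mst n : measurable_fun (Om : set S) (fun x => smooth_trunc' k n (v x)).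
  apply: (measurable_comp_continuous _ mv).
  by apply: lipschitz_continuous => a b; exact: smooth_trunc'_lipschitz.
have mth := measurable_theta k mv.
have an n : appr Om E (smooth_trunc k n \o v) (fun x => smooth_trunc' k n (v x) *: W x)
    (smooth_trunc k n \o tau).
  apply: (@appr_comp _ _ 1 (2 * n.+1%:R)) => //.
  - exact: Cinf_smooth_trunc.
  - by move=> x; exact: smooth_trunc_derive.
  - by move=> x; exact: smooth_trunc'_norm.
  - by move=> a b; exact: smooth_trunc'_lipschitz.
apply: appr_closed.
- apply: (L1_lipschitz_comp mO Ofin (trunc_continuous k0') _ Iv).
  by move=> a b; exact: trunc_lipschitz.
- move=> i; rewrite WE; apply: (L1_mul mO (M := 1)) (IW i) => // x _; exact: theta_norm.
move=> e e0.
have cW : \forall n \near \oo, forall i, \int[mu]_(x in Om)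
    `|smooth_trunc' k n (v x) * W x ord0 i - theta k (v x) * W x ord0 i| <= e.
  apply: filter_forall => i.
  have mW := L1_measurable mO (IW i).
  apply: (proj2 (Rint_dominated_near mO _ (L1_norm (IW i)) _ _ e0)).
  - by move=> n; exact: (measurable_funM (mst n) mW).
  - by move=> x _; apply: cvgMl; exact: smooth_trunc_cvg'.
  - by move=> n x _; rewrite normrM ler_piMl//; exact: smooth_trunc'_norm.
pose m := fine (mu Om); have m0 : 0 <= m by rewrite fine_ge0.
have e1 : 0 < e / (m + 1) / ln 2 by rewrite !divr_gt0// ?ltr_wpDl// ln_gt0// ltr1n.
have sn : \forall n \near \oo, forall s : R, `|smooth_trunc k n s - trunc k s| <= e / (m + 1).
  apply: filterS (near_infty_natSinv_lt (PosNum e1)) => n /ltW/= h s.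
  rewrite (le_trans (smooth_trunc_near _ _ k0'))// mulrC -ler_pdivlMr// ln_gt0// ltr1n//.
near \oo => n.
have h1 : forall s : R, `|smooth_trunc k n s - trunc k s| <= e / (m + 1) by near: n.
have em : e / (m + 1) <= e by rewrite ler_pdivrMr ?ltr_wpDl// mulrDr mulr1 lerDr mulr_ge0// ltW.
exists (smooth_trunc k n \o v), (fun x => smooth_trunc' k n (v x) *: W x), (smooth_trunc k n \o tau).
split; first exact: an.
- have [Ist _ _] := an n.
  apply: (@le_trans _ _ (\int[mu]_(x in Om) (e / (m + 1)))).
    apply: le_Rintegral => //.
    + apply: L1_norm; apply: L1B => //.
      apply: (L1_lipschitz_comp mO Ofin (trunc_continuous k0') _ Iv).
      by move=> a b; exact: trunc_lipschitz.
    + by apply: (@L1_bounded _ _ _ _ _ _ `|e / (m + 1)|).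
    + by move=> x _; exact: h1.
  by rewrite Rintegral_cst// -/m -mulrA ler_piMr ?(ltW e0)// mulrC ler_pdivrMr ?ltr_wpDl// mul1r lerDl.
- have h i : \int[mu]_(x in Om) `|smooth_trunc' k n (v x) * W x ord0 i - theta k (v x) * W x ord0 i| <= e.
    by move: i; near: n.
  move=> i; apply: le_trans (h i); rewrite le_eqVlt; apply/orP; left; apply/eqP.
  by congr Rintegral; apply/funext => x; rewrite !mxE.
- rewrite (_ : _ `&` _ = set0) ?outer_measure0 ?lee_fin ?(ltW e0)//.
  apply/seteqP; split=> // x [_ /=]; rewrite ltNge => /negP; apply.
  exact: le_trans (h1 _) em.
Unshelve. all: by end_near. Qed.

End appr_closure.

Lemma Rint_sum d (T : measurableType d) (R : realType) (nu : {measure set T -> \bar R})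
    (D : set T) (I : Type) (r : seq I) (F : I -> T -> R) : measurable D ->
  (forall i, L1 nu D (F i)) ->
  \int[nu]_(x in D) (\sum_(i <- r) F i x) = \sum_(i <- r) \int[nu]_(x in D) F i x.
Proof.
move=> mD IF; elim: r => [|i r IH].
  rewrite big_nil; under eq_Rintegral do rewrite big_nil; by rewrite /Rintegral integral0.
rewrite big_cons -IH -(RintegralD mD (IF i) (L1_sum _ mD IF)).
by congr Rintegral; apply/funext => x; rewrite big_cons.
Qed.

(** * Functions with zero gradient *)

Section steps.
Context {R : realType} {N : nat}.
Local Notation V := 'rV[R]_N.
Local Notation S := (lebesgue_space R N).
Local Notation mu := (leb R N).
Implicit Types (f phi psi : V -> R) (x e w : V).

Definition dird e f x := \sum_(i < N) e ord0 i * partial i f x.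

Lemma smooth_dird e f : smooth f -> smooth (dird e f).
Proof.
move=> sf; rewrite /dird; elim: (index_enum _) => [|i l IH].
  by under [X in smooth X]funext do rewrite big_nil; exact: smooth_cst.
rewrite (_ : (fun x => _) = (fun x => e ord0 i * partial i f x + \sum_(j <- l) e ord0 j * partial j f x)).
  by apply: smoothD => //; apply: smoothM; [exact: smooth_cst|exact: smooth_partial].
by apply/funext => x; rewrite big_cons.
Qed.

(** Two applications of the mean value theorem; [B] bounds the second derivative in the direction
    [e] on a cube that contains the segments. *)
Lemma step_estimate f e r : smooth f -> exists2 B, 0 <= B & forall x s,
  `|x| <= r -> 0 <= s <= 1 -> `|f (x + s *: e) - f x| <= s * (`|dird e f x| + s * B).
Proof.
move=> sf; have sd := smooth_dird e sf; have sdd := smooth_dird e sd.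
have [B B0 HB] := continuous_bounded_compact (smooth_continuous sdd) (@cube_compact _ _ 0 (r + `|e|)).
exists B => // x s xr /andP[s0 s1].
have [s' /andP[s'0 s's] ->] := line_mvt x e sf s0.
rewrite normrM ger0_norm// ler_wpM2l// derive_partial; last exact: smooth_differentiable.
rewrite -/(dird e f (x + s' *: e)) -[X in `|X|](subrK (dird e f x)) addrC.
rewrite (le_trans (ler_normD _ _))// lerD2l.
have [s'' /andP[s''0 s''s] ->] := line_mvt x e sd s'0.
rewrite normrM ger0_norm// derive_partial; last exact: smooth_differentiable.
apply: ler_pM => //; apply: HB; rewrite /cube/= subr0 (le_trans (ler_normD _ _))// lerD//.
by rewrite normrZ ger0_norm// ler_piMl// (le_trans s''s)// (le_trans s's).
Qed.

Lemma Rint_transl (A : set V) f w : measurable (A : set S) ->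
  measurable_fun (setT : set S) f ->
  \int[mu]_(x in A) f (x + w) = \int[mu]_(x in transl (- w) @^-1` A) f x.
Proof.
move=> mA mf; rewrite /Rintegral; congr fine; have mA' := measurable_transl_set (- w) mA.
rewrite -[in RHS](@integral_transl R N w (transl (- w) @^-1` A) (EFin \o f) mA').
  by rewrite translK.
by apply/measurable_EFinP; exact: measurable_funTS.
Qed.

Lemma le_Rint_subset (A U : set V) f : measurable (A : set S) -> measurable (U : set S) ->
  A `<=` U -> L1 mu U f -> (forall x, 0 <= f x) ->
  \int[mu]_(x in A) f x <= \int[mu]_(x in U) f x.
Proof.
move=> mA mU AU If f0; have IA := L1S mA mU AU If.
rewrite -lee_fin !EFin_Rintegral//; apply: ge0_subset_integral => //.
  by apply/measurable_EFinP; exact: (L1_measurable mU If).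
by move=> x _; rewrite lee_fin.
Qed.

Lemma continuous_L1 f (D : set V) : measurable (D : set S) -> bounded_set D ->
  continuous f -> L1 mu D f.
Proof.
move=> mD bD cf; have [M [_ /(_ (M + 1))]] := bD; rewrite ltrDl ltr01 => /(_ isT) HM.
have [C C0 HC] := continuous_bounded_compact cf (@cube_compact _ _ 0 (M + 1)).
apply: (@L1_bounded _ _ _ _ _ _ C) => //; first exact: leb_bounded.
  by apply: measurable_funTS; exact: (continuous_measurable_om leb_half).
by move=> x Dx; apply: HC; rewrite /cube/= subr0; exact: HM.
Qed.

Lemma continuous_transl f w : continuous f -> continuous (fun x => f (x + w)).
Proof.
move=> cf x; have ct : continuous (fun y : V => y + w).
  by move=> y; apply: continuousD; [move=> A; exact: id|exact: cst_continuous].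
exact: (continuous_comp (ct x) (cf _)).
Qed.

Lemma continuous_normf f : continuous f -> continuous (fun x => `|f x|).
Proof. by move=> cf x; exact: (continuous_comp (cf x) (@norm_continuous _ _ _)). Qed.

(** The translation by [w] is cut into [n + 1] equal steps. By translation invariance each costs
    [1 / (n + 1)] times the integral of the derivative over a translate of [A] inside [U], up to a
    second order error; the errors add up to [O (1 / n)]. *)
Lemma transl_estimate (A U : set V) phi w : smooth phi -> measurable (A : set S) ->
  bounded_set A -> open U -> bounded_set U ->
  (forall x t, A x -> 0 <= t <= 1 -> U (x + t *: w)) ->
  \int[mu]_(x in A) `|phi (x + w) - phi x| <= \int[mu]_(x in U) `|dird w phi x|.
Proof.
move=> sphi mA bA oU bU AU.
have mU : measurable (U : set S) := measurable_open_om leb_half oU.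
have Afin := leb_bounded bA; have Ufin := leb_bounded bU.
have sd := smooth_dird w sphi.
have [M [_ /(_ (M + 1))]] := bA; rewrite ltrDl ltr01 => /(_ isT) HM.
have [B B0 HB] := step_estimate w (M + 1 + `|w|) sphi.
have cphi := smooth_continuous sphi; have cd := smooth_continuous sd.
apply/ler_addgt0Pr => eps eps0.
pose m := fine (mu A); have m0 : 0 <= m by rewrite fine_ge0.
have [n Hn] : exists n, B * m * n.+1%:R^-1 <= eps.
  have b0 : 0 <= B * m / eps by rewrite divr_ge0 ?mulr_ge0// ltW.
  exists (Num.bound (B * m / eps)); have h := archi_boundP b0.
  rewrite ler_pdivrMr ?ltr0n// [leRHS]mulrC -ler_pdivrMr//.
  by rewrite (le_trans (ltW h))// ler_nat; exact: leqnSn.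
set k : R := n.+1%:R in Hn; have k0 : 0 < k by rewrite ltr0n.
pose X (j : nat) x := x + (j%:R / k) *: w.
have XS j x : X j.+1 x = X j x + k^-1 *: w.
  by rewrite /X -addrA -scalerDl -natr1 mulrDl mul1r.
have jk j : (j < n.+1)%N -> 0 <= j%:R / k <= 1.
  by move=> jn; rewrite divr_ge0 ?(ltW k0)//= ler_pdivrMr// mul1r ler_nat ltnW.
have Xb j x : A x -> (j < n.+1)%N -> `|X j x| <= M + 1 + `|w|.
  move=> Ax /jk /andP[j0 j1]; rewrite (le_trans (ler_normD _ _))// lerD//; first exact: HM.
  by rewrite normrZ ger0_norm// ler_piMl.
have pw x : A x -> `|phi (x + w) - phi x| <=
    \sum_(j < n.+1) k^-1 * (`|dird w phi (X j x)| + k^-1 * B).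
  move=> Ax.
  have -> : phi (x + w) - phi x = \sum_(0 <= j < n.+1) (phi (X j.+1 x) - phi (X j x)).
    by rewrite (telescope_sumr (fun j => phi (X j x)))// /X mul0r scale0r addr0 divff ?gt_eqF// scale1r.
  rewrite big_mkord (le_trans (ler_norm_sum _ _ _))//; apply: ler_sum => j _.
  rewrite XS HB ?Xb//; last by rewrite invr_ge0 (ltW k0)/= invf_le1// ler1n.
have cdX j : continuous (fun x => `|dird w phi (X j x)|).
  exact/continuous_normf/(continuous_transl cd).
have IX j : L1 mu A (fun x => `|dird w phi (X j x)|) by exact: continuous_L1.
have Icst : L1 mu A (fun _ => k^-1 * B).
  by apply: (@L1_bounded _ _ _ _ _ _ `|k^-1 * B|).
have IF j : L1 mu A (fun x => k^-1 * (`|dird w phi (X j x)| + k^-1 * B)).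
  by apply: L1Z => //; exact: L1D.
apply: (@le_trans _ _ (\int[mu]_(x in A) (\sum_(j < n.+1) k^-1 * (`|dird w phi (X j x)| + k^-1 * B)))).
  apply: le_Rintegral => //; last exact: (L1_sum (I := 'I_n.+1) _ mA IF).
  exact: (L1_norm (L1B mA (continuous_L1 mA bA (continuous_transl cphi)) (continuous_L1 mA bA cphi))).
rewrite (Rint_sum (I := 'I_n.+1) _ mA IF).
apply: (@le_trans _ _ (\sum_(j < n.+1) k^-1 * (\int[mu]_(x in U) `|dird w phi x| + k^-1 * (B * m)))).
  apply: ler_sum => j _; rewrite RintegralZl//; last exact: L1D.
  rewrite ler_wpM2l ?invr_ge0 ?(ltW k0)// (RintegralD mA (IX j) Icst) Rintegral_cst// -/m mulrA lerD2r.
  have mdn : measurable_fun (setT : set S) (fun x => `|dird w phi x|).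
    by apply: (continuous_measurable_om leb_half); exact: continuous_normf.
  rewrite /X (Rint_transl _ mA mdn).
  apply: le_Rint_subset => //.
  - exact: measurable_transl_set.
  - move=> x; rewrite /transl/= => Ax; rewrite -(subrK ((j%:R / k) *: w) x).
    by apply: AU => //; exact: jk.
  - by apply: continuous_L1 => //; exact: continuous_normf.
rewrite sumr_const card_ord -mulr_natl -/k mulrA divff ?gt_eqF// mul1r lerD2l.
by rewrite mulrC.
Qed.

Lemma transl_dird_bound (U : set V) phi w (e : R) : smooth phi -> open U -> bounded_set U ->
  (forall i, \int[mu]_(x in U) `|partial i phi x| <= e) ->
  \int[mu]_(x in U) `|dird w phi x| <= (\sum_i `|w ord0 i|) * e.
Proof.
move=> sphi oU bU H; have mU : measurable (U : set S) := measurable_open_om leb_half oU.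
have Ip i : L1 mu U (fun x => `|partial i phi x|).
  by apply: L1_norm; apply: smooth_L1 => //; exact: smooth_partial.
have IZ i : L1 mu U (fun x => `|w ord0 i| * `|partial i phi x|) by exact: L1Z.
apply: (@le_trans _ _ (\int[mu]_(x in U) (\sum_(i < N) `|w ord0 i| * `|partial i phi x|))).
  apply: le_Rintegral => //.
  - by apply: L1_norm; apply: smooth_L1 => //; exact: smooth_dird.
  - exact: (L1_sum (I := 'I_N) _ mU IZ).
  - move=> x _; rewrite (le_trans (ler_norm_sum _ _ _))//; apply: ler_sum => i _.
    by rewrite normrM.
rewrite (Rint_sum (I := 'I_N) _ mU IZ) mulr_suml; apply: ler_sum => i _.
rewrite RintegralZl//; [by apply: ler_wpM2l|exact: Ip].
Qed.

Lemma appr_transl_invariant Om E v tau (A : set V) w : open Om -> bounded_set Om ->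
  appr Om E v (fun=> 0) tau -> measurable (A : set S) -> bounded_set A ->
  (forall x t, A x -> 0 <= t <= 1 -> Om (x + t *: w)) ->
  \int[mu]_(x in transl (- w) @^-1` A) v x = \int[mu]_(x in A) v x.
Proof.
move=> oO bO [Iv _ ap] mA bA AO.
have mO : measurable (Om : set S) := measurable_open_om leb_half oO.
have AOm : A `<=` Om by move=> x /AO/(_ (_ : 0 <= 0 <= 1)); rewrite lexx ler01 scale0r addr0; exact.
have mA' := measurable_transl_set (- w) mA.
have AOm' : transl (- w) @^-1` A `<=` Om.
  by move=> x /AO/(_ (_ : 0 <= 1 <= 1)); rewrite lexx ler01 scale1r /transl subrK; exact.
apply/eqP; rewrite -subr_eq0 -normr_le0; apply/ler_addgt0Pr => e e0; rewrite add0r.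
(* The sum pays for the gradient of the approximant along [w], the 2 for replacing [v] by the
   approximant on [A] and on its translate. *)
pose C := \sum_i `|w ord0 i| + 2; have C0 : 0 < C by rewrite ltr_wpDl// sumr_ge0.
have [phi [sphi a1 b1 _]] := ap _ (divr_gt0 e0 C0).
have Iphi := smooth_L1 oO bO sphi.
have near_int (B : set V) : measurable (B : set S) -> B `<=` Om ->
    `|\int[mu]_(x in B) phi x - \int[mu]_(x in B) v x| <= e / C.
  move=> mB BO; have IB := L1S mB mO BO Iphi; have IBv := L1S mB mO BO Iv.
  rewrite -RintegralB//; apply: le_trans (le_normr_Rintegral mB (L1B mB IB IBv)) _.
  apply: le_trans a1; apply: le_Rint_subset => //.
  exact: (L1_norm (L1B mO Iphi Iv)).
have := near_int _ mA AOm; have := near_int _ mA' AOm'.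
rewrite -(Rint_transl _ mA); last by apply: (continuous_measurable_om leb_half); exact: smooth_continuous.
have ct : continuous (fun x => phi (x + w)) by exact/continuous_transl/smooth_continuous.
have IAt := continuous_L1 mA bA ct; have IA := L1S mA mO AOm Iphi.
have : `|\int[mu]_(x in A) phi (x + w) - \int[mu]_(x in A) phi x| <= (\sum_i `|w ord0 i|) * (e / C).
  rewrite -RintegralB//; apply: le_trans (le_normr_Rintegral mA (L1B mA IAt IA)) _.
  apply: le_trans (transl_estimate sphi mA bA oO bO AO) _.
  apply: transl_dird_bound => // i; apply: le_trans (b1 i).
  by under [leRHS]eq_Rintegral do rewrite mxE subr0.
set a := \int[mu]_(x in A) phi (x + w); set b := \int[mu]_(x in A) phi x.
set c := \int[mu]_(x in _ @^-1` _) v x; set d := \int[mu]_(x in A) v x => h1 h2 h3.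
rewrite (_ : c - d = (a - b) - (a - c) + (b - d)); last by ring.
apply: le_trans (ler_normD _ _) _; apply: le_trans (lerD (ler_normB _ _) (lexx _)) _.
apply: le_trans (lerD (lerD h1 h2) h3) _.
have -> : (\sum_i `|w ord0 i|) * (e / C) + e / C + e / C = C * (e / C) by rewrite /C; ring.
by rewrite mulrC divfK// gt_eqF.
Qed.

End steps.

Lemma bounded_setS {R : realType} {N : nat} (A B : set 'rV[R]_N) : A `<=` B ->
  bounded_set B -> bounded_set A.
Proof. by move=> AB [M [Mr H]]; exists M; split=> // K MK x /AB; exact: H. Qed.

(** * Repeated halving of boxes *)

Section half_open_boxes.
Context {R : realType} {N : nat}.
Local Notation V := 'rV[R]_N.
Local Notation S := (lebesgue_space R N).
Local Notation mu := (leb R N).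
Implicit Types (a b x : V) (v tau psi : V -> R).

(** Half-open, so that halving yields a partition into two boxes of the same kind, which are
    translates of each other. *)
Definition hbox a b : set V := [set x | forall i, a ord0 i <= x ord0 i < b ord0 i].

Lemma measurable_hbox a b : measurable (hbox a b : set S).
Proof.
rewrite (_ : hbox a b = \bigcap_(i in [set: 'I_N])
  ((fun x : S => x ord0 i) @^-1` `[a ord0 i, b ord0 i[)).
  apply: fin_bigcap_measurable => // i _; rewrite -[X in measurable X]setTI.
  exact: (measurable_coord leb_half).
apply/seteqP; split => x.
  by move=> H i _ /=; rewrite in_itv/=; exact: H.
by move=> H i; have := H i I; rewrite /= in_itv.
Qed.

Lemma hbox_cbox a b : hbox a b `<=` cbox a b.
Proof. by move=> x H i; have /andP[-> /ltW ->] := H i. Qed.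

Lemma bounded_hbox a b : bounded_set (hbox a b).
Proof.
by apply: (bounded_setS (@hbox_cbox a b)); apply: compact_bounded; exact: compact_cbox.
Qed.

Definition mid a b i : R := (a ord0 i + b ord0 i) / 2.

Lemma upd_same a i (m : R) : upd a i m ord0 i = m. Proof. by rewrite mxE eqxx. Qed.

Lemma upd_other a i j (m : R) : j != i -> upd a i m ord0 j = a ord0 j.
Proof. by rewrite mxE => /negPf ->. Qed.

Lemma hbox_split a b i : (forall j, a ord0 j <= b ord0 j) ->
  hbox a b = hbox a (upd b i (mid a b i)) `|` hbox (upd a i (mid a b i)) b.
Proof.
move=> ab; have mi : a ord0 i <= mid a b i <= b ord0 i.
  by rewrite /mid; have := ab i; lra.
apply/seteqP; split => x.
  move=> H; have [h|h] := ltP (x ord0 i) (mid a b i); [left|right] => j;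
    have [->|ji] := eqVneq j i; rewrite ?upd_same ?upd_other//; have := H i; lra.
move=> [] H j; have := H j; have [->|ji] := eqVneq j i; rewrite ?upd_same ?upd_other//; lra.
Qed.

Lemma hbox_transl a b i : (forall j, a ord0 j <= b ord0 j) ->
  hbox (upd a i (mid a b i)) b =
  transl (- (((b ord0 i - a ord0 i) / 2) *: delta_mx ord0 i)) @^-1` hbox a (upd b i (mid a b i)).
Proof.
move=> ab; apply/seteqP; split => x H j; have := H j; rewrite /transl !mxE eqxx /=;
  have [->|ji] := eqVneq j i; rewrite ?mulr1 ?mulr0 ?subr0// /mid; lra.
Qed.

Variables (Om E : set V) (tau : V -> R).
Hypotheses (oO : open Om) (bO : bounded_set Om).
Variable v : V -> R.
Hypothesis av : appr Om E v (fun=> 0) tau.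
Let mO : measurable (Om : set S) := measurable_open_om leb_half oO.
Let Iv : L1 mu Om v. Proof. by case: av. Qed.

(** The sum of the side lengths, that is the l^1 diameter, of the boxes obtained by halving once in
    each direction listed in [l]. *)
Definition weighted_side (l : seq 'I_N) a b : R :=
  \sum_j (b ord0 j - a ord0 j) * 2^-1 ^+ count_mem j l.

Variables (psi : V -> R) (L : R) (L0 : 0 <= L).
Hypotheses (mpsi : measurable_fun (setT : set S) psi)
  (psiL : forall x y, `|psi x - psi y| <= L * \sum_i `|x ord0 i - y ord0 i|)
  (psib : exists M, forall x, `|psi x| <= M).

Let Ivpsi (A : set V) : measurable (A : set S) -> A `<=` Om -> L1 mu A (fun x => v x * psi x).
Proof.
move=> mA AO; have [M HM] := psib; under eq_fun do rewrite mulrC.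
apply: (L1_mul (M := M)) => //; first exact: measurable_funTS.
exact: (L1S mA mO AO Iv).
Qed.

(* The mean of [v] is the same on the two halves of a box, by translation
   invariance, hence remains 0 on the halves, where [psi] oscillates less. *)
Lemma box_oscillation (l : seq 'I_N) a b : (forall j, a ord0 j <= b ord0 j) ->
  cbox a b `<=` Om -> \int[mu]_(x in hbox a b) v x = 0 ->
  `|\int[mu]_(x in hbox a b) (v x * psi x)| <=
  L * weighted_side l a b * \int[mu]_(x in hbox a b) `|v x|.
Proof.
elim: l a b => [|i l IH] a b ab abO v0.
  have mB := measurable_hbox a b; have BO := subset_trans (@hbox_cbox a b) abO.
  have IB := L1S mB mO BO Iv.
  have IB' : L1 mu (hbox a b) (fun x => v x * (psi x - psi a)).
    rewrite (_ : (fun x => _) = (fun x => v x * psi x - psi a * v x)).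
      by apply: L1B; [|exact: Ivpsi|exact: L1Z].
    by apply/funext => x; ring.
  (* As [v] has mean 0, a constant may be subtracted from [psi]; what remains is bounded by [L]
     times the l^1 diameter. *)
  have -> : \int[mu]_(x in hbox a b) (v x * psi x) = \int[mu]_(x in hbox a b) (v x * (psi x - psi a)).
    rewrite (_ : (fun x => v x * (psi x - psi a)) = (fun x => v x * psi x - psi a * v x)).
      rewrite (RintegralB mB (Ivpsi mB BO) (L1Z _ mB IB)) (RintegralZl _ mB IB).
      by rewrite v0 mulr0 subr0.
    by apply/funext => x; ring.
  apply: le_trans (le_normr_Rintegral mB IB') _.
  rewrite -(RintegralZl _ mB (L1_norm IB)); apply: le_Rintegral => //.
  - exact: L1_norm.
  - by apply: L1Z => //; exact: L1_norm.
  - move=> x Bx; rewrite normrM mulrC ler_wpM2r//; apply: le_trans (psiL x a) _.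
    rewrite ler_wpM2l//; apply: ler_sum => j _; rewrite expr0 mulr1.
    by have /andP[h1 h2] := Bx j; rewrite ger0_norm ?subr_ge0// lerD2r ltW.
set m := mid a b i; set a' := upd a i m; set b' := upd b i m.
have mi : a ord0 i <= m <= b ord0 i by rewrite /m /mid; have := ab i; lra.
have ab' j : a ord0 j <= b' ord0 j.
  by have [->|ji] := eqVneq j i; rewrite ?upd_same ?upd_other//; case/andP: mi.
have a'b j : a' ord0 j <= b ord0 j.
  by have [->|ji] := eqVneq j i; rewrite ?upd_same ?upd_other//; case/andP: mi.
have ab'O : cbox a b' `<=` Om.
  move=> x H; apply: abO => j; have := H j.
  by have [->|ji] := eqVneq j i; rewrite ?upd_same ?upd_other//; lra.
have a'bO : cbox a' b `<=` Om.
  move=> x H; apply: abO => j; have := H j.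
  by have [->|ji] := eqVneq j i; rewrite ?upd_same ?upd_other//; lra.
have side j : b' ord0 j - a ord0 j = (b ord0 j - a ord0 j) * 2^-1 ^+ (i == j).
  have [->|ji] := eqVneq j i; rewrite ?upd_same ?upd_other// ?expr0 ?mulr1 ?expr1 /m /mid//.
  by field.
have side' j : b ord0 j - a' ord0 j = (b ord0 j - a ord0 j) * 2^-1 ^+ (i == j).
  have [->|ji] := eqVneq j i; rewrite ?upd_same ?upd_other// ?expr0 ?mulr1 ?expr1 /m /mid//.
  by field.
have E1 : weighted_side (i :: l) a b = weighted_side l a b'.
  by apply: eq_bigr => j _; rewrite side /= exprD mulrA.
have E2 : weighted_side (i :: l) a b = weighted_side l a' b.
  by apply: eq_bigr => j _; rewrite side' /= exprD mulrA.
have mB1 := measurable_hbox a b'; have mB2 := measurable_hbox a' b.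
have B1O := subset_trans (@hbox_cbox a b') ab'O.
have B2O := subset_trans (@hbox_cbox a' b) a'bO.
have disj : [disjoint hbox a b' & hbox a' b].
  rewrite disj_set2E; apply/eqP/seteqP; split=> // x [/(_ i) + /(_ i)].
  by rewrite !upd_same => /andP[_ h1] /andP[h2 _]; rewrite lt_geF in h2.
have U : hbox a b = hbox a b' `|` hbox a' b by exact: hbox_split.
have UO : hbox a b' `|` hbox a' b `<=` Om by move=> x [/B1O|/B2O].
have mU := measurableU _ _ mB1 mB2.
have UOm : L1 mu Om `<=` L1 mu (hbox a b' `|` hbox a' b) by move=> f; exact: L1S.
have splitE (f : V -> R) : L1 mu (hbox a b' `|` hbox a' b) f ->
  \int[mu]_(x in hbox a b) f x = \int[mu]_(x in hbox a b') f x + \int[mu]_(x in hbox a' b) f x.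
  by move=> If; rewrite U Rintegral_setU.
have eqv : \int[mu]_(x in hbox a' b) v x = \int[mu]_(x in hbox a b') v x.
  rewrite /a' hbox_transl// -/m -/b'.
  apply: (appr_transl_invariant oO bO av mB1 (bounded_hbox a b')) => x t B1x /andP[t0 t1].
  apply: abO => j; have := B1x j; rewrite !mxE eqxx /=.
  have [->|ji] := eqVneq j i; last by rewrite mulr0 mulr0 addr0 => /andP[-> /ltW ->].
  rewrite mulr1 /m /mid => /andP[h1 h2].
  have d0 : 0 <= (b ord0 i - a ord0 i) / 2 by have := ab i; lra.
  have := ler_piMl d0 t1; have := mulr_ge0 t0 d0.
  by move: (t * _) => q; lra.
have v12 := splitE _ (UOm _ Iv); rewrite v0 eqv in v12.
have z1 : \int[mu]_(x in hbox a b') v x = 0 by lra.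
have z2 : \int[mu]_(x in hbox a' b) v x = 0 by rewrite eqv.
rewrite (splitE _ (Ivpsi mU UO)) (splitE _ (L1_norm (UOm _ Iv))) mulrDr.
apply: le_trans (ler_normD _ _) _; apply: lerD.
- by rewrite E1; exact: IH.
- by rewrite E2; exact: IH.
Qed.

Lemma coordinate_cycles n : exists l : seq 'I_N, forall j, count_mem j l = n.
Proof.
elim: n => [|n [l Hl]]; first by exists [::].
by exists (enum 'I_N ++ l) => j; rewrite count_cat Hl count_uniq_mem ?enum_uniq// mem_enum.
Qed.

(** After [n] rounds of halving in all directions the oscillation bound has been divided by
    [2 ^ n]. *)
Lemma box_orthogonal a b : (forall j, a ord0 j <= b ord0 j) ->
  cbox a b `<=` Om -> \int[mu]_(x in hbox a b) v x = 0 ->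
  \int[mu]_(x in hbox a b) (v x * psi x) = 0.
Proof.
move=> ab abO v0; apply/eqP; rewrite -normr_le0; apply/ler_addgt0Pr => e e0; rewrite add0r.
pose D := \sum_j (b ord0 j - a ord0 j); pose I0 := \int[mu]_(x in hbox a b) `|v x|.
have D0 : 0 <= D by apply: sumr_ge0 => j _; rewrite subr_ge0.
have I00 : 0 <= I0 by exact: Rintegral_ge0.
have C0 : 0 <= L * D * I0 by rewrite !mulr_ge0.
have C1 : 0 < L * D * I0 + 1 by rewrite ltr_wpDl.
have [n Hn] : exists n, (2^-1 : R) ^+ n <= e / (L * D * I0 + 1).
  have := @cvg_geometric R 1 2^-1; rewrite ger0_norm// invf_lt1// ltr1n => /(_ isT).
  move=> /cvgrPdist_le/(_ _ (divr_gt0 e0 C1))[n _ /(_ n (leqnn n))]/=.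
  rewrite sub0r normrN mul1r => h; exists n; exact: le_trans (ler_norm _) h.
have [l Hl] := coordinate_cycles n.
apply: le_trans (box_oscillation l ab abO v0) _.
have -> : weighted_side l a b = D * 2^-1 ^+ n by rewrite mulr_suml; apply: eq_bigr => j _; rewrite Hl.
rewrite -/I0 (_ : L * _ * _ = (L * D * I0) * 2^-1 ^+ n); last by ring.
apply: le_trans (ler_wpM2l C0 Hn) _.
by rewrite mulrCA ler_piMr ?(ltW e0)// ler_pdivrMr// mul1r lerDl.
Qed.

End half_open_boxes.

(** * Zero gradient implies locally constant *)

Section local_constancy.
Context {R : realType} {N : nat}.
Local Notation V := 'rV[R]_N.
Local Notation S := (lebesgue_space R N).
Local Notation mu := (leb R N).
Variables (Om E : set V) (oO : open Om) (bO : bounded_set Om) (N0 : (0 < N)%N).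
Hypothesis cube_pos : forall r, 0 < r -> (0 < mu (cube 0 r))%E.
Implicit Types (v tau : V -> R).
Let mO : measurable (Om : set S) := measurable_open_om leb_half oO.
Let Ofin : (mu Om < +oo)%E := leb_bounded bO.

Lemma appr_cst (c : R) : appr Om E (fun=> c) (fun=> 0) (fun=> c).
Proof.
split.
- by apply: (@L1_bounded _ _ _ _ _ _ `|c|).
- by move=> i; apply: (@L1_bounded _ _ _ _ _ _ 0) => // x _; rewrite mxE normr0.
- move=> e e0; exists (fun=> c); split.
  + exact: smooth_cst.
  + under eq_Rintegral do rewrite subrr normr0.
    by rewrite /Rintegral integral0 ltW.
  + move=> i; under eq_Rintegral do rewrite partial_cst mxE subrr normr0.
    by rewrite /Rintegral integral0 ltW.
  + rewrite (_ : _ `&` _ = set0) ?outer_measure0 ?lee_fin ?ltW//.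
    by apply/seteqP; split=> // x [_ /=]; rewrite subrr normr0 ltNge (ltW e0).
Qed.

Lemma appr_subc v tau (c : R) : appr Om E v (fun=> 0) tau ->
  appr Om E (fun x => v x - c) (fun=> 0) (fun x => tau x - c).
Proof.
move=> av; apply: appr_eq (appr_sub oO bO av (appr_cst c)) => // x i.
by rewrite subr0.
Qed.

Lemma test_lipschitz (psi : V -> R) : test_function Om psi -> exists2 L, 0 <= L &
  forall x y, `|psi x - psi y| <= L * \sum_i `|x ord0 i - y ord0 i|.
Proof.
move=> tp; have sp := tp.1.
have /choice[M HM] i : exists M, 0 <= M /\ forall x, `|partial i psi x| <= M.
  by have [M M0 HM] := test_partial_bounded i tp; exists M.
exists (\sum_i M i); first by apply: sumr_ge0 => i _; case: (HM i).
move=> x y; have [s _] := line_mvt y (x - y) sp (ler01).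
rewrite scale1r mul1r (addrC y) subrK => ->; rewrite derive_partial; last exact: smooth_differentiable.
apply: le_trans (ler_norm_sum _ _ _) _; rewrite mulr_sumr; apply: ler_sum => i _.
rewrite normrM !mxE mulrC ler_wpM2r//; apply: le_trans ((HM i).2 _) _.
by rewrite (bigD1 i)//= lerDl sumr_ge0// => j _; case: (HM j).
Qed.

(** The constant is the mean over the cube: [v - c] is orthogonal to all test functions by
    [box_orthogonal], hence 0 by the fundamental lemma. *)
Lemma ball_constant v tau x r : appr Om E v (fun=> 0) tau -> 0 < r -> cube x r `<=` Om ->
  exists c, {ae mu, forall y, `|y - x| < r -> v y = c}.
Proof.
move=> av r0 xrO.
pose a : V := \row_i (x ord0 i - r); pose b : V := \row_i (x ord0 i + r).
have ab j : a ord0 j <= b ord0 j by rewrite !mxE; lra.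
have abO : cbox a b `<=` Om by rewrite -cubeE// ltW.
have mB := measurable_hbox a b.
have Bfin : (mu (hbox a b) < +oo)%E := leb_bounded (bounded_hbox a b).
have Bpos : 0 < fine (mu (hbox a b)).
  rewrite fine_gt0// Bfin andbT; apply: lt_le_trans (cube_pos (divr_gt0 r0 (ltr0n _ 2))) _.
  rewrite -(leb_cubeE x); apply: le_leb => y; rewrite /cube/= => /rV_norm_leP H i.
  have := H (divr_ge0 (ltW r0) (ler0n _ 2)) i; rewrite !mxE ler_norml; lra.
have BO := subset_trans (@hbox_cbox _ _ a b) abO.
have [Iv _ _] := av.
pose c := (\int[mu]_(y in hbox a b) v y) / fine (mu (hbox a b)); exists c.
have avc := appr_subc c av; have [Ivc _ _] := avc.
have z : \int[mu]_(y in hbox a b) (v y - c) = 0.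
  have IB := L1S mB mO BO Iv.
  have Ic : L1 mu (hbox a b) (fun=> c) by apply: (@L1_bounded _ _ _ _ _ _ `|c|).
  by rewrite (RintegralB mB IB Ic) Rintegral_cst// /c divfK ?subrr// gt_eqF.
pose U : set V := [set y | `|y - x| < r].
have oU : open U.
  by rewrite (_ : U = ball x r); [exact: ball_open|apply/seteqP; split=> y; rewrite -ball_normE/= distrC].
have UB : U `<=` hbox a b.
  by move=> y /(rV_norm_ltP _ r0) H i; have := H i; rewrite !mxE ltr_norml; lra.
have UO : U `<=` Om by exact: subset_trans BO.
have mU : measurable (U : set S) := measurable_open_om leb_half oU.
have := fundamental_lemma N0 oU (L1S mU mO UO Ivc).
move=> H; have : forall psi, test_function U psi -> \int[mu]_(y in U) ((v y - c) * psi y) = 0.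
  move=> psi tp; have tpO : test_function Om psi.
    case: tp => sp [K [cK KU K0]]; split=> //; exists K; split=> //; exact: subset_trans UO.
  have [L L0 HL] := test_lipschitz tpO.
  have mp : measurable_fun (setT : set S) psi := @smooth_measurable _ _ _ _ tp.1.
  have pb : exists M, forall x, `|psi x| <= M by have [M _ HM] := test_bounded tp; exists M.
  (* The test function vanishes outside the open cube [U], so its integrals over [U] and over the
     half-open box coincide. *)
  rewrite -(box_orthogonal oO bO avc L0 mp HL pb ab abO z).
  rewrite Rintegral_mkcond [RHS]Rintegral_mkcond; congr Rintegral; apply/funext => y.
  rewrite /patch; case: ifPn => [/set_mem/UB/mem_set -> //|]; rewrite notin_setE => nU.
  case: ifP => // _; case: tp => _ [K [_ KU K0]]; rewrite K0 ?mulr0// => /KU//.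
move=> /H; apply: ae_imp => y h /h/eqP; rewrite subr_eq0 => /eqP//.
Qed.

End local_constancy.

Section outer_local.
Context {R : realType} {N : nat} (mu : {outer_measure set 'rV[R]_N -> \bar R}).
Local Notation V := 'rV[R]_N.

Lemma open_normlt (x : V) r : open [set y | `|y - x| < r].
Proof.
rewrite (_ : [set y | _] = ball x r); first exact: ball_open.
by apply/seteqP; split=> y; rewrite -ball_normE/= distrC.
Qed.

Lemma outer_measure_countable0 (F : nat -> set V) (A : set V) :
  (forall n, mu (F n) = 0%E) -> A `<=` \bigcup_n F n -> mu A = 0%E.
Proof.
move=> F0 AF; apply/eqP; rewrite eq_le outer_measure_ge0 andbT.
apply: le_trans (le_outer_measure mu _ _ AF) _.
by apply: le_trans (outer_measure_sigma_subadditive mu F) _; rewrite eseries0.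
Qed.

(** Lindelof's argument: countably many rational boxes with null intersection already cover [A]. *)
Lemma outer_local (A : set V) :
  (forall x, A x -> exists2 r, 0 < r & mu (A `&` cube x r) = 0%E) -> mu A = 0%E.
Proof.
move=> H.
pose F (k : nat) : set V := if (unpickle k : option ('rV[rat]_N * nat)) is Some (q, n)
  then (if `[< mu (A `&` rbox q n) = 0%E >] then A `&` rbox q n else set0) else set0.
apply: (@outer_measure_countable0 F).
  move=> k; rewrite /F; case: unpickle => [[q n]|]; last exact: outer_measure0.
  by case: asboolP => // _; exact: outer_measure0.
move=> x Ax; have [r r0 Hr] := H x Ax.
have [|q [n [qx qU]]] := open_rbox (@open_normlt x r) (_ : [set y | `|y - x| < r] x).
  by rewrite /= subrr normr0.
have qr : rbox q n `<=` cube x r.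
  move=> y qy; apply: ltW; apply: qU => i; have := qy i; rewrite !mxE.
  by case/andP => /ltW -> /ltW ->.
exists (pickle (q, n)) => //; rewrite /F pickleK asboolT//.
apply/eqP; rewrite eq_le outer_measure_ge0 andbT -Hr; apply: le_outer_measure.
by move=> y [Ay /qr]; split.
Qed.

End outer_local.

(** * Connected components of an open set *)

Section components.
Context {R : realType} {N : nat}.
Local Notation V := 'rV[R]_N.
Implicit Types (Om : set V) (x y z : V).

Lemma segment_component Om x y : (forall t, 0 <= t <= 1 -> Om (x + t *: (y - x))) ->
  connected_component Om x y.
Proof.
move=> H; pose g (t : R) : V := x + t *: (y - x).
have cg : continuous g.
  by move=> t; apply: cvgD; [exact: cvg_cst|apply: cvgZl; exact: cvg_id].
apply: (@connected_component_max _ _ (g @` `[0, 1]%classic)).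
- by exists 0; [rewrite /= in_itv/= lexx ler01|rewrite /g scale0r addr0].
- by move=> _ [t + <-]; rewrite /= in_itv/=; exact: H.
- apply: connected_continuous_connected; first exact: segment_connected.
  exact: continuous_subspaceT.
- by exists 1; [rewrite /= in_itv/= lexx ler01|rewrite /g scale1r addrC subrK].
Qed.

Lemma ball_component Om x y r : (forall z, `|z - x| < r -> Om z) -> `|y - x| < r ->
  connected_component Om x y.
Proof.
move=> H yr; apply: segment_component => t /andP[t0 t1]; apply: H.
rewrite addrC addKr normrZ ger0_norm//; apply: le_lt_trans yr.
by rewrite ler_piMl.
Qed.

Lemma open_normP Om x : open Om -> Om x -> exists2 r, 0 < r & forall z, `|z - x| < r -> Om z.
Proof.
rewrite openE => oO /oO /nbhs_ballP[r /= r0 H]; exists r => // z zr; apply: H.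
by rewrite -ball_normE/= distrC.
Qed.

Lemma open_component Om x : open Om -> open (connected_component Om x).
Proof.
move=> oO; rewrite openE => y Cy.
have [r r0 H] := open_normP oO (connected_component_sub Cy).
apply/nbhs_ballP; exists r => //= z; rewrite -ball_normE/= distrC => zr.
exact: connected_component_trans Cy (ball_component H zr).
Qed.

Lemma closure_normP (A : set V) y r : closure A y -> 0 < r -> exists2 x, A x & `|x - y| < r.
Proof.
move=> cA r0; have [x [Ax Bx]] := cA _ (nbhsx_ballx y r r0); exists x => //.
by move: Bx; rewrite -ball_normE/= distrC.
Qed.

(** A limit point of the component that lies in the open set has a ball in it; this ball meets the
    component, so the point is in the component, which is open. *)
Lemma boundary_component Om x : open Om -> boundary (connected_component Om x) `<=` boundary Om.
Proof.
move=> oO y [clC nC]; split.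
  by move: clC; apply: closureS; exact: connected_component_sub.
move=> /interior_subset Oy; apply: nC.
have := @open_component Om x oO; rewrite openE; apply.
have [r r0 H] := open_normP oO Oy; have [z Cz zr] := closure_normP clC r0.
exact: connected_component_trans Cz (connected_component_sym (ball_component H zr)).
Qed.

End components.

Section component_constancy.
Context {R : realType} {N : nat}.
Local Notation V := 'rV[R]_N.
Local Notation mu := (leb R N).
Variables (Om E : set V) (oO : open Om) (bO : bounded_set Om) (N0 : (0 < N)%N).
Hypothesis cube_pos : forall r, 0 < r -> (0 < mu (cube 0 r))%E.
Variables (v tau : V -> R) (av : appr Om E v (fun=> 0) tau).

Let good (y : V) (c : R) := exists2 r, 0 < r & {ae mu, forall z, `|z - y| < r -> v z = c}.

Let good_ex y : Om y -> exists c, good y c.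
Proof.
move=> Oy; have [r r0 H] := open_normP oO Oy; have r20 := divr_gt0 r0 (ltr0n _ 2).
have [|c Hc] := ball_constant oO bO N0 cube_pos (x := y) av r20.
  by move=> z /= zr; apply: H; apply: le_lt_trans zr _; rewrite ltr_pdivrMr// ltr_pMr// ltr1n.
by exists c; exists (r / 2).
Qed.

Let good_uniq y c c' : good y c -> good y c' -> c = c'.
Proof.
move=> [r r0 H] [r' r'0 H']; apply/eqP/negPn/negP => cc'.
pose s := Num.min r r' / 2; have s0 : 0 < s by rewrite divr_gt0// lt_min r0.
have : {ae mu, forall z, ~ cube y s z}.
  apply: ae_imp2 H H' => z h h' /= zs; move/eqP: cc'; apply.
  have zr : `|z - y| < Num.min r r'.
    by apply: le_lt_trans zs _; rewrite ltr_pdivrMr// ltr_pMr ?ltr1n// lt_min r0.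
  by move: zr; rewrite lt_min => /andP[/h <- /h' <-].
move/negligible_om => H0; have := cube_pos s0; rewrite -(leb_cubeE y).
suff -> : mu (cube y s) = 0%E by rewrite ltxx.
by rewrite -[RHS]H0; congr (leb R N _); apply/seteqP; split=> z /= h; [exact|exact: contrapT].
Qed.

Let good_open y c z r : 0 < r -> {ae mu, forall z, `|z - y| < r -> v z = c} ->
  `|z - y| < r -> good z c.
Proof.
move=> r0 H zr; exists (r - `|z - y|); first by rewrite subr_gt0.
apply: ae_imp H => w h wz; apply: h; rewrite -(subrK z w) -addrA.
by apply: le_lt_trans (ler_normD _ _) _; rewrite -ltrBrDr.
Qed.

Let open_good (P : set R) : open [set y : V | exists2 c, P c & good y c].
Proof.
rewrite openE => y [c Pc [r r0 H]]; apply/nbhs_ballP; exists r => //= z.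
rewrite -ball_normE/= distrC => zr; exists c => //; exact: good_open H zr.
Qed.

(** Each point has a unique local value of [v]. The points with the value [c] form an open set, and
    so do the others, so by connectedness the first set is the whole component. *)
Lemma component_constant x : Om x ->
  exists c, {ae mu, forall y, connected_component Om x y -> v y = c}.
Proof.
move=> Ox; have [c gc] := good_ex Ox; exists c.
have EC : connected_component Om x `&` [set y : V | exists2 c', c' = c & good y c'] = connected_component Om x.
  apply: component_connected.
  - by exists x; split; [exact: connected_component_refl|exists c].
  - by exists [set y : V | exists2 c', c' = c & good y c'] => //; exact: (@open_good [set c]).
  - exists (~` [set y : V | exists2 c', c' <> c & good y c']).
      have oG := @open_good [set c' | c' <> c].
      by apply: open_closedC.
    apply/seteqP; split => y [Cy /=].
      by move=> [_ -> gyc]; split=> // -[c' c'c gyc']; apply: c'c; exact: good_uniq gyc' gyc.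
    move=> nb; split=> //; have [c' gc'] := good_ex (connected_component_sub Cy).
    by exists c' => //; apply: contrapT => c'c; apply: nb; exists c'.
apply/negligible_om; apply: outer_local => y /= /not_implyP[Cy _].
have : (connected_component Om x `&` [set y : V | exists2 c', c' = c & good y c']) y by rewrite EC.
move=> [_ [_ -> [r r0 /negligible_om H]]]; exists (r / 2); first by rewrite divr_gt0.
apply/eqP; rewrite eq_le outer_measure_ge0 andbT -H; apply: le_outer_measure.
move=> z [/= /not_implyP[_ vz] zr]; apply/not_implyP; split=> //.
by apply: le_lt_trans zr _; rewrite ltr_pdivrMr// ltr_pMr// ltr1n.
Qed.

End component_constancy.

(** * Traces near a Lipschitz boundary *)

Section finite_covers.
Context {R : realType} {N : nat}.
Local Notation V := 'rV[R]_N.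
Local Notation S := (lebesgue_space R N).
Local Notation mu := (leb R N).

Lemma sum_disjoint_le (I : eqType) (s : seq I) (A : I -> set V) (U : set V) (G : V -> R) :
  measurable (U : set S) -> L1 mu U G -> (forall x, 0 <= G x) -> uniq s ->
  (forall i, i \in s -> measurable (A i : set S) /\ A i `<=` U) ->
  (forall i j, i \in s -> j \in s -> i != j -> A i `&` A j = set0) ->
  \sum_(i <- s) \int[mu]_(x in A i) G x <= \int[mu]_(x in U) G x.
Proof.
elim: s U => [|i s IH] U mU IG G0 us H D; first by rewrite big_nil Rintegral_ge0.
have [mA AU] := H i (mem_head _ _).
have mD : measurable (U `\` A i : set S) by exact: measurableD.
have -> : \int[mu]_(x in U) G x = \int[mu]_(x in A i) G x + \int[mu]_(x in U `\` A i) G x.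
  rewrite -[in LHS](setDUK AU) Rintegral_setU ?setDUK//.
  by rewrite disj_set2E; apply/eqP; rewrite setDE setICA setICr setI0.
rewrite big_cons.
rewrite lerD2l; move: us => /= /andP[ins us].
have ms j : j \in s -> j \in i :: s by rewrite inE => ->; rewrite orbT.
apply: IH => //.
- by apply: L1S IG => //; exact: subDsetl.
- move=> j js; have [mj AjU] := H j (ms _ js); split=> // x Ajx; split; first exact: AjU.
  move=> Aix; have ij : i != j by apply: contraNneq ins => ->.
  have := D i j (mem_head _ _) (ms _ js) ij.
  by move/seteqP => [/(_ x) + _]; apply; split.
- by move=> j k js ks; apply: D; exact: ms.
Qed.

Lemma smooth_lipschitz (phi : V -> R) r : smooth phi -> exists2 L, 0 <= L &
  forall x y, `|x| <= r -> `|y| <= r -> `|phi x - phi y| <= L * `|x - y|.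
Proof.
move=> sp; have /choice[B HB] (i : 'I_N) : exists B, 0 <= B /\ forall x, `|x| <= r -> `|partial i phi x| <= B.
  have [B B0 HB] := continuous_bounded_compact (smooth_continuous (@smooth_partial _ _ _ i sp))
    (@cube_compact _ _ 0 r).
  by exists B; split=> // x xr; apply: HB; rewrite /cube/= subr0.
exists (\sum_i B i); first by apply: sumr_ge0 => i _; case: (HB i).
move=> x y xr yr; have [s /andP[s0 s1]] := line_mvt y (x - y) sp (ler01).
rewrite scale1r mul1r (addrC y) subrK => ->; rewrite derive_partial; last exact: smooth_differentiable.
apply: le_trans (ler_norm_sum _ _ _) _; rewrite mulr_suml; apply: ler_sum => i _.
rewrite normrM mulrC; apply: ler_pM => //; last exact: coord_norm_le.
apply: (HB i).2; rewrite (_ : _ + _ = (1 - s) *: y + s *: x).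
  apply: le_trans (ler_normD _ _) _; rewrite !normrZ !ger0_norm ?subr_ge0//.
  apply: le_trans (lerD (ler_wpM2l _ yr) (ler_wpM2l s0 xr)) _; rewrite ?subr_ge0//.
  by rewrite -mulrDl subrK mul1r.
by rewrite scalerBr scalerBl scale1r addrA addrAC.
Qed.

Lemma cover_outer_finite (c : set V -> \bar R) (c0 : c set0 = 0%E) (c_ge0 : forall A, (0 <= c A)%E)
    (I : eqType) (s : seq I) (A : I -> set V) (B : R) (X : set V) :
  0 <= B -> (forall i, c (A i) <= B%:E)%E -> X `<=` [set x | exists2 i, i \in s & A i x] ->
  (cover_outer c X <= ((size s)%:R * B)%:E)%E.
Proof.
move=> B0 AB XA.
pose F n : set V := nth set0 (map A s) n.
apply: (@le_trans _ _ (\sum_(n <oo) c (F n))%E).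
  apply: ereal_inf_lbound; exists F => //= x /XA[i si Ai].
  exists (index i s) => //; rewrite /F (nth_map i) ?index_mem// nth_index//.
have F0 n : (size s <= n)%N -> c (F n) = 0%E by move=> h; rewrite /F nth_default ?size_map.
have FB n : (c (F n) <= B%:E)%E.
  by rewrite /F; elim: s n {XA F F0} => [|i s IH] [|n] /=; rewrite ?nth_nil ?c0//; exact: IH.
rewrite (nneseries_split 0 (size s)); last by move=> k _.
rewrite add0n (@eseries0 _ _ (size s)) ?adde0; last by move=> n h _; exact: F0.
apply: (@le_trans _ _ (\sum_(0 <= n < size s) B%:E)%E); first exact: lee_sum.
rewrite sumEFin sumr_const_nat subn0 lee_fin mulr_natl.
exact: lexx.
Qed.

Lemma enorm_le_norm (x : V) : enorm x <= N%:R * `|x|.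
Proof.
have Nx : 0 <= N%:R * `|x| by rewrite mulr_ge0.
rewrite -(ger0_norm Nx) -sqrtr_sqr /enorm ler_wsqrtr// /dot.
apply: (@le_trans _ _ (\sum_(i < N) `|x| ^+ 2)).
  apply: ler_sum => i _; rewrite -expr2 -real_normK ?num_real// lerXn2r ?nnegrE//.
  exact: coord_norm_le.
rewrite sumr_const card_ord -[leLHS]mulr_natl exprMn ler_wpM2r ?sqr_ge0// -natrX ler_nat.
by case: (N) => // n; rewrite expnS leq_pmulr// expn_gt0.
Qed.

End finite_covers.

(** Iteration bounds [a 0] by [a j] plus the sum of all increments, for every [j <= K]; these
    [K + 1] inequalities are added. Here [a j] will be the integral of [|phi|] over the cube of
    height [j] in a column. *)
Lemma telescoped_mean {R : realType} (a m : nat -> R) (d : R) (K : nat) : 0 <= d ->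
  (forall i, 0 <= m i) -> (forall j, (j < K)%N -> a j <= a j.+1 + d * m j) ->
  K.+1%:R * a 0%N <= \sum_(0 <= j < K.+1) (a j + K.+1%:R * d * m j).
Proof.
move=> d0 m0 am.
have H1 j : (j <= K)%N -> a 0%N <= a j + d * \sum_(0 <= i < j) m i.
  elim: j => [|j IH] jK; first by rewrite big_geq// mulr0 addr0.
  by rewrite big_nat_recr//=; have := IH (ltnW jK); have := am j jK; lra.
have -> : K.+1%:R * a 0%N = \sum_(0 <= j < K.+1) a 0%N by rewrite sumr_const_nat subn0 mulr_natl.
pose D := \sum_(0 <= i < K.+1) m i.
have H2 j : (j < K.+1)%N -> a 0%N <= a j + d * D.
  move=> jK; apply: le_trans (H1 j jK) _.
  by rewrite lerD2l ler_wpM2l// /D (big_cat_nat _ (ltnW jK))//= lerDl sumr_ge0.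
apply: (@le_trans _ _ (\sum_(0 <= j < K.+1) (a j + d * D))).
  by rewrite !big_nat; apply: ler_sum => j /andP[_ jK]; exact: H2.
rewrite !big_split/= sumr_const_nat subn0 -[_ *+ K.+1]mulr_natl mulrA -mulr_sumr.
exact: lexx.
Qed.

(** * A trace inequality by counting cubes *)

Section boundary_estimate.
Context {R : realType} {N : nat}.
Local Notation V := 'rV[R]_N.
Local Notation S := (lebesgue_space R N).
Local Notation mu := (leb R N).
Local Notation H := (hausdorff_om R N N.-1).
Hypothesis cube_pos : forall r, 0 < r -> (0 < mu (cube 0 r))%E.
Variables (U : set V) (e : V) (kappa c s0 : R).
Hypotheses (N0 : (0 < N)%N) (oU : open U) (bU : bounded_set U) (e0 : 0 < `|e|)
  (kappa0 : 0 < kappa) (c0 : 0 < c) (s00 : 0 < s0) (s01 : s0 <= 1).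

(* Cones of axis [e] and height [s0] at points of [E] lie in [U], and [E] is a
   graph in the direction [e]. *)
Definition chart (E : set V) := [/\ bounded_set E,
  (forall y s x, E y -> 0 < s -> s <= s0 -> `|x - (y + s *: e)| < kappa * s -> U x) &
  (forall y y' s, E y -> E y' -> c * `|y - y'| <= `|y - y' + s *: e|)].

Let mU : measurable (U : set S) := measurable_open_om leb_half oU.

(** [Q K y j] runs through a column of [K + 1] cubes climbing from [y] to the height [s0]. As
    [rho < kappa], the cubes lie in the cone; as [rho <= |e| / 3], those of one column are disjoint;
    and since [c * M * delta K = 3 * rho * delta K], so are the columns over points more than
    [M * delta K] apart. *)
Let rho := Num.min kappa `|e| / 3.
Let M := 3 * rho / c.
Let delta (K : nat) := s0 / K.+1%:R.
Let Q K y j := cube (y + (j.+1%:R * delta K) *: e) (rho * delta K).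

Let rho0 : 0 < rho. Proof. by rewrite divr_gt0// lt_min kappa0. Qed.
Let M0 : 0 < M. Proof. by rewrite divr_gt0// mulr_gt0. Qed.
Let delta0 K : 0 < delta K. Proof. by rewrite divr_gt0// ltr0n. Qed.
Let delta1 K : delta K <= 1.
Proof. by rewrite ler_pdivrMr ?ltr0n// mul1r (le_trans s01)// ler1n. Qed.

Let QU E K y j : chart E -> E y -> (j < K.+1)%N -> Q K y j `<=` U.
Proof.
move=> [_ EU _] Ey jK x Qx; apply: (EU y (j.+1%:R * delta K)) => //.
- by rewrite mulr_gt0// ltr0n.
- by rewrite /delta mulrCA ler_piMr ?(ltW s00)// ler_pdivrMr ?ltr0n// mul1r ler_nat.
- apply: le_lt_trans Qx _; rewrite mulrA ltr_pM2r//.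
  apply: (@lt_le_trans _ _ kappa); last by rewrite ler_peMr ?(ltW kappa0)// ler1n.
  by rewrite /rho ltr_pdivrMr// gt_min ltr_pMr ?ltr1n.
Qed.

Let Q_disjoint E K y y' j j' : chart E -> E y -> E y' -> (y == y' \/ M * delta K < `|y - y'|) ->
  (y, j) != (y', j') -> Q K y j `&` Q K y' j' = set0.
Proof.
move=> [_ _ EC] Ey Ey' sep neq; apply/seteqP; split=> // x [].
rewrite /Q /cube /= distrC => h1 h2.
have h : `|y - y' + (j.+1%:R * delta K - j'.+1%:R * delta K) *: e| <= 2 * (rho * delta K).
  have -> : 2 * (rho * delta K) = rho * delta K + rho * delta K by ring.
  apply: le_trans (lerD h1 h2); apply: le_trans (ler_normD _ _).
  rewrite (_ : y + _ - x + _ = y - y' + (j.+1%:R * delta K - j'.+1%:R * delta K) *: e)//.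
  by rewrite addrA subrK scalerBl opprD addrACA.
have rd : 0 < rho * delta K by rewrite mulr_gt0.
case: sep => [/eqP yy|sep].
  move: neq h; rewrite yy subrr add0r normrZ -mulrBl normrM (gtr0_norm (delta0 K)).
  have [->|jj _] := eqVneq j j'; first by rewrite eqxx.
  have d1 : 1 <= `|j.+1%:R - j'.+1%:R| :> R.
    have : (j != j')%N by [].
    rewrite neq_ltn => /orP[jl|jl].
      by rewrite distrC -natrB ?ltnS 1?ltnW// normr_nat ler1n subSS subn_gt0.
    by rewrite -natrB ?ltnS 1?ltnW// normr_nat ler1n subSS subn_gt0.
  have re : rho * 3 <= `|e| by rewrite /rho divfK// ge_min lexx orbT.
  apply/negP; rewrite -ltNge; apply: (@lt_le_trans _ _ (3 * (rho * delta K))).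
    by rewrite ltr_pM2r// ltr_nat.
  apply: (@le_trans _ _ (1 * delta K * `|e|)).
    rewrite mul1r (_ : 3 * (rho * delta K) = delta K * (rho * 3)); last by ring.
    by rewrite ler_wpM2l// ltW.
  by rewrite ler_wpM2r// ler_wpM2r// ltW.
have := le_trans (EC _ _ _ Ey Ey') h; apply/negP; rewrite -ltNge.
apply: (@lt_trans _ _ (c * (M * delta K))); last by rewrite ltr_pM2l.
have -> : c * (M * delta K) = 3 * (rho * delta K) by rewrite /M; field; rewrite gt_eqF.
by rewrite ltr_pM2r// ltr_nat.
Qed.

Variables (phi : V -> R) (sphi : smooth phi).

Let mass K B x := `|dird e phi x| + delta K * B.

Let measurable_Q K y j : measurable (Q K y j : set S) := measurable_cube _ _.

Let bounded_cube x r : bounded_set (cube x r : set V).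
Proof. by apply: compact_bounded; exact: cube_compact. Qed.

Let cphi : continuous (fun x => `|phi x|).
Proof. exact/continuous_normf/smooth_continuous. Qed.

Let cmass K B : continuous (mass K B).
Proof.
have h := continuous_normf (smooth_continuous (smooth_dird e sphi)).
by move=> x; exact: (cvgD (h x) (cvg_cst (delta K * B))).
Qed.

Let IQ K y j (f : V -> R) : continuous f -> L1 mu (Q K y j) f.
Proof. by move=> cf; apply: continuous_L1 => //; exact: bounded_cube. Qed.

Let mass_ge0 K B x : 0 <= B -> 0 <= mass K B x.
Proof. by move=> B0; rewrite addr_ge0// mulr_ge0// ltW. Qed.

Let shift_mass E K y j B r : chart E -> E y -> (j < K.+1)%N ->
  (forall x, U x -> `|x| <= r) ->
  (forall x s, `|x| <= r -> 0 <= s <= 1 -> `|phi (x + s *: e) - phi x| <= s * (`|dird e phi x| + s * B)) ->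
  \int[mu]_(x in Q K y j) `|phi x| <=
  \int[mu]_(x in Q K y j.+1) `|phi x| + delta K * \int[mu]_(x in Q K y j) mass K B x.
Proof.
move=> cE Ey jK Ur HB.
have QE : Q K y j.+1 = transl (- (delta K *: e)) @^-1` Q K y j.
  have E1 x : x - (y + (j.+2%:R * delta K) *: e) =
      x - delta K *: e - (y + (j.+1%:R * delta K) *: e).
    by rewrite -[j.+2%:R]natr1 mulrDl mul1r scalerDl (addrA y) [in LHS]opprD addrA addrAC.
  by apply/seteqP; split => x; rewrite /Q /cube /transl/= E1.
have mphi : measurable_fun (setT : set S) (fun x => `|phi x|).
  exact: (continuous_measurable_om leb_half).
have RT := @Rint_transl R N (Q K y j) (fun x => `|phi x|) (delta K *: e) (measurable_Q K y j) mphi.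
rewrite QE -RT.
have I1 := IQ K y j (continuous_transl (w := delta K *: e) cphi).
have I2 := IQ K y j (@cmass K B).
rewrite -(RintegralZl _ _ I2)// -(RintegralD _ I1 (L1Z _ _ I2))//.
apply: le_Rintegral => //.
- exact: IQ.
- by apply: L1D => //; exact: L1Z.
- move=> x /(QU cE Ey jK)/Ur xr.
  have := HB x (delta K) xr; rewrite (ltW (delta0 K)) delta1 => /(_ isT) h.
  rewrite -[X in `|X|](subrK (phi (x + delta K *: e))) addrC; apply: le_trans (ler_normD _ _) _.
  by rewrite lerD2l distrC.
Qed.

Let column_mass E K y B r : chart E -> E y -> 0 <= B ->
  (forall x, U x -> `|x| <= r) ->
  (forall x s, `|x| <= r -> 0 <= s <= 1 -> `|phi (x + s *: e) - phi x| <= s * (`|dird e phi x| + s * B)) ->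
  K.+1%:R * \int[mu]_(x in Q K y 0) `|phi x| <=
  \sum_(0 <= j < K.+1) \int[mu]_(x in Q K y j) (`|phi x| + s0 * mass K B x).
Proof.
move=> cE Ey B0 Ur HB.
have m0 i : 0 <= \int[mu]_(x in Q K y i) mass K B x.
  by apply: Rintegral_ge0 => x _; exact: mass_ge0.
have am j (jK : (j < K)%N) := shift_mass cE Ey (ltnW jK) Ur HB.
apply: le_trans (telescoped_mean (ltW (delta0 K)) m0 am) _.
have -> : K.+1%:R * delta K = s0 by rewrite /delta mulrC divfK// pnatr_eq0.
apply: ler_sum => j _; have I1 := IQ K y j cphi; have I2 := IQ K y j (@cmass K B).
by rewrite (RintegralD _ I1 (L1Z _ _ I2))// (RintegralZl _ _ I2).
Qed.

Let separated K (Y : seq V) :=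
  forall y y', y \in Y -> y' \in Y -> y == y' \/ M * delta K < `|y - y'|.

(** The lowest cube of each column carries at least [eps / 2] times its volume. [column_mass] bounds
    [K + 1] times this by an integral over the column, and the disjoint columns fit together in
    [U]. *)
Let family_mass E K (Y : seq V) B r eps : chart E -> uniq Y -> {in Y, forall y, E y} ->
  separated K Y -> 0 <= B -> (forall x, U x -> `|x| <= r) ->
  (forall x s, `|x| <= r -> 0 <= s <= 1 -> `|phi (x + s *: e) - phi x| <= s * (`|dird e phi x| + s * B)) ->
  (forall y x, E y -> Q K y 0 x -> eps / 2 <= `|phi x|) -> 0 <= eps ->
  K.+1%:R * ((size Y)%:R * (eps / 2 * fine (mu (cube 0 (rho * delta K))))) <=
  \int[mu]_(x in U) (`|phi x| + s0 * mass K B x).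
Proof.
move=> cE uY YE sY B0 Ur HB lowb eps0.
have G0 x : 0 <= `|phi x| + s0 * mass K B x.
  by rewrite addr_ge0// mulr_ge0 ?mass_ge0// ltW.
have IG : L1 mu U (fun x => `|phi x| + s0 * mass K B x).
  by apply: L1D => //; [|apply: L1Z => //]; apply: continuous_L1 => //; exact: cmass.
have uYj : uniq [seq (y, j) | y <- Y, j <- iota 0 K.+1].
  by apply: allpairs_uniq => //; [exact: iota_uniq|move=> [? ?] [? ?]].
have h : \sum_(p <- [seq (y, j) | y <- Y, j <- iota 0 K.+1])
    \int[mu]_(x in Q K p.1 p.2) (`|phi x| + s0 * mass K B x) <=
    \int[mu]_(x in U) (`|phi x| + s0 * mass K B x).
  apply: sum_disjoint_le => //.
  - move=> _ /allpairsP[[y j] [yY + ->]]; rewrite mem_iota => jK; split=> //.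
    exact: (QU cE (YE _ yY) jK).
  - move=> p p' /allpairsP[[y j] [yY _ ->]] /allpairsP[[y' j'] [y'Y _ ->]].
    exact: (Q_disjoint cE (YE _ yY) (YE _ y'Y) (sY _ _ yY y'Y)).
apply: le_trans h; rewrite big_allpairs.
suff h : K.+1%:R * ((size Y)%:R * (eps / 2 * fine (mu (cube 0 (rho * delta K))))) <=
    \sum_(y <- Y) \sum_(0 <= j < K.+1) \int[mu]_(x in Q K y j) (`|phi x| + s0 * mass K B x).
  exact: h.
have -> : K.+1%:R * ((size Y)%:R * (eps / 2 * fine (mu (cube 0 (rho * delta K))))) =
    \sum_(y <- Y) K.+1%:R * (eps / 2 * fine (mu (cube 0 (rho * delta K)))).
  by rewrite big_const_seq count_predT iter_addr_0 -[RHS]mulr_natl mulrCA.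
rewrite big_seq [leRHS]big_seq; apply: ler_sum => y yY.
have cm := column_mass K cE (YE _ yY) B0 Ur HB.
apply: (le_trans _ cm); rewrite ler_wpM2l//.
have I0 := IQ K y 0 cphi.
have <- : \int[mu]_(x in Q K y 0) (eps / 2) = eps / 2 * fine (mu (cube 0 (rho * delta K))).
  by rewrite Rintegral_cst// /Q leb_cubeE.
apply: le_Rintegral => //.
- by apply: (@L1_bounded _ _ _ _ _ _ `|eps / 2|) => //; exact: leb_cube_fin.
- by move=> x; exact: lowb (YE _ yY).
Qed.

Let q0 := fine (mu (cube 0 (rho * s0))).

Let q00 : 0 < q0.
Proof. by rewrite fine_gt0// leb_cube_fin andbT; apply: cube_pos; rewrite mulr_gt0. Qed.

(** Comparing the small cube with the fixed one of volume [q0] costs [(K + 1) ^ N], of which the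
    averaging over a column wins back one power: the number of points grows like
    [(K + 1) ^ (N - 1)], as for a hypersurface. *)
Let family_count E K (Y : seq V) B r eps : chart E -> uniq Y -> {in Y, forall y, E y} ->
  separated K Y -> 0 <= B -> (forall x, U x -> `|x| <= r) ->
  (forall x s, `|x| <= r -> 0 <= s <= 1 -> `|phi (x + s *: e) - phi x| <= s * (`|dird e phi x| + s * B)) ->
  (forall y x, E y -> Q K y 0 x -> eps / 2 <= `|phi x|) -> 0 <= eps ->
  (size Y)%:R * (eps / 2 * q0) <=
  K.+1%:R ^+ N.-1 * \int[mu]_(x in U) (`|phi x| + s0 * mass K B x).
Proof.
move=> cE uY YE sY B0 Ur HB lowb eps0.
have h := family_mass cE uY YE sY B0 Ur HB lowb eps0.
apply: le_trans (ler_wpM2l _ h); last by rewrite exprn_ge0.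
set q := fine (mu (cube 0 (rho * delta K))).
have q0q : q0 <= K.+1%:R ^+ N * q.
  have := @leb_cube_div R N (rho * s0) K (mulr_gt0 rho0 s00).
  have -> : rho * s0 / K.+1%:R = rho * delta K by rewrite /delta [RHS]mulrA.
  move=> hd.
  rewrite -lee_fin EFinM /q0 /q !fineK ?ge0_fin_numE ?leb_cube_fin ?leb_ge0// -natrX.
  exact: hd.
have E1 : K.+1%:R ^+ N = K.+1%:R ^+ N.-1 * K.+1%:R :> R by rewrite -exprSr prednK.
rewrite (_ : _ * (K.+1%:R * _) = (size Y)%:R * (eps / 2 * (K.+1%:R ^+ N.-1 * K.+1%:R * q))); last by ring.
by rewrite -E1 ler_wpM2l// ler_wpM2l// divr_ge0.
Qed.

Let small_delta d : 0 < d -> \forall K \near \oo, delta K <= d.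
Proof.
move=> d0; have d1 : 0 < d / s0 by rewrite divr_gt0.
apply: filterS (near_infty_natSinv_lt (PosNum d1)) => K /ltW/=.
by rewrite ler_pdivlMr// /delta mulrC.
Qed.

Let bv := ball_volume R N.-1.
(** Gauge of a covering cube of half-side [M * delta K], multiplied by the bound of [family_count]:
    the powers of [K + 1] cancel. The factor 2 comes from [eps / 2]. *)
Definition trace_constant := bv * (N%:R * M * s0) ^+ N.-1 * 2 / q0.

Let gauge_cube D y r : 0 <= r -> N%:R * (2 * r) <= D ->
  (@hausdorff_gauge R N N.-1 D (cube y r) <= (bv * (N%:R * r) ^+ N.-1)%:E)%E.
Proof.
move=> r0 rD; have y0 : cube y r y by rewrite /cube/= subrr normr0.
have dle : (diam (cube y r) <= (N%:R * (2 * r))%:E)%E.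
  apply: ge_ereal_sup => _ [[x x'] /= [xy x'y] <-]; rewrite lee_fin.
  apply: le_trans (enorm_le_norm _) _; rewrite ler_wpM2l//.
  rewrite -(subrK y x) -addrA; apply: le_trans (ler_normD _ _) _.
  by rewrite mulr_natl mulr2n lerD// distrC.
have d0 : (0 <= diam (cube y r))%E.
  apply: le_ereal_sup_tmp; exists (enorm (y - y))%:E; first by exists (y, y).
  by rewrite lee_fin sqrtr_ge0.
have dfin : diam (cube y r) \is a fin_num by rewrite ge0_fin_numE// (le_lt_trans dle)// ltry.
apply: (@le_trans _ _ (bv * (fine (diam (cube y r)) / 2) ^+ N.-1)%:E).
  apply: ereal_inf_lbound; right; split=> //; first by exists y.
  by apply: le_trans dle _; rewrite lee_fin.
rewrite lee_fin ler_wpM2l ?ball_volume_ge0// lerXn2r ?nnegrE ?mulr_ge0 ?divr_ge0 ?fine_ge0//.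
by rewrite ler_pdivrMr// -mulrA (mulrC r) -lee_fin fineK.
Qed.

(* The cubes [Q K y j], for [y] in a maximal separated family of [E] and
   [j <= K], are disjoint in [U]; averaging over [j] bounds the integral of [phi]
   near the points of the family, and covering [E] with cubes around these
   points bounds its measure. *)
Lemma trace_estimate E eps : chart E -> 0 < eps -> (forall y, E y -> eps <= `|phi y|) ->
  (H E <= (trace_constant / eps *
    (\int[mu]_(x in U) `|phi x| + \int[mu]_(x in U) `|dird e phi x|))%:E)%E.
Proof.
move=> cE eps0 lowb; have eps0' := ltW eps0.
have [bE _ _] := cE.
have [r1 [_ /(_ (r1 + 1))]] := bU; rewrite ltrDl ltr01 => /(_ isT) Ur.
have [r2 [_ /(_ (r2 + 1))]] := bE; rewrite ltrDl ltr01 => /(_ isT) Er.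
have [B B0 HB] := step_estimate e (r1 + 1) sphi.
have [L L0 HL] := smooth_lipschitz (r2 + 1 + (`|e| + rho)) sphi.
have tc0 : 0 <= trace_constant / eps.
  rewrite divr_ge0// divr_ge0 ?(ltW q00)// mulr_ge0// mulr_ge0 ?ball_volume_ge0//.
  by rewrite exprn_ge0// mulr_ge0 ?(ltW s00)// mulr_ge0// ltW.
set J := \int[mu]_(x in U) `|phi x| + _.
apply: ge_ereal_sup => _ [D D0 <-]; apply/lee_addgt0Pr => eta eta0.
have pos1 (t : R) : 0 <= t -> 0 < t + 1 by move=> t0; rewrite ltr_wpDl.
pose muU := fine (mu U); have muU0 : 0 <= muU by rewrite fine_ge0.
have bound (t a : R) d : 0 <= t -> 0 < a -> d <= a / (t + 1) -> t * d <= a.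
  move=> t0 a0 da; apply: le_trans (ler_wpM2l t0 da) _.
  by rewrite mulrCA ler_piMr ?(ltW a0)// ler_pdivrMr ?pos1// mul1r lerDl.
(* For large [K], [t1] makes the covering cubes finer than the scale [D], [t2] keeps [phi] within
   [eps / 2] of its boundary value on the lowest cube, and [t3] absorbs the second order errors in
   [eta]. *)
pose t1 := N%:R * (2 * M); pose t2 := L * (`|e| + rho); pose t3 := trace_constant / eps * (B * muU).
have t10 : 0 <= t1 by rewrite mulr_ge0// mulr_ge0// ltW.
have t20 : 0 <= t2 by rewrite mulr_ge0// addr_ge0// ltW.
have t30 : 0 <= t3 by rewrite mulr_ge0// mulr_ge0.
have n1 := small_delta (divr_gt0 D0 (pos1 _ t10)).
have n2 := small_delta (divr_gt0 (divr_gt0 eps0 (ltr0n _ 2)) (pos1 _ t20)).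
have n3 := small_delta (divr_gt0 eta0 (pos1 _ t30)).
near \oo => K.
have d1 : t1 * delta K <= D by apply: bound => //; near: K.
have d2 : t2 * delta K <= eps / 2 by apply: bound; [|exact: divr_gt0|near: K].
have d3 : t3 * delta K <= eta by apply: bound => //; near: K.
have low y x : E y -> Q K y 0 x -> eps / 2 <= `|phi x|.
  move=> Ey; rewrite /Q /cube/= mul1r => Qx.
  have xy : `|x - y| <= delta K * (`|e| + rho).
    rewrite (_ : x - y = delta K *: e + (x - (y + delta K *: e))); last first.
      by rewrite [RHS]addrC opprD addrA subrK.
    apply: le_trans (ler_normD _ _) _; rewrite mulrDr lerD//.
      by rewrite normrZ (gtr0_norm (delta0 K)).
    by rewrite mulrC.
  have yr : `|y| <= r2 + 1 + (`|e| + rho) by rewrite (le_trans (Er _ Ey))// lerDl addr_ge0// ltW.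
  have xr : `|x| <= r2 + 1 + (`|e| + rho).
    rewrite -(subrK y x) addrC; apply: le_trans (ler_normD _ _) _; rewrite lerD ?Er//.
    by rewrite (le_trans xy)// ler_piMl ?delta1// addr_ge0// ltW.
  have hL := HL _ _ yr xr.
  have : `|phi y - phi x| <= eps / 2.
    apply: le_trans hL _; apply: le_trans d2; rewrite /t2 -mulrA ler_wpM2l//.
    by rewrite mulrC distrC.
  have := lowb _ Ey; have := ler_normD (phi y - phi x) (phi x); rewrite subrK; lra.
pose P m := exists Y : seq V, [/\ size Y = m, uniq Y, {in Y, forall y, E y} & separated K Y].
have Ur' x : U x -> `|x| <= r1 + 1 by exact: Ur.
set IG := \int[mu]_(x in U) (`|phi x| + s0 * mass K B x).
have count Y : uniq Y -> {in Y, forall y, E y} -> separated K Y ->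
    (size Y)%:R * (eps / 2 * q0) <= K.+1%:R ^+ N.-1 * IG.
  by move=> uY YE sY; exact: (family_count cE uY YE sY B0 Ur' HB low).
have eq0 : 0 < eps / 2 * q0 by rewrite mulr_gt0// divr_gt0.
have P0 : exists m, `[< P m >] by exists 0%N; apply/asboolP; exists [::]; split.
(* The counting bound makes a separated family of maximal size exist; by maximality, the cubes of
   half-side [M * delta K] around it cover [E]. *)
have Pb m : `[< P m >] -> (m <= Num.bound (K.+1%:R ^+ N.-1 * IG / (eps / 2 * q0)))%N.
  move=> /asboolP[Y [<- uY YE sY]]; have := count Y uY YE sY.
  rewrite -ler_pdivlMr// => h; rewrite -(ler_nat R); apply: (le_trans h); apply: ltW.
  by apply: archi_boundP; exact: le_trans h.
have [_ /asboolP[Y [<- uY YE sY]] Ymax] := ex_maxnP P0 Pb.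
have cover : E `<=` [set x | exists2 y, y \in Y & cube y (M * delta K) x].
  move=> x Ex; apply: contrapT => nx.
  have far y : y \in Y -> M * delta K < `|x - y|.
    by move=> yY; rewrite ltNge; apply/negP => h; apply: nx; exists y.
  have Md : 0 < M * delta K by rewrite mulr_gt0.
  have : (size (x :: Y) <= size Y)%N; last by rewrite ltnn.
  apply: Ymax; apply/asboolP; exists (x :: Y); split=> //=.
  - rewrite uY andbT; apply/negP => /far; rewrite subrr normr0 ltNge.
    by rewrite (ltW Md).
  - by move=> y; rewrite inE => /orP[/eqP ->|/YE].
  - move=> y y'; rewrite !inE => /orP[/eqP ->|yY] /orP[/eqP ->|y'Y]; first by left.
    + by right; exact: far.
    + by right; rewrite distrC; exact: far.
    + exact: sY.
pose b := bv * (N%:R * (M * delta K)) ^+ N.-1.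
have Md0 : 0 <= M * delta K by rewrite mulr_ge0// ltW.
have b0 : 0 <= b by rewrite mulr_ge0 ?ball_volume_ge0// exprn_ge0// mulr_ge0.
have gb y : (@hausdorff_gauge R N N.-1 D (cube y (M * delta K)) <= b%:E)%E.
  by apply: gauge_cube => //; apply: le_trans d1; rewrite /t1 le_eqVlt; apply/orP; left; apply/eqP; ring.
apply: le_trans (cover_outer_finite (hausdorff_gauge0 N.-1 D) (hausdorff_gauge_ge0 N.-1 D) b0 gb cover) _.
rewrite -EFinD lee_fin.
have IGJ : IG <= J + delta K * (B * muU).
  have I1 : L1 mu U (fun x => `|phi x|) by exact: continuous_L1.
  have I2 : L1 mu U (fun x => `|dird e phi x|).
    by apply: continuous_L1 => //; exact/continuous_normf/smooth_continuous/smooth_dird.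
  have Ic : L1 mu U (fun=> delta K * B).
    by apply: (@L1_bounded _ _ _ _ _ _ `|delta K * B|) => //; exact: leb_bounded.
  rewrite /IG /J -addrA (RintegralD mU I1 (L1Z _ mU (L1D mU I2 Ic))) lerD2l.
  rewrite (RintegralZl _ mU (L1D mU I2 Ic)) (RintegralD mU I2 Ic) Rintegral_cst//.
  rewrite -/muU mulrA ler_piMl// addr_ge0 ?Rintegral_ge0//.
  by rewrite !mulr_ge0// ltW.
have k0 : 0 < K.+1%:R ^+ N.-1 :> R by rewrite exprn_gt0.
have bval : b = bv * (N%:R * M * s0) ^+ N.-1 / K.+1%:R ^+ N.-1.
  rewrite /b /delta -exprVn -mulrA -exprMn; congr (_ * _ ^+ _); ring.
have sizeY : (size Y)%:R / K.+1%:R ^+ N.-1 <= IG * 2 / (eps * q0).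
  have h := count Y uY YE sY.
  rewrite ler_pdivrMr// mulrAC ler_pdivlMr ?mulr_gt0//; move: h.
  by move: (K.+1%:R ^+ _) => k; lra.
have -> : (size Y)%:R * b = (size Y)%:R / K.+1%:R ^+ N.-1 * (bv * (N%:R * M * s0) ^+ N.-1).
  by rewrite bval; ring.
have bb0 : 0 <= bv * (N%:R * M * s0) ^+ N.-1.
  by rewrite mulr_ge0 ?ball_volume_ge0// exprn_ge0// mulr_ge0 ?(ltW s00)// mulr_ge0// ltW.
apply: le_trans (ler_wpM2r bb0 sizeY) _.
have -> : IG * 2 / (eps * q0) * (bv * (N%:R * M * s0) ^+ N.-1) = trace_constant / eps * IG.
  by rewrite /trace_constant; field; rewrite !gt_eqF.
apply: le_trans (ler_wpM2l tc0 IGJ) _; rewrite mulrDr lerD2l.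
by apply: le_trans d3; rewrite /t3 mulrCA -mulrA mulrC -!mulrA.
Unshelve. all: by end_near. Qed.

End boundary_estimate.

Section trace_constant_region.
Context {R : realType} {N : nat}.
Local Notation V := 'rV[R]_N.
Local Notation S := (lebesgue_space R N).
Local Notation mu := (leb R N).
Local Notation H := (hausdorff_om R N N.-1).
Hypothesis cube_pos : forall r, 0 < r -> (0 < mu (cube 0 r))%E.
Variables (Om U E : set V) (e : V) (kappa c s0 : R).
Hypotheses (N0 : (0 < N)%N) (oO : open Om) (bO : bounded_set Om) (oU : open U) (UO : U `<=` Om)
  (e0 : 0 < `|e|) (kappa0 : 0 < kappa) (c0 : 0 < c) (s00 : 0 < s0) (s01 : s0 <= 1)
  (cE : chart U e kappa c s0 E).
Variables (v tau : V -> R) (W : V -> V) (b : R).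
Hypotheses (av : appr Om E v W tau) (vb : {ae mu, forall x, U x -> v x = b})
  (W0 : {ae mu, forall x, U x -> forall i, W x ord0 i = 0}).

Let mU : measurable (U : set S) := measurable_open_om leb_half oU.
Let mO : measurable (Om : set S) := measurable_open_om leb_half oO.
Let bU : bounded_set U := bounded_setS UO bO.

Let trace_far eps : 0 < eps -> H (E `&` [set x | 2 * eps < `|tau x - b|]) = 0%E.
Proof.
move=> eps0; apply/eqP; rewrite eq_le outer_measure_ge0 andbT; apply/lee_addgt0Pr => eta eta0.
rewrite add0e.
pose T := `|trace_constant e kappa c s0| / eps * (1 + \sum_i `|e ord0 i|).
have se0 : 0 <= \sum_i `|e ord0 i| by exact: sumr_ge0.
have T0 : 0 <= T by rewrite mulr_ge0 ?divr_ge0 ?(ltW eps0)// addr_ge0.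
have T1 : 0 < 1 + T by rewrite ltr_pwDl.
pose e' := Num.min eps (eta / (1 + T)).
have e'0 : 0 < e' by rewrite lt_min eps0 divr_gt0.
have e'eps : e' <= eps by rewrite ge_min lexx.
have e'eta : e' + T * e' <= eta.
  by rewrite -[X in X + _]mul1r -mulrDl mulrC -ler_pdivlMr// ge_min lexx orbT.
have [Iv IW ap] := av; have [phi [sphi a1 b1 h1]] := ap _ e'0.
have sc := @smooth_cst R N b.
have Iphi := smooth_L1 oO bO sphi.
have Idir : forall i, \int[mu]_(x in U) `|partial i phi x| <= e'.
  move=> i; have Ip := smooth_L1 oO bO (@smooth_partial _ _ _ i sphi).
  apply: le_trans (b1 i); apply: le_trans (le_Rint_subset mU mO UO (L1_norm (L1B mO Ip (IW i))) _) => //.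
  have I1 := L1S mU mO UO (L1_norm Ip); have I2 := L1S mU mO UO (L1_norm (L1B mO Ip (IW i))).
  rewrite le_eqVlt; apply/orP; left; apply/eqP.
  apply: (Rintegral_ae mU (L1_measurable mU I1) (L1_measurable mU I2)).
  by apply: ae_imp W0 => x h Ux; rewrite h// subr0.
have Ival : \int[mu]_(x in U) `|phi x - b| <= e'.
  have Ipb : L1 mu Om (fun x => phi x - b) by apply: smooth_L1 => //; exact: smoothB.
  apply: le_trans a1; apply: le_trans (le_Rint_subset mU mO UO (L1_norm (L1B mO Iphi Iv)) _) => //.
  have I1 := L1S mU mO UO (L1_norm Ipb); have I2 := L1S mU mO UO (L1_norm (L1B mO Iphi Iv)).
  rewrite le_eqVlt; apply/orP; left; apply/eqP.
  apply: (Rintegral_ae mU (L1_measurable mU I1) (L1_measurable mU I2)).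
  by apply: ae_imp vb => x h Ux; rewrite h.
(* Where [tau] is farther than [2 eps] from [b], either [phi] is farther than [e'] from [tau], on a
   small set, or the point is in [F]. There [trace_estimate] applies to [phi - b], which is small in
   [U] together with its gradient. *)
pose F := E `&` [set x | eps <= `|phi x - b|].
have cF : chart U e kappa c s0 F.
  have [k1 k2 k3] := cE; split.
  - by apply: bounded_setS k1 => x [].
  - by move=> y s x [Ey _]; exact: k2.
  - by move=> y y' s [Ey _] [Ey' _]; exact: k3.
have := trace_estimate cube_pos N0 oU bU e0 kappa0 c0 s00 s01 (smoothB sphi sc) cF eps0.
rewrite (_ : dird e _ = dird e phi); last first.
  by apply/funext => x; apply: eq_bigr => i _; rewrite partialB// partial_cst subr0.
move=> /(_ (fun y Fy => Fy.2)) HF.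
have HF' : (H F <= (T * e')%:E)%E.
  apply: le_trans HF _; rewrite lee_fin.
  have Jd := @transl_dird_bound R N U phi e e' sphi oU bU Idir.
  have J0 : 0 <= \int[mu]_(x in U) `|phi x - b| + \int[mu]_(x in U) `|dird e phi x|.
    by rewrite addr_ge0// Rintegral_ge0.
  apply: (@le_trans _ _ (`|trace_constant e kappa c s0| / eps *
      (\int[mu]_(x in U) `|phi x - b| + \int[mu]_(x in U) `|dird e phi x|))).
    by rewrite ler_wpM2r// ler_wpM2r ?invr_ge0 ?(ltW eps0)// ler_norm.
  rewrite /T -[leRHS]mulrA ler_wpM2l ?divr_ge0 ?(ltW eps0)// mulrDl mul1r lerD//.
apply: (@le_trans _ _ (e'%:E + (T * e')%:E)%E); last by rewrite -EFinD lee_fin.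
apply: le_trans (leeD h1 HF'); apply: le_trans (outer_measureU2 _ _ _).
apply: le_outer_measure => x [Ex /= hx]; have [h|h] := ltP e' `|phi x - tau x|; first by left.
right; split=> //=; have := ler_normD (tau x - phi x) (phi x - b).
by rewrite addrA subrK (distrC (tau x) (phi x)); lra.
Qed.

Lemma trace_const : H (E `&` [set x | tau x <> b]) = 0%E.
Proof.
apply: (@outer_measure_countable0 _ _ _ (fun n => E `&` [set x | 2 * n.+1%:R^-1 < `|tau x - b|])).
  by move=> n; apply: trace_far; rewrite invr_gt0 ltr0n.
move=> x [Ex /= /eqP]; rewrite -subr_eq0 -normr_gt0 => t0.
have t20 : 0 < `|tau x - b| / 2 by rewrite divr_gt0.
have [n _ /(_ n (leqnn n)) /= h] := near_infty_natSinv_lt (PosNum t20).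
by exists n => //; split=> //=; rewrite mulrC -ltr_pdivlMr.
Qed.

End trace_constant_region.

(** * Charts of a Lipschitz boundary *)

Section charts.
Context {R : realType} {N : nat}.
Local Notation V := 'rV[R]_N.
Implicit Types (x y : V) (Om : set V).

Lemma dotDl x y (z : V) : dot (x + y) z = dot x z + dot y z.
Proof. by rewrite /dot -big_split/=; apply: eq_bigr => i _; rewrite mxE mulrDl. Qed.

Lemma dotZl (t : R) x y : dot (t *: x) y = t * dot x y.
Proof. by rewrite /dot mulr_sumr; apply: eq_bigr => i _; rewrite mxE mulrA. Qed.

Lemma dotBl x y (z : V) : dot (x - y) z = dot x z - dot y z.
Proof. by rewrite -scaleN1r dotDl dotZl mulN1r. Qed.

Lemma dot_norm x y : `|dot x y| <= N%:R * `|y| * `|x|.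
Proof.
apply: le_trans (ler_norm_sum _ _ _) _.
apply: (@le_trans _ _ (\sum_(i < N) `|y| * `|x|)).
  by apply: ler_sum => i _; rewrite normrM mulrC ler_pM ?coord_norm_le.
by rewrite sumr_const card_ord -mulrA mulr_natl.
Qed.

(** The height [G] above the graph is Lipschitz, grows with slope 1 along [e], vanishes on the
    boundary and is positive exactly in [Om] near [y0]. The cone property and the graph property of
    a chart both follow from this. *)
Lemma lipschitz_chart Om y0 : (0 < N)%N -> open Om -> lipschitz_boundary Om -> boundary Om y0 ->
  exists e kappa c s0 r, [/\ 0 < `|e| & 0 < kappa] /\ [/\ 0 < c, 0 < s0, s0 <= 1 & 0 < r] /\
    (chart Om e kappa c s0 (boundary Om `&` cube y0 r) /\
     forall x0, chart (connected_component Om x0) e kappa c s0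
       (boundary (connected_component Om x0) `&` cube y0 r)).
Proof.
move=> N0 oO lip /lip[e [gamma [r [ee gl r0 HO]]]].
have e0 : 0 < `|e|.
  rewrite normr_gt0; apply/eqP => E0; move: ee; rewrite E0 /dot big1 => [/eqP|i _].
    by rewrite eq_sym oner_eq0.
  by rewrite mxE mul0r.
have [L L0 HL] : exists2 L, 0 <= L & forall x y, `|gamma x - gamma y| <= L * `|x - y|.
  case: gl => M [_ /(_ (`|M| + 1))]; rewrite (le_lt_trans (ler_norm M))// ?ltrDl// => /(_ isT) h.
  by exists (`|M| + 1); rewrite ?addr_ge0// => x y; exact: (h (x, y)).
pose P x := x - dot x e *: e; pose G x := dot x e - gamma (P x).
have PD y s : P (y + s *: e) = P y.
  by rewrite /P dotDl dotZl ee mulr1 scalerDl opprD addrACA subrr addr0.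
have GD y s : G (y + s *: e) = G y + s.
  by rewrite /G PD dotDl dotZl ee mulr1 addrAC.
pose d1 := N%:R * `|e|; have d10 : 0 < d1 by rewrite mulr_gt0// ltr0n.
pose L' := d1 + L * (1 + d1 * `|e|).
have L'0 : 0 < L' by rewrite ltr_pwDl// mulr_ge0// addr_ge0// mulr_ge0// ltW.
have GL x y : `|G x - G y| <= L' * `|x - y|.
  have h1 : `|dot x e - dot y e| <= d1 * `|x - y| by rewrite -dotBl; exact: dot_norm.
  have h2 : `|P x - P y| <= (1 + d1 * `|e|) * `|x - y|.
    rewrite (_ : P x - P y = (x - y) - (dot x e - dot y e) *: e); last first.
      by rewrite /P; apply/rowP => i; rewrite !mxE; ring.
    apply: le_trans (ler_normB _ _) _; rewrite mulrDl mul1r lerD2l normrZ mulrAC.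
    by rewrite ler_wpM2r.
  rewrite (_ : G x - G y = (dot x e - dot y e) - (gamma (P x) - gamma (P y))); last first.
    by rewrite /G; ring.
  apply: le_trans (ler_normB _ _) _; rewrite mulrDl lerD//.
  by apply: le_trans (HL _ _) _; rewrite -mulrA ler_wpM2l.
have OG x : enorm (x - y0) < r -> (Om x <-> 0 < G x) by move=> /HO ->; rewrite /G subr_gt0.
pose r1 := r / N%:R; have r10 : 0 < r1 by rewrite divr_gt0// ltr0n.
have OG1 x : `|x - y0| < r1 -> (Om x <-> 0 < G x).
  move=> xr; apply: OG; apply: le_lt_trans (enorm_le_norm _) _.
  by rewrite mulrC -ltr_pdivlMr// ltr0n.
(* At the height [s] above a boundary point [G] equals [s], and within the distance [kappa * s] it
   changes by less than [s], so it remains positive. *)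
pose kappa := L'^-1; have k0 : 0 < kappa by rewrite invr_gt0.
have G0 y : boundary Om y -> `|y - y0| < r1 -> G y = 0.
  move=> [cl ni] yr; have rr : 0 < r1 - `|y - y0| by rewrite subr_gt0.
  have near_y x t : `|x - y| < t -> t <= r1 - `|y - y0| -> `|x - y0| < r1.
    move=> h1 h2; rewrite -(subrK y x) -addrA; apply: le_lt_trans (ler_normD _ _) _.
    by rewrite -ltrBrDr (lt_le_trans h1).
  apply/eqP; rewrite eq_le; apply/andP; split; rewrite leNgt; apply/negP => Gy.
    apply: ni; pose t := Num.min (r1 - `|y - y0|) (G y * kappa).
    have t0 : 0 < t by rewrite lt_min rr mulr_gt0.
    apply/nbhs_ballP; exists t => //= x; rewrite -ball_normE/= distrC => xt.
    have /OG1 -> : `|x - y0| < r1 by apply: near_y xt _; rewrite ge_min lexx.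
    have : L' * `|x - y| < G y.
      rewrite mulrC -ltr_pdivlMr//; apply: lt_le_trans xt _.
      by rewrite ge_min lexx orbT.
    have := GL x y; rewrite distrC => h1 h2; have := ler_norm (G y - G x); lra.
  pose t := Num.min (r1 - `|y - y0|) (- G y * kappa).
  have t0 : 0 < t by rewrite lt_min rr mulr_gt0// oppr_gt0.
  have [x Ox xt] := closure_normP cl t0.
  have /OG1 H1 : `|x - y0| < r1 by apply: near_y xt _; rewrite ge_min lexx.
  have : L' * `|x - y| < - G y.
    rewrite mulrC -ltr_pdivlMr//; apply: lt_le_trans xt _.
    by rewrite ge_min lexx orbT.
  have := GL x y; have := ler_norm (G x - G y); have := H1.1 Ox; lra.
(* Cones of height [s0] over points of [cube y0 (r1 / 4)] stay where the description of [Om] by [G]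
   is valid. *)
pose s0 := Num.min 1 (r1 / 4 / (kappa + `|e|)).
have ke0 : 0 < kappa + `|e| by rewrite addr_gt0.
have s00 : 0 < s0 by rewrite lt_min ltr01/=; apply: divr_gt0 => //; apply: divr_gt0.
have s01 : s0 <= 1 by rewrite ge_min lexx.
have s0k s : s <= s0 -> (kappa + `|e|) * s <= r1 / 4.
  by move=> ss; rewrite mulrC -ler_pdivlMr// (le_trans ss)// ge_min lexx orbT.
pose c := (1 + L' * `|e|)^-1.
have c0 : 0 < c by rewrite invr_gt0 ltr_pwDl// mulr_ge0// ltW.
have cone y s x : boundary Om y -> `|y - y0| <= r1 / 4 -> 0 < s -> s <= s0 ->
    `|x - (y + s *: e)| < kappa * s -> Om x.
  move=> By yr s0' ss xs; have yr1 : `|y - y0| < r1 by lra.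
  apply/OG1.
    rewrite -(subrK (y + s *: e) x) -addrA; apply: le_lt_trans (ler_normD _ _) _.
    rewrite addrAC; have := ler_normD (y - y0) (s *: e); rewrite normrZ (gtr0_norm s0').
    by have := s0k s ss; rewrite mulrDl; lra.
  have := GL x (y + s *: e); rewrite GD (G0 _ By yr1) add0r => h.
  have : L' * `|x - (y + s *: e)| < s by rewrite -ltr_pdivlMl.
  by have := ler_norm (s - G x); rewrite distrC; lra.
have graph y y' s : boundary Om y -> boundary Om y' -> `|y - y0| <= r1 / 4 -> `|y' - y0| <= r1 / 4 ->
    c * `|y - y'| <= `|y - y' + s *: e|.
  move=> By By' yr yr'; have h1 : `|y - y0| < r1 by lra.
  have h2 : `|y' - y0| < r1 by lra.
  have := GL (y + s *: e) y'; rewrite GD (G0 _ By h1) (G0 _ By' h2) add0r subr0 (addrAC y) => sL.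
  rewrite /c ler_pdivrMl ?ltr_pwDl ?mulr_ge0 ?(ltW L'0)//.
  rewrite -{1}(addrK (s *: e) (y - y')); apply: le_trans (ler_normB _ _) _.
  by rewrite mulrDl mul1r lerD2l normrZ mulrAC ler_wpM2r.
exists e, kappa, c, s0, (r1 / 4); split=> //; split; first by split=> //; rewrite divr_gt0.
have bc (A : set V) : bounded_set (A `&` cube y0 (r1 / 4)).
  apply: (@bounded_setS _ _ _ (cube y0 (r1 / 4))) => [x []//|].
  by apply: compact_bounded; exact: cube_compact.
split.
  split=> //; first by move=> y s x [By yr]; exact: cone.
  by move=> y y' s [By yr] [By' yr']; exact: graph.
move=> x0; have CO := @boundary_component _ _ Om x0 oO.
split=> //; last by move=> y y' s [/CO By yr] [/CO By' yr']; exact: graph.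
move=> y s x [By yr] s0' ss xs; have BO := CO _ By.
(* The cone lies in the component itself: a point [z] of the component near [y] is joined in [Om] to
   [z + s *: e], as [G] increases along [e], and this point lies in the ball around [y + s *: e],
   which is contained in [Om]. *)
have [clC _] := By; have ks : 0 < Num.min (kappa * s) (r1 / 4) by rewrite lt_min; apply/andP; split; [exact: mulr_gt0|exact: divr_gt0].
have [z Cz] := closure_normP clC ks; rewrite lt_min => /andP[zk zr].
have Oz := connected_component_sub Cz.
have ballO w : `|w - (y + s *: e)| < kappa * s -> Om w by exact: cone.
have zse : connected_component Om z (z + s *: e).
  apply: segment_component => t /andP[t0 t1]; rewrite (addrC z (s *: e)) addrK scalerA.
  have zr1 : `|z - y0| <= r1 / 2.
    rewrite -(subrK y z) -addrA; apply: le_trans (ler_normD _ _) _.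
    by move: yr; rewrite /cube/=; lra.
  apply/OG1.
    rewrite addrAC; apply: le_lt_trans (ler_normD _ _) _; rewrite normrZ ger0_norm ?mulr_ge0 ?(ltW s0')//.
    have h1 : t * s * `|e| <= s * `|e| by rewrite ler_wpM2r// ler_piMl// ltW.
    have h2 := s0k s ss; have h3 : 0 <= kappa * s by rewrite mulr_ge0// ltW.
    by move: h2; rewrite mulrDl [`|e| * s]mulrC; lra.
  have /OG1 [/(_ Oz) Gz _] : `|z - y0| < r1 by lra.
  by rewrite GD; apply: ltr_pwDl => //; rewrite mulr_ge0// ltW.
apply: connected_component_trans Cz _; apply: connected_component_trans zse _.
apply: connected_component_trans (ball_component ballO xs).
apply: connected_component_sym; apply: ball_component ballO _.
by rewrite opprD addrACA subrr addr0.
Qed.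

End charts.

(** * From boundary values to values inside *)

Section zero_trace.
Context {R : realType} {N : nat}.
Local Notation V := 'rV[R]_N.
Local Notation mu := (leb R N).
Local Notation H := (hausdorff_om R N N.-1).
Hypothesis cube_pos : forall r, 0 < r -> (0 < mu (cube 0 r))%E.
Variables (Om : set V) (N0 : (0 < N)%N) (Olip : bounded_lipschitz_open Om).
Let oO : open Om. Proof. by case: Olip. Qed.
Let bO : bounded_set Om. Proof. by case: Olip. Qed.
Let lO : lipschitz_boundary Om. Proof. by case: Olip. Qed.

Lemma chartS (U E E' : set V) e kappa c s0 : E' `<=` E ->
  chart U e kappa c s0 E -> chart U e kappa c s0 E'.
Proof.
move=> EE [k1 k2 k3]; split.
- exact: bounded_setS EE k1.
- by move=> y s x /EE; exact: k2.
- by move=> y y' s /EE Ey /EE; exact: k3.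
Qed.

(** The traces converge only on each [E j], so [trace_const] is applied piece by piece. A nonzero
    constant on a component would force [lambda] to vanish almost everywhere on its boundary. *)
Lemma zero_from_boundary v tau lambda (E : nat -> set V) :
  (forall y, boundary Om y -> exists j, E j y) ->
  (forall j, appr Om (boundary Om `&` E j) v (fun=> 0) tau) ->
  {ae surf R N, forall y, boundary Om y -> lambda y != 0 -> tau y = 0} ->
  nonnull_on_components Om lambda -> {ae mu, forall x, Om x -> v x = 0}.
Proof.
move=> Ecov av lt nn; apply/negligible_om; apply: outer_local => x /= /not_implyP[Ox _].
have [c Hc] := component_constant oO bO N0 cube_pos (av 0%N) Ox.
have c0 : c = 0.
  apply: contrapT => cn0; apply: (nn _ Ox); apply/negligible_om; apply: outer_local.
  move=> y0 /= /not_implyP[By0 _]; have By0' := boundary_component oO By0.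
  have [e [kappa [c1 [s0 [r [[e0 k0] [[c10 s00 s01 r0] [_ /(_ x) cC]]]]]]]] := lipschitz_chart N0 oO lO By0'.
  exists r => //.
  pose C := connected_component Om x.
  pose Z j := (boundary C `&` cube y0 r `&` E j) `&` [set y | tau y <> c].
  have Z0 j : H (Z j) = 0%E.
    have CE : boundary C `&` cube y0 r `&` E j `<=` boundary Om `&` E j.
      by move=> y [[/(boundary_component oO)]].
    have cCE : chart C e kappa c1 s0 (boundary C `&` cube y0 r `&` E j) by apply: chartS cC => y [].
    have CO : C `<=` Om := @connected_component_sub _ Om x.
    have oC : open C by exact: open_component.
    apply: (trace_const cube_pos N0 oO bO oC CO e0 k0 c10 s00 s01 cCE (apprS CE (av j)) Hc).
    by apply: aeW => y _ i; rewrite mxE.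
  move/negligible_om : lt => lt.
  (* The index 0 holds the exceptional set of the hypothesis on [tau], the index [j.+1] the points
     of [E j] where [tau] differs from [c]. *)
  apply: (@outer_measure_countable0 _ _ _ (fun n => if n is j.+1 then Z j else
    ~` [set y | boundary Om y -> lambda y != 0 -> tau y = 0])).
    by case.
  move=> y [/= /not_implyP[By ly] yr]; have [j Ej] := Ecov y (boundary_component oO By).
  have [t0|tn0] := pselect (tau y = 0).
    by exists j.+1 => //; split=> //=; rewrite t0 => /esym.
  exists 0%N => //= h; apply: tn0; apply: h; first exact: (boundary_component oO By).
  exact/eqP.
have [r r0 Hr] := open_normP (@open_component _ _ Om x oO) (connected_component_refl Ox).
exists (r / 2); first by rewrite divr_gt0.
move/negligible_om : Hc => Hc; apply/eqP; rewrite eq_le outer_measure_ge0 andbT -Hc.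
apply: le_outer_measure => z [/= /not_implyP[_ vz] zr]; apply/not_implyP; rewrite c0; split=> //.
by apply: Hr; apply: le_lt_trans zr _; rewrite ltr_pdivrMr// ltr_pMr// ltr1n.
Qed.

(* With [F t = exp (1 / t)] for [t < 0] and [F t = 0] for [t >= 0], [F v] is 0 in
   [Om], so its trace [F tau] is 0. *)
Lemma trace_ge0 v W tau : appr Om (boundary Om) v W tau ->
  {ae mu, forall x, Om x -> 0 <= v x} -> {ae surf R N, forall y, boundary Om y -> 0 <= tau y}.
Proof.
move=> av v0.
pose F (t : R) := flat (- 1 * t + 0).
(* The first and second derivatives of the flat function: both are bounded, so [F'] is bounded and
   Lipschitz, as [appr_comp] demands. *)
pose P1 : {poly R} := 'X^2 * (1 - 1^`()); pose P2 : {poly R} := 'X^2 * (P1 - P1^`()).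
pose F' (t : R) := - 1 * flatp P1 (- 1 * t + 0).
pose F'' (t : R) := flatp P2 (- 1 * t + 0).
have CF : Cinf F by apply: Cinf_affine; exact: Cinf_flat.
have dcomp (Q : {poly R}) (t : R) : is_derive t (1 : R) (fun t => flatp Q (- 1 * t + 0))
    (- 1 * flatp ('X^2 * (Q - Q^`())) (- 1 * t + 0)).
  apply: (@is_derive_eq _ _ _ _ _ _ _ (flatp ('X^2 * (Q - Q^`())) (- 1 * t + 0) * - 1)); last by rewrite mulrC.
  apply: (@is_derive1_comp R (flatp Q) (fun x => - 1 * x + 0)).
    exact: flatp_derive.
  exact: affine_derive.
have dF t : is_derive t (1 : R) F (F' t) by exact: dcomp.
have dF' t : is_derive t (1 : R) F' (F'' t).
  suff -> : F'' t = - 1 *: (- 1 * flatp P2 (- 1 * t + 0)) by apply: is_deriveZ; exact: dcomp.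
  by rewrite /F'' /GRing.scale/= [RHS]mulrA mulrNN !mul1r.
have [M HM] := flatp_bounded P1; have [K HK] := flatp_bounded P2.
have F'M t : `|F' t| <= M by rewrite /F' normrM normrN1 mul1r.
have F''K t : `|F'' t| <= K by exact: HK.
have K0 : 0 <= K by exact: le_trans (F''K 0).
have F'L := lipschitz_of_derive dF' F''K.
have aF := appr_comp oO bO K0 CF dF F'M F'L av.
have Fneg t : 0 <= t -> F t = 0 by move=> t0; rewrite /F flat_le0// addr0 mulN1r oppr_le0.
have F'neg t : 0 <= t -> F' t = 0.
  by move=> t0; rewrite /F' /flatp addr0 !mulN1r oppr_gt0 ltNge t0 oppr0.
apply/negligible_om; apply: outer_local => y0 /= /not_implyP[By0 _].
have [e [kappa [c1 [s0 [r [[e0 k0] [[c10 s00 s01 r0] [cO _]]]]]]]] := lipschitz_chart N0 oO lO By0.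
exists r => //.
have EB : boundary Om `&` cube y0 r `<=` boundary Om by move=> y [].
have : H ((boundary Om `&` cube y0 r) `&` [set y | (F \o tau) y <> 0]) = 0%E.
  apply: (trace_const cube_pos N0 oO bO oO (@subset_refl _ _) e0 k0 c10 s00 s01 cO (apprS EB aF)).
  - by apply: ae_imp v0 => x h Ox; rewrite /= Fneg// h.
  - by apply: ae_imp v0 => x h Ox i; rewrite mxE F'neg ?mul0r// h.
move=> H0; apply/eqP; rewrite eq_le outer_measure_ge0 andbT -H0.
apply: le_outer_measure => y [/= /not_implyP[By ty] yr]; split; first by split.
move=> /=; apply/eqP; rewrite gt_eqF// /F flat_gt0// addr0 mulN1r oppr_gt0 ltNge.
exact/negP.
Qed.

End zero_trace.

(** * Structure conditions and pointwise estimates *)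

Section vector_inequalities.
Context {R : realType} {N : nat}.
Local Notation V := 'rV[R]_N.
Implicit Types (x y w : V).

Lemma dotC x y : dot x y = dot y x.
Proof. by apply: eq_bigr => i _; rewrite mulrC. Qed.

Lemma dotBr w x y : dot w (x - y) = dot w x - dot w y.
Proof. by rewrite dotC dotBl !(dotC w). Qed.

Lemma dotZr (t : R) w x : dot w (t *: x) = t * dot w x.
Proof. by rewrite dotC dotZl dotC. Qed.

Lemma dot0r w : dot w 0 = 0.
Proof. by apply: big1 => i _; rewrite mxE mulr0. Qed.

Lemma enorm_ge0 x : 0 <= enorm x.
Proof. exact: sqrtr_ge0. Qed.

Lemma dot_enorm x y : `|dot x y| <= N%:R * (enorm x * enorm y).
Proof.
apply: le_trans (ler_norm_sum _ _ _) _.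
apply: (@le_trans _ _ (\sum_(i < N) enorm x * enorm y)).
  by apply: ler_sum => i _; rewrite normrM ler_pM// coord_enorm_le.
by rewrite sumr_const card_ord mulr_natl.
Qed.

(** Replacing the smaller of [s] and [t] by the larger one gives this crude form of Young's
    inequality; [young_conj] follows with [s ^ (1 / (p - 1))] in place of [s]. *)
Lemma young_powR (p s t : R) : 1 < p -> 0 <= s -> 0 <= t ->
  s `^ (p - 1) * t <= s `^ p + t `^ p.
Proof.
move=> p1 s0 t0; have p0 : 0 < p by exact: lt_trans p1.
have pM (r : R) : 0 <= r -> r `^ (p - 1) * r = r `^ p.
  move=> r0; have [->|rn0] := eqVneq r 0; first by rewrite mulr0 powR0// gt_eqF.
  by rewrite -{2}(powRr1 r0) -powRD ?subrK// rn0 implybT.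
have [st|ts] := leP s t.
  apply: (@le_trans _ _ (t `^ p)); last by rewrite lerDr powR_ge0.
  by rewrite -(pM t)// ler_wpM2r// ge0_ler_powR ?nnegrE// subr_ge0 ltW.
apply: (@le_trans _ _ (s `^ p)); last by rewrite lerDl powR_ge0.
by rewrite -(pM s)// ler_wpM2l ?powR_ge0// ltW.
Qed.

Lemma young_conj (p s t : R) : 1 < p -> 0 <= s -> 0 <= t ->
  s * t <= s `^ (p / (p - 1)) + t `^ p.
Proof.
move=> p1 s0 t0; have p10 : 0 < p - 1 by rewrite subr_gt0.
have := young_powR p1 (powR_ge0 s (p - 1)^-1) t0.
by rewrite -!powRrM mulVf ?gt_eqF// powRr1// mulrC [_^-1 * p]mulrC.
Qed.

End vector_inequalities.

Section structure_conditions.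
Context {R : realType} {N : nat}.
Local Notation V := 'rV[R]_N.
Variables (p alpha beta zx : R) (ax : V -> V).
Hypotheses (N0 : (0 < N)%N) (p1 : 1 < p) (alpha0 : 0 < alpha) (beta0 : 0 < beta) (zx0 : 0 <= zx).
Hypothesis struct : forall xi xi' : V, xi != xi' ->
  [/\ alpha * enorm xi `^ p <= dot (ax xi) xi,
      enorm (ax xi) <= beta * (zx + enorm xi `^ (p - 1)) &
      0 < dot (ax xi - ax xi') (xi - xi')].

(** The structure conditions are given for pairs of distinct vectors; coercivity and growth at one
    vector are extracted with an arbitrary partner. *)
Let other (xi : V) : exists xi' : V, xi != xi'.
Proof.
exists (xi + const_mx 1); apply/eqP => /rowP/(_ (Ordinal N0)) /eqP; rewrite !mxE.
by rewrite -subr_eq0 opprD addrA subrr sub0r oppr_eq0 oner_eq0.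
Qed.

Lemma struct_coercive xi : alpha * enorm xi `^ p <= dot (ax xi) xi.
Proof. by have [xi' /struct[]] := other xi. Qed.

Lemma struct_growth xi : enorm (ax xi) <= beta * (zx + enorm xi `^ (p - 1)).
Proof. by have [xi' /struct[]] := other xi. Qed.

Lemma struct_energy_ge0 xi : 0 <= dot (ax xi) xi.
Proof. by apply: le_trans (struct_coercive xi); rewrite mulr_ge0 ?powR_ge0// ltW. Qed.

Lemma struct_mono xi xi' : 0 <= dot (ax xi - ax xi') (xi - xi').
Proof.
have [->|/struct[_ _ /ltW//]] := eqVneq xi xi'.
by rewrite !subrr dot0r.
Qed.

Lemma struct_strict xi xi' : dot (ax xi - ax xi') (xi - xi') = 0 -> xi = xi'.
Proof.
move=> h; apply/eqP; apply: contraT => /struct[_ _]; by rewrite h ltxx.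
Qed.

Definition cross_constant := N%:R * beta * (1 + 2 / alpha).

Lemma cross_constant_ge0 : 0 <= cross_constant.
Proof. by rewrite !mulr_ge0 ?(ltW beta0)// addr_ge0// divr_ge0// ltW. Qed.

(** Growth, then Young's inequality for each of the two terms; coercivity turns [p]-th powers into
    energies. The power of [xi'] occurs twice, whence [2 / alpha] in [cross_constant]. *)
Lemma struct_cross xi xi' : `|dot (ax xi) xi'| <=
  cross_constant * (zx `^ (p / (p - 1)) + dot (ax xi) xi + dot (ax xi') xi').
Proof.
apply: le_trans (dot_enorm _ _) _; rewrite /cross_constant -!mulrA ler_wpM2l//.
apply: le_trans (ler_wpM2r (enorm_ge0 xi') (struct_growth xi)) _.
rewrite -mulrA ler_wpM2l ?(ltW beta0)// mulrDl.
apply: le_trans (lerD (young_conj p1 zx0 (enorm_ge0 xi')) (young_powR p1 (enorm_ge0 xi) (enorm_ge0 xi'))) _.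
have a0 : 0 <= alpha^-1 by rewrite invr_ge0 ltW.
have h1 : enorm xi `^ p <= alpha^-1 * dot (ax xi) xi by rewrite ler_pdivlMl// struct_coercive.
have h2 : enorm xi' `^ p <= alpha^-1 * dot (ax xi') xi' by rewrite ler_pdivlMl// struct_coercive.
have e1 := struct_energy_ge0 xi; have e2 := struct_energy_ge0 xi'.
have x0 : 0 <= zx `^ (p / (p - 1)) by exact: powR_ge0.
have m1 := mulr_ge0 a0 e1; have m2 := mulr_ge0 a0 e2; have m3 := mulr_ge0 a0 x0.
move: h1 h2 e1 e2 x0 m1 m2 m3; move: (_ `^ _) (_ `^ _) (_ `^ _) (dot _ _) (dot _ _) => X A B e1 e2.
lra.
Qed.

Definition cutv (k s : R) (D : V) : V := if `|s| <= k then D else 0.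

(* The gradient of [trunc 1 (u1 - trunc n u2)] where [u1 = s], [u2 = t]. *)
Definition trunc_diff_grad (n s t : R) (D1 D2 : V) : V :=
  if `|s| <= n + 1 then theta 1 (trunc (n + 1) s - trunc n t) *: (cutv (n + 1) s D1 - cutv n t D2)
  else 0.

(** The energy where [n - 2 < |s| <= n + 1], as a difference of two cuts because this is the
    integrand that the entropy equation produces for [T_(n+1) u - T_(n-2) u]. *)
Definition window_energy (n s : R) (D : V) : R :=
  dot (ax D) (cutv (n + 1) s D - cutv (n - 2) s D).

Lemma thetaN (k s : R) : 0 < k -> theta k (- s) = theta k s.
Proof. by move=> k0; rewrite !thetaE// normrN. Qed.

Lemma theta_ge0 (k s : R) : 0 < k -> 0 <= theta k s.
Proof. by move=> k0; rewrite thetaE//; case: ifP => // _; case: ifP. Qed.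

Lemma theta_neq0 (k s : R) : 0 < k -> theta k s != 0 -> `|s| <= k.
Proof.
by move=> k0; rewrite thetaE//; case: ifPn => [/ltW//|_]; case: ifPn => [/eqP ->//|]; rewrite eqxx.
Qed.

Lemma trunc_gt (k s : R) : 0 <= k -> k < s -> trunc k s = k.
Proof. by move=> k0 ks; rewrite truncE// ks ltNge (le_trans _ (ltW ks)) ?(le_trans _ k0) ?oppr_le0. Qed.

Variables (n s t : R) (D1 D2 : V).
Hypotheses (n2 : 2 <= n) (s0 : 0 <= s) (t0 : 0 <= t).

Lemma window_energyE (D : V) (r : R) : 0 <= r -> window_energy n r D =
  if (n - 2 < r) && (r <= n + 1) then dot (ax D) D else 0.
Proof.
move=> r0; rewrite /window_energy /cutv ger0_norm//.
case: (leP r (n + 1)) => h1; case: (leP r (n - 2)) => h2 /=; rewrite ?subrr ?subr0 ?dot0r//.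
by exfalso; lra.
Qed.

Lemma window_energy_ge0 (D : V) (r : R) : 0 <= r -> 0 <= window_energy n r D.
Proof. by move=> r0; rewrite window_energyE//; case: ifP => // _; exact: struct_energy_ge0. Qed.

Lemma trunc_diff_gradE : trunc_diff_grad n s t D1 D2 =
  if s <= n + 1 then
    if t <= n then theta 1 (s - t) *: (D1 - D2) else theta 1 (s - n) *: D1
  else 0.
Proof.
rewrite /trunc_diff_grad /cutv ger0_norm// ger0_norm//.
have [sn|//] := leP s (n + 1); rewrite (trunc_id (s := s)) ?ger0_norm//.
have [tn|nt] := leP t n; first by rewrite trunc_id// ger0_norm.
by rewrite (trunc_gt (le_trans (ler0n _ 2) n2) nt) subr0.
Qed.

(** If [s, t <= n], this is the term to be paired with the other equation. If [t > n], only a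
    nonnegative energy is left. If [n < s <= n + 1] and [t <= n], the cross term survives only for
    [s - t <= 1], so both values are in the window and [struct_cross] applies. *)
Lemma trunc_diff_grad_lower : dot (ax D1) (trunc_diff_grad n s t D1 D2) >=
  (if (s <= n) && (t <= n) then theta 1 (s - t) * dot (ax D1) (D1 - D2) else 0) -
  cross_constant * ((if n - 2 < s then zx `^ (p / (p - 1)) else 0) +
    window_energy n s D1 + window_energy n t D2).
Proof.
have C0 := cross_constant_ge0.
have e1 := struct_energy_ge0 D1; have e2 := struct_energy_ge0 D2.
have x0 : 0 <= zx `^ (p / (p - 1)) by exact: powR_ge0.
have B0 : 0 <= cross_constant * ((if n - 2 < s then zx `^ (p / (p - 1)) else 0) +
    window_energy n s D1 + window_energy n t D2).
  by rewrite mulr_ge0// !addr_ge0 ?window_energy_ge0//; case: ifP.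
rewrite trunc_diff_gradE; have [sn1|ns1] := leP s (n + 1); last first.
  have -> : (s <= n) = false by apply/negbTE; rewrite -ltNge; lra.
  by rewrite dot0r /= sub0r oppr_le0.
have [tn|nt] := leP t n; last first.
  rewrite andbF dotZr sub0r; apply: (@le_trans _ _ 0); first by rewrite oppr_le0.
  by rewrite mulr_ge0// theta_ge0.
rewrite dotZr andbT; have [sn|ns] := leP s n; first by rewrite lerBlDr lerDl.
have [->|/theta_neq0 -/(_ ltr01) st] := eqVneq (theta 1 (s - t)) 0.
  by rewrite mul0r sub0r oppr_le0.
have th0 := @theta_ge0 1 (s - t) ltr01; have := theta_norm (s - t) (@ltr01 R); rewrite ger0_norm// => th1.
have cr := struct_cross D1 D2; move: B0.
have := ler_norm (s - t) => st'.
have w1 : n - 2 < s by lra.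
have w2 : n - 2 < t by lra.
have w3 : t <= n + 1 by lra.
rewrite !window_energyE// w1 w2 w3 sn1 /=.
move=> B0; rewrite dotBr sub0r.
apply: (@le_trans _ _ (- (theta 1 (s - t) * `|dot (ax D1) D2|))).
  by rewrite lerN2; apply: le_trans cr; rewrite ler_piMl.
rewrite mulrBr; have := ler_wpM2l th0 (ler_norm (dot (ax D1) D2)); have := mulr_ge0 th0 e1; lra.
Qed.

(** Once the gradients agree where [|s - t| <= 1], the gradient survives only for [t > n]. There it
    is [theta] times [D1] with [s] in the window, and [le_norm_powR] trades its norm for the
    energy. *)
Lemma trunc_diff_grad_bound (eps : R) i : 0 < eps -> (`|s - t| <= 1 -> D1 = D2) ->
  `|trunc_diff_grad n s t D1 D2 ord0 i| <= eps + eps `^ (1 - p) / alpha * window_energy n s D1.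
Proof.
move=> eps0 D12; have B0 : 0 <= eps + eps `^ (1 - p) / alpha * window_energy n s D1.
  by rewrite addr_ge0 ?(ltW eps0)// mulr_ge0 ?window_energy_ge0// divr_ge0 ?powR_ge0// ltW.
rewrite trunc_diff_gradE; have [sn1|ns1] := leP s (n + 1); last by rewrite mxE normr0.
have [tn|nt] := leP t n.
  suff -> : theta 1 (s - t) *: (D1 - D2) = 0 by rewrite mxE normr0.
  have [->|/theta_neq0 -/(_ ltr01) /D12 ->] := eqVneq (theta 1 (s - t)) 0.
    by rewrite scale0r.
  by rewrite subrr scaler0.
have [->|/theta_neq0 -/(_ ltr01) st] := eqVneq (theta 1 (s - n)) 0.
  by rewrite scale0r mxE normr0.
have := ler_norm (- (s - n)); rewrite normrN => st'.
rewrite window_energyE// sn1 (_ : n - 2 < s) /=; last by lra.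
rewrite mxE normrM; apply: (@le_trans _ _ (enorm D1)).
  apply: le_trans (coord_enorm_le D1 i); rewrite ler_piMl// theta_norm//.
have := le_norm_powR (enorm D1) (ltW p1) eps0; rewrite ger0_norm ?enorm_ge0//.
move=> /le_trans; apply; rewrite lerD2l -mulrA ler_wpM2l ?powR_ge0//.
by rewrite ler_pdivlMl// struct_coercive.
Qed.

End structure_conditions.

(** * Entropy solutions *)

Section integrability.
Context d {T : measurableType d} {R : realType} (mu : {measure set T -> \bar R}).
Variables (D : set T) (mD : measurable D).
Implicit Types (f g : T -> R).

Lemma ae_all (P : nat -> T -> Prop) : (forall n, {ae mu, forall x, P n x}) ->
  {ae mu, forall x, forall n, P n x}.
Proof.
move=> H; apply: (@negligibleS _ _ _ mu (\bigcup_n (~` [set x | P n x]))).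
  by move=> x /existsNP[n Hn]; exists n.
by apply: negligible_bigcup => n; exact: H.
Qed.

Lemma L1_powR_in_Lp f (q : R) : 0 < q -> measurable_fun D f ->
  L1 mu D (fun x => `|f x| `^ q) -> in_Lp mu D q f.
Proof.
move=> q0 mf If; split=> //; rewrite /finite_norm.
have h : ('N[mu]_(q%:E)[EFin \o (f \_ D)] `^ q < +oo)%E.
  rewrite Lnorm_restrict//; have [_] := integrableP _ _ _ If.
  rewrite (eq_integral (fun x => (`|f x| `^ q)%:E))// => x _ /=.
  by rewrite ger0_norm// powR_ge0.
move: h (Lnorm_ge0 mu q%:E (EFin \o (f \_ D))).
by case: ('N[mu]_ _ [_])%E => // [r|]; rewrite ?ltry// poweRyr ?gt_eqF.
Qed.

Lemma in_Lp_dom f g1 g2 (q : R) : 0 < q -> measurable_fun D f -> in_Lp mu D q g1 ->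
  in_Lp mu D q g2 -> (forall x, D x -> `|f x| <= `|g1 x| + `|g2 x|) -> in_Lp mu D q f.
Proof.
move=> q0 mf L1g L2g fg; have q0' := ltW q0; apply: L1_powR_in_Lp => //.
have I1 := in_Lp_powR q0 mD L1g; have I2 := in_Lp_powR q0 mD L2g.
apply: (@L1_le _ _ _ _ _ _ (fun x => 2 `^ q * (`|g1 x| `^ q + `|g2 x| `^ q))) => //.
- by apply: (measurableT_comp (measurable_powR q)); exact: measurableT_comp.
- move=> x Dx; rewrite ger0_norm ?powR_ge0//.
  set s := `|g1 x|; set t := `|g2 x|; pose m := Num.max s t.
  have s0 : 0 <= s by exact: normr_ge0.
  have t0 : 0 <= t by exact: normr_ge0.
  have m0 : 0 <= m by rewrite le_max s0.
  apply: (@le_trans _ _ ((2 * m) `^ q)).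
    rewrite ge0_ler_powR ?nnegrE ?mulr_ge0//; apply: le_trans (fg _ Dx) _.
    by rewrite mulr_natl mulr2n lerD// /m le_max lexx ?orbT.
  rewrite powRM// ler_wpM2l ?powR_ge0// /m /Num.max; case: ifP => _.
    by rewrite lerDr powR_ge0.
  by rewrite lerDl powR_ge0.
- by apply: L1Z => //; exact: L1D.
Qed.

Lemma bounded_in_Lp f (q B : R) : 0 < q -> (mu D < +oo)%E -> measurable_fun D f ->
  (forall x, D x -> `|f x| <= B) -> in_Lp mu D q f.
Proof.
move=> q0 Dfin mf fB; apply: L1_powR_in_Lp => //.
apply: (@L1_bounded _ _ _ _ _ _ (`|B| `^ q)) => //.
  by apply: (measurableT_comp (measurable_powR q)); exact: measurableT_comp.
move=> x Dx; rewrite ger0_norm ?powR_ge0// ge0_ler_powR ?nnegrE ?(ltW q0)//.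
by rewrite (le_trans (fB _ Dx))// ler_norm.
Qed.

Lemma L1_young (p : R) f g : 1 < p -> in_Lp mu D (p / (p - 1)) f -> in_Lp mu D p g ->
  L1 mu D (fun x => f x * g x).
Proof.
move=> p1 Lf Lg; have p0 : 0 < p by exact: lt_trans p1.
have q0 : 0 < p / (p - 1) by rewrite divr_gt0// subr_gt0.
have I1 := in_Lp_powR q0 mD Lf; have I2 := in_Lp_powR p0 mD Lg.
apply: (@L1_le _ _ _ _ _ _ (fun x => `|f x| `^ (p / (p - 1)) + `|g x| `^ p)) => //.
- by apply: measurable_funM; [case: Lf|case: Lg].
- by move=> x Dx; rewrite normrM; exact: young_conj.
- exact: L1D.
Qed.

(** For [phi = h (b y) * g y], which may be infinite: integrability makes it finite almost
    everywhere, so the entropy equation can be rewritten in the reals. *)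
Lemma fine_integral (phi : T -> \bar R) (t : T -> R) (M : R) : mu.-integrable D phi ->
  measurable_fun D t -> (forall x, `|t x| <= M) ->
  [/\ L1 mu D (fine \o phi), L1 mu D (fun x => fine (phi x) * t x) &
  (\int[mu]_(x in D) (phi x * (t x)%:E) = (\int[mu]_(x in D) (fine (phi x) * t x))%:E)%E].
Proof.
move=> Iphi mt tM; have aef := integrable_ae mD Iphi.
have mphi := measurable_int _ Iphi.
have mfine : measurable_fun D (fine \o phi) by exact: measurableT_comp.
have Ifine : L1 mu D (fine \o phi).
  have E : ae_eq mu D phi (EFin \o (fine \o phi)).
    by apply: ae_imp aef => x h Dx /=; rewrite fineK// h.
  apply/integrableP; split; first exact/measurable_EFinP.
  move/integrableP : Iphi => [_]; apply: le_lt_trans.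
  rewrite le_eqVlt; apply/orP; left; apply/eqP; apply: ae_eq_integral => //.
  - by apply: measurableT_comp => //; exact/measurable_EFinP.
  - exact: measurableT_comp.
  - by apply: ae_imp E => x h Dx; rewrite h.
have Ift : L1 mu D (fun x => fine (phi x) * t x).
  by under eq_fun do rewrite mulrC; apply: (L1_mul mD mt (fun x _ => tM x) Ifine).
split=> //; rewrite EFin_Rintegral//; apply: ae_eq_integral => //.
- by apply: emeasurable_funM => //; exact/measurable_EFinP.
- exact/measurable_EFinP/(L1_measurable mD Ift).
- by apply: ae_imp aef => x h Dx; rewrite EFinM fineK// h.
Qed.

Lemma Rint_cvg_mul f (ts : nat -> T -> R) t (M : R) : L1 mu D f ->
  (forall n, measurable_fun D (ts n)) -> (forall n x, `|ts n x| <= M) ->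
  (forall x, D x -> ts n x @[n --> \oo] --> t x) ->
  L1 mu D (fun x => f x * t x) /\
  \int[mu]_(x in D) (f x * ts n x) @[n --> \oo] --> \int[mu]_(x in D) (f x * t x).
Proof.
move=> If mts tsM cv; have mf := L1_measurable mD If.
have mt : measurable_fun D t by exact: (measurable_fun_cvg mts).
have [|||||A _ B] := @Rint_dominated _ _ _ mu D (fun n x => f x * ts n x) (fun x => f x * t x)
  (fun x => M * `|f x|) mD.
- by move=> n; exact: measurable_funM.
- exact: measurable_funM.
- by apply: aeW => x Dx; apply: cvgM; [exact: cvg_cst|exact: cv].
- by apply: L1Z => //; exact: L1_norm.
- by apply: aeW => x Dx n; rewrite normrM mulrC ler_wpM2r.
by split.
Qed.

End integrability.

Section sobolev_of_appr.
Context {R : realType} {N : nat}.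
Local Notation V := 'rV[R]_N.
Local Notation S := (lebesgue_space R N).
Local Notation mu := (leb R N).
Variables (Om : set V) (oO : open Om) (bO : bounded_set Om) (N0 : (0 < N)%N) (p : R) (p1 : 1 < p).
Implicit Types (E : set V) (v u tau b : V -> R) (W : V -> V).

Let mO : measurable (Om : set S) := measurable_open_om leb_half oO.
Let Ofin : (mu Om < +oo)%E := leb_bounded bO.
Let p0 : 0 < p. Proof. exact: lt_trans p1. Qed.

Lemma sobolev_of_appr E v W tau (B : R) (A1 A2 : V -> V) : appr Om E v W tau ->
  (forall x, Om x -> `|v x| <= B) ->
  (forall i, in_Lp mu Om p (fun x => A1 x ord0 i)) ->
  (forall i, in_Lp mu Om p (fun x => A2 x ord0 i)) ->
  (forall i x, Om x -> `|W x ord0 i| <= `|A1 x ord0 i| + `|A2 x ord0 i|) ->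
  sobolev_grad Om p v W.
Proof.
move=> av vB L1A L2A WA; have [Iv IW _] := av; split.
- exact: (bounded_in_Lp mO p0 Ofin (L1_measurable mO Iv) vB).
- by move=> i; exact: (in_Lp_dom mO p0 (L1_measurable mO (IW i)) (L1A i) (L2A i) (WA i)).
- by move=> i phi tphi; exact: (appr_ibp oO bO i av tphi).
Qed.

Lemma appr_ae E v W W' tau : measurable_field Om W' ->
  {ae mu, forall x, Om x -> forall i, W x ord0 i = W' x ord0 i} ->
  appr Om E v W tau -> appr Om E v W' tau.
Proof.
move=> mW' WW' [Iv IW ap].
have WWi i : {ae mu, forall x, Om x -> W x ord0 i = W' x ord0 i}.
  by apply: ae_imp WW' => x h Ox; exact: h.
have IW' i : L1 mu Om (fun x => W' x ord0 i) := L1_ae mO (mW' i) (WWi i) (IW i).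
split=> // e /ap[phi [sphi a1 b1 c1]]; exists phi; split=> // i.
apply: le_trans (b1 i); rewrite le_eqVlt; apply/orP; left; apply/eqP.
have Ip := smooth_L1 oO bO (@smooth_partial _ _ _ i sphi).
apply: (Rintegral_ae mO (L1_measurable mO (L1_norm (L1B mO Ip (IW' i))))
  (L1_measurable mO (L1_norm (L1B mO Ip (IW i))))).
by apply: ae_imp (WWi i) => x h Ox; rewrite h.
Qed.

(** Viewed as a truncation of [T_(k+1) u], [T_k u] has the weak gradient [theta k] times that of
    [T_(k+1) u]. On the level set it is [Du / 2], while [cut] gives [Du]; uniqueness makes them
    equal. *)
Lemma level_null u (Du : V -> V) b (k : R) : truncated_grad Om p u Du ->
  boundary_value Om p u b -> 0 < k -> {ae mu, forall x, Om x -> `|u x| = k -> Du x = 0}.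
Proof.
move=> [mDu tg] [_ bv] k0; have k10 : 0 < k + 1 by rewrite addr_gt0.
have av := appr_trunc oO bO k0 (appr_trace oO bO N0 p1 (tg _ k10) (bv _ k10)).
have TT x : trunc k (trunc (k + 1) (u x)) = trunc k (u x).
  rewrite !truncE ?(ltW k0) ?(ltW k10)//.
  by case: (ltP (u x) (- (k + 1))) => h1; case: (ltP (k + 1) (u x)) => h2;
    repeat (let h := fresh in case: ifPn; rewrite -?leNgt; move=> h); lra.
have [_ LD _] := tg _ k10.
have gk : sobolev_grad Om p (trunc k \o u)
    (fun x => theta k (trunc (k + 1) (u x)) *: cut (k + 1) u Du x).
  rewrite (_ : trunc k \o u = trunc k \o (trunc (k + 1) \o u)); last first.
    by apply/funext => x /=; rewrite TT.
  apply: (sobolev_of_appr (B := k) (A1 := cut (k + 1) u Du) (A2 := cut (k + 1) u Du) av) => //.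
  - by move=> x _; rewrite /= trunc_norm// ltW.
  - move=> i x _; rewrite mxE normrM; apply: (@le_trans _ _ `|cut (k + 1) u Du x ord0 i|).
      by rewrite ler_piMl// theta_norm.
    by rewrite lerDl.
apply: ae_imp (weak_grad_unique oO bO N0 (ltW p1) (tg _ k0) gk) => x h Ox uk.
apply/rowP => i; have := h Ox i; rewrite mxE /cut uk lexx lerDl ler01 trunc_id; last by rewrite uk lerDl.
by rewrite thetaE// uk ltxx eqxx mxE; lra.
Qed.

End sobolev_of_appr.

Section truncation_limits.
Context {R : realType}.
Implicit Types k m s : R.

Lemma trunc_sub k m s : 0 <= k -> 0 <= m -> trunc k (s - trunc m s) = trunc (m + k) s - trunc m s.
Proof.
move=> k0 m0; rewrite (truncE (k := k))// !truncE ?addr_ge0//.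
case: (ltP s (- m)) => h1; case: (ltP m s) => h2; case: (ltP s (- (m + k))) => h3;
  case: (ltP (m + k) s) => h4; repeat (let h := fresh in case: ifPn; rewrite -?leNgt; move=> h); lra.
Qed.

Lemma near_natr_ge s : \forall m \near \oo, s <= m%:R.
Proof.
near=> m; apply: le_trans (ler_norm s) _; apply: le_trans (ltW (archi_boundP (normr_ge0 s))) _.
by rewrite ler_nat; near: m; exact: nbhs_infty_ge.
Unshelve. all: by end_near. Qed.

Lemma trunc_tail_cvg0 (c : nat) k s : 0 <= k -> trunc k (s - trunc (m + c)%:R s) @[m --> \oo] --> (0 : R).
Proof.
move=> k0; apply/cvgrPdist_le => e e0; apply: filterS (near_natr_ge `|s|) => m sm.
rewrite (trunc_id (k := (m + c)%:R)); last by rewrite (le_trans sm)// ler_nat leq_addr.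
by rewrite subrr trunc_id ?normr0// subrr normr0 ltW.
Qed.

End truncation_limits.

(** * The entropy equation of one solution *)

Section one_solution.
Context {R : realType} {N : nat}.
Local Notation V := 'rV[R]_N.
Local Notation S := (lebesgue_space R N).
Local Notation mu := (leb R N).
Local Notation nu := (surf R N).
Variables (Om : set V) (oO : open Om) (bO : bounded_set Om) (N0 : (0 < N)%N) (p : R) (p1 : 1 < p).
Variables (a : V -> V -> V) (lambda : V -> R) (sigma : R -> R) (h : R -> \bar R) (f g : V -> R).
Implicit Types (u v tau b : V -> R) (Du W G : V -> V).

Let mO : measurable (Om : set S) := measurable_open_om leb_half oO.
Let mB : measurable (boundary Om : set (hausdorff_space R N N.-1)) := measurable_boundary _ Om.
Let p0 : 0 < p. Proof. exact: lt_trans p1. Qed.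

Hypothesis fL1 : in_Lp mu Om 1 f.

Definition entropy_data u Du b := [/\ truncated_grad Om p u Du /\ boundary_value Om p u b,
  forall k, 0 < k -> forall i, in_Lp mu Om (p / (p - 1)) (fun x => a x (cut k u Du x) ord0 i),
  nu.-integrable (boundary Om) (fun x => (lambda x * sigma (b x))%:E),
  nu.-integrable (boundary Om) (fun x => h (b x) * (g x)%:E)%E &
  forall v tau k G, sobolev Om p v -> ess_bounded Om v -> is_trace Om p v tau -> 0 < k ->
    sobolev_grad Om p (fun x => trunc k (u x - v x)) G ->
    (\int[mu]_(x in Om) (dot (a x (Du x)) (G x))%:E +
     \int[nu]_(x in boundary Om) (lambda x * sigma (b x) * trunc k (b x - tau x))%:E =
     \int[mu]_(x in Om) (f x * trunc k (u x - v x))%:E +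
     \int[nu]_(x in boundary Om) (h (b x) * (g x)%:E * (trunc k (b x - tau x))%:E))%E].

Definition absorbed b x := lambda x * sigma (b x).
Definition emitted b x := fine (h (b x) * (g x)%:E)%E.

Let If : L1 mu Om f := in_Lp_L1 (lexx 1) mO (leb_bounded bO) fL1.

(** Integrability of [a x (Du x)] is known only after cutting; on the set where [W] may be nonzero
    the cut changes nothing. *)
Lemma L1_dot_cut u Du b k W : entropy_data u Du b -> 0 < k ->
  (forall i, in_Lp mu Om p (fun x => W x ord0 i)) -> (forall x, k < `|u x| -> W x = 0) ->
  L1 mu Om (fun x => dot (a x (Du x)) (W x)).
Proof.
move=> [_ aL _ _ _] k0 LW W0.
rewrite (_ : (fun x => _) = (fun x => \sum_(i < N) a x (cut k u Du x) ord0 i * W x ord0 i)).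
  apply: (L1_sum (I := 'I_N)) => // i.
  exact: (L1_young mO p1 (aL k k0 i) (LW i)).
apply/funext => x; rewrite /dot /cut; case: ifPn => // uk.
have -> : W x = 0 by apply: W0; rewrite ltNge.
by rewrite !big1// => i _; rewrite mxE mulr0.
Qed.

Lemma emitted_L1 u Du b : entropy_data u Du b -> L1 nu (boundary Om) (emitted b).
Proof.
move=> [_ _ _ HI _].
have m0 : measurable_fun (boundary Om : set (hausdorff_space R N N.-1)) (fun=> 0 : R) by [].
have b0 (x : hausdorff_space R N N.-1) : `|0 : R| <= 0 by rewrite normr0.
by have [] := fine_integral mB HI m0 b0.
Qed.

Lemma entropy_real u Du b v tau k G : measurable_fun (Om : set S) u -> entropy_data u Du b ->
  measurable_fun (Om : set S) v ->
  sobolev Om p v -> ess_bounded Om v -> is_trace Om p v tau -> 0 < k ->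
  sobolev_grad Om p (fun x => trunc k (u x - v x)) G ->
  L1 mu Om (fun x => dot (a x (Du x)) (G x)) ->
  \int[mu]_(x in Om) dot (a x (Du x)) (G x) =
  \int[mu]_(x in Om) (f x * trunc k (u x - v x)) +
  \int[nu]_(x in boundary Om) (emitted b x * trunc k (b x - tau x)) -
  \int[nu]_(x in boundary Om) (absorbed b x * trunc k (b x - tau x)).
Proof.
move=> mu_u [[_ [mb _]] _ FI HI eqn] mv sv ev tv k0 gG IG.
have k0' := ltW k0; have [[mtau _] _] := tv.
have mT : measurable_fun (boundary Om : set (hausdorff_space R N N.-1)) (fun x => trunc k (b x - tau x)).
  exact: (measurable_comp_continuous (trunc_continuous k0') (measurable_funB mb mtau)).
have mTu : measurable_fun (Om : set S) (fun x => trunc k (u x - v x)).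
  exact: (measurable_comp_continuous (trunc_continuous k0') (measurable_funB mu_u mv)).
have Tk (s : R) : `|trunc k s| <= k by exact: trunc_norm.
have [_ I1 E1] := fine_integral mB HI mT (fun x => Tk (b x - tau x)).
have I2 : L1 nu (boundary Om) (fun x => absorbed b x * trunc k (b x - tau x)).
  under eq_fun do rewrite mulrC.
  exact: (L1_mul mB mT (fun x _ => Tk (b x - tau x)) FI).
have I3 : L1 mu Om (fun x => f x * trunc k (u x - v x)).
  under eq_fun do rewrite mulrC.
  exact: (L1_mul mO mTu (fun x _ => Tk (u x - v x)) If).
have := eqn v tau k G sv ev tv k0 gG; rewrite E1.
rewrite -(EFin_Rintegral mO IG) -(EFin_Rintegral mO I3) -(EFin_Rintegral mB I2) -!EFinD => -[].
by rewrite /emitted /absorbed; lra.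
Qed.

Lemma trunc_test u Du b k : entropy_data u Du b -> 0 < k -> measurable_fun (Om : set S) u ->
  [/\ measurable_fun (Om : set S) (trunc k \o u), sobolev Om p (trunc k \o u),
      ess_bounded Om (trunc k \o u) & is_trace Om p (trunc k \o u) (trunc k \o b)].
Proof.
move=> [[[_ tg] [_ bv]] _ _ _ _] k0 mu_u.
have mt := measurable_comp_continuous (trunc_continuous (ltW k0)) mu_u.
split; [exact: mt|by exists (cut k u Du); exact: tg| |exact: bv].
  by split; [exact: mt|exists k; apply: aeW => x _; exact: trunc_norm (ltW k0)].
Qed.

Lemma energy_window_L1 u Du b (n : R) : entropy_data u Du b -> 2 < n ->
  L1 mu Om (fun x => window_energy (a x) n (u x) (Du x)).
Proof.
move=> ed n2; have [[[_ tg] _] _ _ _ _] := ed.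
have n10 : 0 < n + 1 by exact: addr_gt0 (lt_trans (ltr0n _ 2) n2) ltr01.
have n20 : 0 < n - 2 by rewrite subr_gt0.
have [_ La _] := tg _ n10.
have [_ Lb _] := tg _ n20.
pose W x := cut (n + 1) u Du x - cut (n - 2) u Du x.
have WE i : (fun x => W x ord0 i) = (fun x => cut (n + 1) u Du x ord0 i - cut (n - 2) u Du x ord0 i).
  by apply/funext => x; rewrite !mxE.
have LW i : in_Lp mu Om p (fun x => W x ord0 i).
  apply: (in_Lp_dom mO p0 _ (La i) (Lb i)).
    by rewrite WE; apply: measurable_funB; [case: (La i)|case: (Lb i)].
  by move=> x _; rewrite !mxE; exact: ler_normB.
have W0 x : n + 1 < `|u x| -> W x = 0.
  move=> nu'; rewrite /W /cut !ifN ?subrr//; rewrite -ltNge//.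
  by apply: lt_trans nu'; rewrite ltrD2l; apply: lt_trans ltr01; rewrite oppr_lt0.
exact: (L1_dot_cut ed n10 LW W0).
Qed.

(** The test function is [T_(n-2) u], and [k = 3] is the width of the window from [n - 2] to
    [n + 1]. *)
Lemma energy_window_int u Du b (n : R) : measurable_fun (Om : set S) u -> entropy_data u Du b -> 2 < n ->
  \int[mu]_(x in Om) window_energy (a x) n (u x) (Du x) =
  \int[mu]_(x in Om) (f x * trunc 3 (u x - trunc (n - 2) (u x))) +
  \int[nu]_(x in boundary Om) (emitted b x * trunc 3 (b x - trunc (n - 2) (b x))) -
  \int[nu]_(x in boundary Om) (absorbed b x * trunc 3 (b x - trunc (n - 2) (b x))).
Proof.
move=> mu_u ed n2; have [[[_ tg] [_ bv]] _ _ _ _] := ed.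
have n10 : 0 < n + 1 by exact: addr_gt0 (lt_trans (ltr0n _ 2) n2) ltr01.
have n20 : 0 < n - 2 by rewrite subr_gt0.
have [mv sv ev tv] := trunc_test ed n20 mu_u.
have n20' := ltW n20.
have E3 x : trunc 3 (u x - trunc (n - 2) (u x)) = trunc (n + 1) (u x) - trunc (n - 2) (u x).
  by rewrite trunc_sub//; congr (trunc _ _ - _); lra.
have IG := energy_window_L1 ed n2.
pose W x := cut (n + 1) u Du x - cut (n - 2) u Du x.
have av := appr_sub oO bO (appr_trace oO bO N0 p1 (tg _ n10) (bv _ n10)) (appr_trace oO bO N0 p1 (tg _ n20) (bv _ n20)).
have [_ La _] := tg _ n10.
have [_ Lb _] := tg _ n20.
have gG : sobolev_grad Om p (fun x => trunc 3 (u x - (trunc (n - 2) \o u) x)) W.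
  rewrite (_ : (fun x => trunc 3 _) = (fun x => (trunc (n + 1) \o u) x - (trunc (n - 2) \o u) x)); last first.
    by apply/funext => x; exact: E3.
  apply: (sobolev_of_appr oO bO p1 (B := 3) av _ La Lb).
  - by move=> x _; rewrite /= -E3; exact: trunc_norm (ler0n _ 3).
  - by move=> i x _; rewrite !mxE; exact: ler_normB.
exact: (entropy_real mu_u ed mv sv ev tv (ltr0n _ 3) gG IG).
Qed.

Lemma energy_window_cvg u Du b : measurable_fun (Om : set S) u -> entropy_data u Du b ->
  \int[mu]_(x in Om) window_energy (a x) m.+3%:R (u x) (Du x) @[m --> \oo] --> (0 : R).
Proof.
move=> mu_u ed; have [[_ [mb _]] _ FI _ _] := ed; have IH := emitted_L1 ed.
(* With [n = m + 3] the lower end [n - 2 = m + 1] is positive for all [m], as a truncation level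
   must be. *)
have m2 m : 2 < m.+3%:R :> R by rewrite ltr_nat.
have mE m : m.+3%:R - 2 = (m + 1)%:R :> R by rewrite -natrB// addn1.
have m0 m : 0 <= (m + 1)%:R :> R by [].
have T0 (s : R) := trunc_tail_cvg0 1 s (ler0n R 3).
have lim d (T : measurableType d) (rho : {measure set T -> \bar R}) (D : set T) (mD : measurable D)
    (F w : T -> R) : L1 rho D F -> measurable_fun D w ->
    \int[rho]_(x in D) (F x * trunc 3 (w x - trunc (m + 1)%:R (w x))) @[m --> \oo] --> (0 : R).
  move=> IF mw.
  have c3 := @trunc_continuous R 3 (ler0n _ 3).
  have mt m : measurable_fun D (fun x => trunc 3 (w x - trunc (m + 1)%:R (w x))).
    apply: (measurable_comp_continuous c3); apply: measurable_funB => //.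
    exact: (measurable_comp_continuous (trunc_continuous (m0 m)) mw).
  have b3 m x : `|trunc 3 (w x - trunc (m + 1)%:R (w x))| <= 3 by exact: trunc_norm.
  have [_] := Rint_cvg_mul mD IF mt b3 (fun x _ => T0 (w x)).
  by under [in X in _ --> X -> _]eq_Rintegral do rewrite mulr0; rewrite /Rintegral integral0.
have l1 := lim _ _ _ _ mO f u If mu_u.
have l2 := lim _ _ _ _ mB _ b IH mb.
have l3 := lim _ _ _ _ mB _ b FI mb.
have -> : (fun m : nat => \int[mu]_(x in Om) window_energy (a x) m.+3%:R (u x) (Du x)) = (fun m =>
    \int[mu]_(x in Om) (f x * trunc 3 (u x - trunc (m + 1)%:R (u x))) +
    \int[nu]_(x in boundary Om) (emitted b x * trunc 3 (b x - trunc (m + 1)%:R (b x))) -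
    \int[nu]_(x in boundary Om) (absorbed b x * trunc 3 (b x - trunc (m + 1)%:R (b x)))).
  by apply/funext => m; rewrite (energy_window_int mu_u ed (m2 m)) mE.
rewrite [X in _ --> X](_ : 0 = 0 + 0 - 0); last by rewrite subr0 addr0.
by apply: cvgB; [apply: cvgD|].
Qed.

End one_solution.

Lemma measurable_cutoff d (T : measurableType d) (R : realType) (D : set T) (k : R) (u w : T -> R) :
  measurable D -> measurable_fun D u -> measurable_fun D w ->
  measurable_fun D (fun x => if `|u x| <= k then w x else 0).
Proof.
move=> mD mu mw; have mnu : measurable_fun D (fun x => `|u x|) by exact: measurableT_comp.
apply: measurable_fun_if => //.
- exact: measurable_fun_ler.
- by apply: measurable_funS mw => //; exact: subIsetl.
Qed.

(** Beyond [n + 1] in absolute value both sides are saturated, as [|T_n t| <= n]. Thus [u1], which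
    has no Sobolev regularity of its own, may be replaced by [T_(n+1) u1]. *)
Lemma trunc_trunc_sub (R : realType) (n s t : R) : 0 <= n ->
  trunc 1 (trunc (n + 1) s - trunc n t) = trunc 1 (s - trunc n t).
Proof.
move=> n0; have := trunc_norm t n0; rewrite ler_norml => /andP[].
move: (trunc n t) => w w1 w2; have n1 : 0 <= n + 1 by rewrite addr_ge0.
rewrite (truncE _ (@ler01 R)) (truncE _ n1) (truncE _ (@ler01 R)).
case: (ltP s (- (n + 1))) => h1; case: (ltP (n + 1) s) => h2;
  repeat (let h := fresh in case: ifPn; rewrite -?leNgt; move=> h); lra.
Qed.

(** * Testing one solution with truncations of the other *)

Section two_solutions.
Context {R : realType} {N : nat}.
Local Notation V := 'rV[R]_N.
Local Notation S := (lebesgue_space R N).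
Local Notation mu := (leb R N).
Local Notation nu := (surf R N).
Variables (Om : set V) (oO : open Om) (bO : bounded_set Om) (N0 : (0 < N)%N) (p : R) (p1 : 1 < p).
Variables (a : V -> V -> V) (lambda : V -> R) (sigma : R -> R) (h : R -> \bar R) (f g : V -> R).
Implicit Types (u v tau b : V -> R) (Du W G : V -> V).

Let mO : measurable (Om : set S) := measurable_open_om leb_half oO.
Let mB : measurable (boundary Om : set (hausdorff_space R N N.-1)) := measurable_boundary _ Om.
Let p0 : 0 < p. Proof. exact: lt_trans p1. Qed.

Hypothesis fL1 : in_Lp mu Om 1 f.
Let If : L1 mu Om f := in_Lp_L1 (lexx 1) mO (leb_bounded bO) fL1.

Definition solution u Du b := [/\ measurable_fun (Om : set S) u,
  {ae mu, forall x, Om x -> 0 <= u x} & entropy_data Om p a lambda sigma h f g u Du b].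

Definition gradient n u1 Du1 u2 Du2 x : V := trunc_diff_grad n (u1 x) (u2 x) (Du1 x) (Du2 x).

Lemma gradient_dom n u1 Du1 u2 Du2 i x : 0 < n -> `|gradient n u1 Du1 u2 Du2 x ord0 i| <=
  `|cut (n + 1) u1 Du1 x ord0 i| + `|cut n u2 Du2 x ord0 i|.
Proof.
move=> n0; rewrite /gradient /trunc_diff_grad; case: ifPn => _; last by rewrite mxE normr0 addr_ge0.
rewrite !mxE normrM; apply: le_trans (ler_normB _ _); rewrite ler_piMl// theta_norm//.
Qed.

Lemma trunc_diff_appr n u1 Du1 b1 u2 Du2 b2 : 0 < n -> solution u1 Du1 b1 -> solution u2 Du2 b2 ->
  appr Om (boundary Om) (fun x => trunc 1 (u1 x - trunc n (u2 x)))
    (gradient n u1 Du1 u2 Du2) (fun y => trunc 1 (b1 y - trunc n (b2 y))).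
Proof.
move=> n0 [mu1 u10 [[tg1 bv1] _ _ _ _]] [mu2 u20 [[tg2 bv2] _ _ _ _]].
have n10 : 0 < n + 1 by rewrite addr_gt0.
have n0' := ltW n0.
have [[_ g1] [_ v1]] := (tg1, bv1); have [[_ g2] [_ v2]] := (tg2, bv2).
have av := appr_trunc oO bO (@ltr01 R) (appr_sub oO bO (appr_trace oO bO N0 p1 (g1 _ n10) (v1 _ n10))
  (appr_trace oO bO N0 p1 (g2 _ n0) (v2 _ n0))).
have [_ La _] := g1 _ n10; have [_ Lb _] := g2 _ n0.
have mW i : measurable_fun (Om : set S) (fun x => gradient n u1 Du1 u2 Du2 x ord0 i).
  have mt1 := measurable_comp_continuous (trunc_continuous (ltW n10)) mu1.
  have mt2 := measurable_comp_continuous (trunc_continuous n0') mu2.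
  have mth := measurable_theta 1 (measurable_funB mt1 mt2).
  have mc := measurable_funB (proj1 (La i)) (proj1 (Lb i)).
  rewrite (_ : (fun x => _) = (fun x => if `|u1 x| <= n + 1 then
      theta 1 (trunc (n + 1) (u1 x) - trunc n (u2 x)) *
      (cut (n + 1) u1 Du1 x ord0 i - cut n u2 Du2 x ord0 i) else 0)).
    exact: (measurable_cutoff _ mO mu1 (measurable_funM mth mc)).
  by apply/funext => x; rewrite /gradient /trunc_diff_grad; case: ifP => _; rewrite !mxE.
(* For [u1 > n + 1] the chain rule gives a multiple of [Du2], where [gradient] is 0 by definition.
   The factor [theta] is nonzero only if [T_n u2 = n], the cut only if [u2 <= n]: this leaves the
   level set [u2 = n], where [Du2 = 0]. *)
have lv := level_null oO bO N0 p1 tg2 bv2 n0.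
have : {ae mu, forall x, Om x -> forall i,
    (theta 1 (trunc (n + 1) (u1 x) - trunc n (u2 x)) *: (cut (n + 1) u1 Du1 x - cut n u2 Du2 x)) ord0 i =
    gradient n u1 Du1 u2 Du2 x ord0 i}.
  apply: ae_imp3 u10 u20 lv => x x10 x20 xl Ox i.
  have {x10}s0 := x10 Ox; have {x20}t0 := x20 Ox; have {}xl := xl Ox.
  rewrite /gradient /trunc_diff_grad; case: ifPn => // sn1; rewrite !mxE.
  rewrite -ltNge (ger0_norm s0) in sn1.
  rewrite (trunc_gt (ltW n10) sn1).
  have [->|/theta_neq0 -/(_ ltr01) th] := eqVneq (theta 1 (n + 1 - trunc n (u2 x))) 0; first exact: mul0r.
  rewrite /cut ifN -?ltNge ?(ger0_norm s0)// (ger0_norm t0) mxE sub0r.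
  case: ifPn => [tn|_]; last by rewrite mxE oppr0 mulr0.
  rewrite xl ?mxE ?oppr0 ?mulr0// ger0_norm//; apply/eqP; rewrite eq_le tn/=.
  by rewrite trunc_id ?ger0_norm// in th; have := ler_norm (n + 1 - u2 x); lra.
move=> WG; have := appr_ae oO bO mW WG av; apply: appr_eq => //.
- by move=> x /=; rewrite trunc_trunc_sub.
- by move=> x _ /=; rewrite trunc_trunc_sub.
Qed.

Lemma gradient_sobolev n u1 Du1 b1 u2 Du2 b2 : 0 < n -> solution u1 Du1 b1 -> solution u2 Du2 b2 ->
  sobolev_grad Om p (fun x => trunc 1 (u1 x - trunc n (u2 x))) (gradient n u1 Du1 u2 Du2).
Proof.
move=> n0 s1 s2; have av := trunc_diff_appr n0 s1 s2.
have n10 : 0 < n + 1 by rewrite addr_gt0.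
have [_ _ [[[_ g1] _] _ _ _ _]] := s1; have [_ _ [[[_ g2] _] _ _ _ _]] := s2.
have [_ La _] := g1 _ n10; have [_ Lb _] := g2 _ n0.
apply: (sobolev_of_appr oO bO p1 (B := 1) av _ La Lb).
- by move=> x _; exact: trunc_norm (@ler01 R).
- by move=> i x _; exact: gradient_dom.
Qed.

Lemma flux_L1 n u1 Du1 b1 u2 Du2 b2 : 0 < n -> solution u1 Du1 b1 -> solution u2 Du2 b2 ->
  L1 mu Om (fun x => dot (a x (Du1 x)) (gradient n u1 Du1 u2 Du2 x)).
Proof.
move=> n0 s1 s2; have [_ _ ed1] := s1; have n10 : 0 < n + 1 by rewrite addr_gt0.
have [_ LG _] := gradient_sobolev n0 s1 s2.
apply: (L1_dot_cut oO p1 ed1 n10 LG) => x nx.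
by rewrite /gradient /trunc_diff_grad ifN// -ltNge.
Qed.

Let trunc1_cvg (s t : R) : trunc 1 (s - trunc (m + 3)%:R t) @[m --> \oo] --> trunc 1 (s - t).
Proof.
apply/cvgrPdist_le => e e0; apply: filterS (near_natr_ge `|t|) => m tm.
rewrite (trunc_id (k := (m + 3)%:R)); last by rewrite (le_trans tm)// ler_nat leq_addr.
by rewrite subrr normr0 ltW.
Qed.

Let trunc1_lim d (T : measurableType d) (rho : {measure set T -> \bar R}) (D : set T)
    (F w1 w2 : T -> R) : measurable D -> L1 rho D F -> measurable_fun D w1 -> measurable_fun D w2 ->
  L1 rho D (fun x => F x * trunc 1 (w1 x - w2 x)) /\
  \int[rho]_(x in D) (F x * trunc 1 (w1 x - trunc (m + 3)%:R (w2 x))) @[m --> \oo] -->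
  \int[rho]_(x in D) (F x * trunc 1 (w1 x - w2 x)).
Proof.
move=> mD IF m1 m2; have c1 := @trunc_continuous R 1 ler01.
apply: (Rint_cvg_mul (M := 1) mD IF).
- move=> m; apply: (measurable_comp_continuous c1); apply: measurable_funB => //.
  exact: (measurable_comp_continuous (trunc_continuous (ler0n _ _)) m2).
- by move=> m x; exact: trunc_norm ler01.
- by move=> x _; exact: trunc1_cvg.
Qed.

Lemma flux_cvg u1 Du1 b1 u2 Du2 b2 : solution u1 Du1 b1 -> solution u2 Du2 b2 ->
  \int[mu]_(x in Om) dot (a x (Du1 x)) (gradient (m + 3)%:R u1 Du1 u2 Du2 x) @[m --> \oo] -->
  \int[mu]_(x in Om) (f x * trunc 1 (u1 x - u2 x)) +
  \int[nu]_(x in boundary Om) (emitted h g b1 x * trunc 1 (b1 x - b2 x)) -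
  \int[nu]_(x in boundary Om) (absorbed lambda sigma b1 x * trunc 1 (b1 x - b2 x)).
Proof.
move=> s1 s2; have [mu1 _ ed1] := s1; have [mu2 _ ed2] := s2.
have [[_ [mb1 _]] _ FI _ _] := ed1; have [[_ [mb2 _]] _ _ _ _] := ed2.
have IH := emitted_L1 ed1.
have n0 m : 0 < (m + 3)%:R :> R by rewrite ltr0n addn3.
have -> : (fun m : nat => \int[mu]_(x in Om) dot (a x (Du1 x)) (gradient (m + 3)%:R u1 Du1 u2 Du2 x)) =
  (fun m : nat => \int[mu]_(x in Om) (f x * trunc 1 (u1 x - trunc (m + 3)%:R (u2 x))) +
  \int[nu]_(x in boundary Om) (emitted h g b1 x * trunc 1 (b1 x - trunc (m + 3)%:R (b2 x))) -
  \int[nu]_(x in boundary Om) (absorbed lambda sigma b1 x * trunc 1 (b1 x - trunc (m + 3)%:R (b2 x)))).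
  apply/funext => m; have [mv sv ev tv] := trunc_test ed2 (n0 m) mu2.
  exact: (entropy_real oO bO fL1 mu1 ed1 mv sv ev tv (@ltr01 R) (gradient_sobolev (n0 m) s1 s2) (flux_L1 (n0 m) s1 s2)).
have [_ l1] := trunc1_lim mO If mu1 mu2.
have [_ l2] := trunc1_lim mB IH mb1 mb2.
have [_ l3] := trunc1_lim mB FI mb1 mb2.
by apply: cvgB; [apply: cvgD|].
Qed.

End two_solutions.

Lemma measurable_gt_indic d (T : measurableType d) (R : realType) (D : set T) (c : R) (u : T -> R) :
  measurable D -> measurable_fun D u ->
  measurable_fun D (fun x => if c < u x then 1 else 0 : R).
Proof.
move=> mD mu; apply: measurable_fun_if => //.
by apply: measurable_fun_ltr.
Qed.

Lemma Rint_ge0_ae d (T : measurableType d) (R : realType) (rho : {measure set T -> \bar R}) (D : set T)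
    (F : T -> R) : measurable D -> L1 rho D F -> {ae rho, forall x, D x -> 0 <= F x} ->
  0 <= \int[rho]_(x in D) F x.
Proof.
move=> mD IF F0; have F0' : {ae rho, forall x, D x -> 0 * F x <= F x}.
  by apply: ae_imp F0 => x F0 Dx; rewrite mul0r F0.
by have := ae_le_Rintegral mD (L1Z 0 mD IF) IF F0'; rewrite RintegralZl// mul0r.
Qed.

Lemma trunc1_gt0 (R : realType) (s : R) : 0 < s -> 0 < trunc 1 s.
Proof. by move=> s0; rewrite truncE//; case: ifPn => [|_]; [lra|case: ifPn => _ //; lra]. Qed.

Lemma trunc1_lt0 (R : realType) (s : R) : s < 0 -> trunc 1 s < 0.
Proof. by move=> s0; rewrite truncE//; case: ifPn => h1; [lra|case: ifPn => h2; lra]. Qed.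

Lemma trunc1_opp (R : realType) (s : R) : trunc 1 (- s) = - trunc 1 s.
Proof.
rewrite !truncE//; repeat (let h := fresh in case: ifPn; rewrite -?leNgt; move=> h); lra.
Qed.

(** * Adding the two equations *)

Section comparison.
Context {R : realType} {N : nat}.
Local Notation V := 'rV[R]_N.
Local Notation S := (lebesgue_space R N).
Local Notation mu := (leb R N).
Local Notation nu := (surf R N).
Variables (Om : set V) (oO : open Om) (bO : bounded_set Om) (N0 : (0 < N)%N) (p : R) (p1 : 1 < p).
Variables (a : V -> V -> V) (alpha beta : R) (z lambda : V -> R) (sigma : R -> R) (h : R -> \bar R) (f g : V -> R).
Implicit Types (u v tau b : V -> R) (Du W G : V -> V).

Let mO : measurable (Om : set S) := measurable_open_om leb_half oO.
Let mB : measurable (boundary Om : set (hausdorff_space R N N.-1)) := measurable_boundary _ Om.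
Let p0 : 0 < p. Proof. exact: lt_trans p1. Qed.

Hypotheses (alpha0 : 0 < alpha) (beta0 : 0 < beta).
Hypothesis z_ge0 : {ae mu, forall x, Om x -> 0 <= z x}.
Hypothesis z_Lp : in_Lp mu Om (p / (p - 1)) z.
Hypothesis a_struct : {ae mu, forall x, Om x -> forall xi xi' : V, xi != xi' ->
    [/\ alpha * enorm xi `^ p <= dot (a x xi) xi,
        enorm (a x xi) <= beta * (z x + enorm xi `^ (p - 1)) &
        0 < dot (a x xi - a x xi') (xi - xi')]}.
Hypothesis fL1 : in_Lp mu Om 1 f.

Local Notation sol := (solution Om p a lambda sigma h f g).
Variables (u1 : V -> R) (Du1 : V -> V) (b1 u2 : V -> R) (Du2 : V -> V) (b2 : V -> R).
Hypotheses (s1 : sol u1 Du1 b1) (s2 : sol u2 Du2 b2).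

Let C0 := cross_constant (N := N) alpha beta.
Let n m : R := (m + 3)%:R.

Let n0 m : 0 < n m. Proof. by rewrite ltr0n addn3. Qed.
Let n2 m : 2 < n m. Proof. by rewrite ltr_nat addn3. Qed.

Definition paired_flux m x : R := if (`|u1 x| <= n m) && (`|u2 x| <= n m) then
  theta 1 (u1 x - u2 x) * dot (a x (Du1 x) - a x (Du2 x)) (Du1 x - Du2 x) else 0.

Let mu1 : measurable_fun (Om : set S) u1. Proof. by case: s1. Qed.
Let mu2 : measurable_fun (Om : set S) u2. Proof. by case: s2. Qed.

Lemma paired_flux_L1 m : L1 mu Om (paired_flux m).
Proof.
have [_ _ [[[_ g1] _] aL1 _ _ _]] := s1; have [_ _ [[[_ g2] _] aL2 _ _ _]] := s2.
have [_ L1' _] := g1 _ (n0 m); have [_ L2' _] := g2 _ (n0 m).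
have q0 : 0 < p / (p - 1) by rewrite divr_gt0// subr_gt0.
pose A i x := a x (cut (n m) u1 Du1 x) ord0 i - a x (cut (n m) u2 Du2 x) ord0 i.
pose B i x := cut (n m) u1 Du1 x ord0 i - cut (n m) u2 Du2 x ord0 i.
have LA i : in_Lp mu Om (p / (p - 1)) (A i).
  apply: (in_Lp_dom mO q0 _ (aL1 _ (n0 m) i) (aL2 _ (n0 m) i)).
    exact: measurable_funB (proj1 (aL1 _ (n0 m) i)) (proj1 (aL2 _ (n0 m) i)).
  by move=> x _; exact: ler_normB.
have LB i : in_Lp mu Om p (B i).
  apply: (in_Lp_dom mO p0 _ (L1' i) (L2' i)).
    exact: measurable_funB (proj1 (L1' i)) (proj1 (L2' i)).
  by move=> x _; exact: ler_normB.
have IAB : L1 mu Om (fun x => \sum_(i < N) A i x * B i x).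
  by apply: (L1_sum (I := 'I_N)) => // i; exact: (L1_young mO p1 (LA i) (LB i)).
pose th x : R := if `|u1 x| <= n m then if `|u2 x| <= n m then theta 1 (u1 x - u2 x) else 0 else 0.
have mth : measurable_fun (Om : set S) th.
  exact: (measurable_cutoff _ mO mu1 (measurable_cutoff _ mO mu2 (measurable_theta 1 (measurable_funB mu1 mu2)))).
have th1 x : Om x -> `|th x| <= 1.
  move=> _; rewrite /th; case: ifP => _; last by rewrite normr0.
  by case: ifP => _; [exact: theta_norm|rewrite normr0].
rewrite (_ : paired_flux m = (fun x => th x * \sum_(i < N) A i x * B i x)).
  exact: (L1_mul mO mth th1 IAB).
apply/funext => x; rewrite /paired_flux /th.
case: (boolP (`|u1 x| <= n m)) => h1 /=; last by rewrite mul0r.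
case: (boolP (`|u2 x| <= n m)) => h2 /=; last by rewrite mul0r.
by congr (_ * _); apply: eq_bigr => i _; rewrite /A /B /cut h1 h2 !mxE.
Qed.

Lemma paired_flux_ge0 m : {ae mu, forall x, Om x -> 0 <= paired_flux m x}.
Proof.
apply: ae_imp a_struct => x st Ox; rewrite /paired_flux; case: ifP => // _.
by rewrite mulr_ge0 ?theta_ge0// (struct_mono (st Ox)).
Qed.

Let zq x := `|z x| `^ (p / (p - 1)).
Let ztail u m x := zq x * (if n m - 2 < u x then 1 else 0).

Let Izq : L1 mu Om zq.
Proof. by apply: in_Lp_powR z_Lp => //; rewrite divr_gt0// subr_gt0. Qed.

Let n2E m : n m - 2 = (m + 1)%:R. Proof. by rewrite /n !natrD -addrA; congr (_ + _); ring. Qed.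

Let ztail_L1 u m : measurable_fun (Om : set S) u -> L1 mu Om (ztail u m).
Proof.
move=> mu_u; rewrite (_ : ztail u m = (fun x => (if n m - 2 < u x then 1 else 0) * zq x)); last first.
  by apply/funext => x; rewrite mulrC.
apply: (L1_mul (M := 1) mO (measurable_gt_indic _ mO mu_u) _ Izq) => x _.
by case: ifP => _; rewrite ?normr1 ?normr0.
Qed.

Let ztail_cvg u : measurable_fun (Om : set S) u ->
  \int[mu]_(x in Om) ztail u m x @[m --> \oo] --> (0 : R).
Proof.
move=> mu_u; have mi m := measurable_gt_indic (n m - 2) mO mu_u.
have b1' m x : `|if n m - 2 < u x then 1 else 0 : R| <= 1.
  by case: ifP => _; rewrite ?normr1 ?normr0.
have cv x : Om x -> (if n m - 2 < u x then 1 else 0 : R) @[m --> \oo] --> (0 : R).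
  move=> _; apply/cvgrPdist_le => e e0; apply: filterS (near_natr_ge (u x)) => m um.
  rewrite n2E ltNge natrD (le_trans um) ?lerDl//=.
  by rewrite subrr normr0 ltW.
have [_] := Rint_cvg_mul mO Izq mi b1' cv.
by under [in X in _ --> X -> _]eq_Rintegral do rewrite mulr0; rewrite /Rintegral integral0.
Qed.

Let energy_cvg u Du b : sol u Du b ->
  \int[mu]_(x in Om) window_energy (a x) (n m) (u x) (Du x) @[m --> \oo] --> (0 : R).
Proof.
move=> [mu_u _ ed]; have := energy_window_cvg oO bO N0 p1 fL1 mu_u ed.
rewrite (_ : (fun m : nat => \int[mu]_(x in Om) window_energy (a x) (n m) (u x) (Du x)) =
  (fun m : nat => \int[mu]_(x in Om) window_energy (a x) m.+3%:R (u x) (Du x)))//.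
by apply/funext => m; rewrite /n addn3.
Qed.

Let flux m x := dot (a x (Du1 x)) (gradient (n m) u1 Du1 u2 Du2 x) +
  dot (a x (Du2 x)) (gradient (n m) u2 Du2 u1 Du1 x).

(** The sum of the error terms of the two lower bounds; each of them contains both window energies,
    whence the factor 2. *)
Let error m x := ztail u1 m x + ztail u2 m x +
  2 * (window_energy (a x) (n m) (u1 x) (Du1 x) + window_energy (a x) (n m) (u2 x) (Du2 x)).

Let flux_lower m : {ae mu, forall x, Om x -> paired_flux m x <= flux m x + C0 * error m x}.
Proof.
have [_ u10 _] := s1; have [_ u20 _] := s2.
have us : {ae mu, forall x, Om x -> 0 <= u1 x /\ 0 <= u2 x}.
  by apply: ae_imp2 u10 u20 => x k1 k2 Ox; split; [exact: k1|exact: k2].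
apply: ae_imp3 us z_ge0 a_struct => x k1 zx st Ox.
have [t1 t2] := k1 Ox; have {}zx := zx Ox; have {}st := st Ox.
have l1 := trunc_diff_grad_lower N0 p1 alpha0 beta0 zx st (Du1 x) (Du2 x) (ltW (n2 m)) t1 t2.
have l2 := trunc_diff_grad_lower N0 p1 alpha0 beta0 zx st (Du2 x) (Du1 x) (ltW (n2 m)) t2 t1.
have E (s : R) : (if n m - 2 < s then z x `^ (p / (p - 1)) else 0) = zq x * (if n m - 2 < s then 1 else 0).
  by rewrite /zq ger0_norm//; case: ifP; rewrite ?mulr1 ?mulr0.
rewrite !E in l1 l2; move: (lerD l1 l2).
rewrite -/(gradient (n m) u1 Du1 u2 Du2 x) -/(gradient (n m) u2 Du2 u1 Du1 x) -/(flux m x).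
have -> : paired_flux m x =
    (if (u1 x <= n m) && (u2 x <= n m) then theta 1 (u1 x - u2 x) * dot (a x (Du1 x)) (Du1 x - Du2 x) else 0) +
    (if (u2 x <= n m) && (u1 x <= n m) then theta 1 (u2 x - u1 x) * dot (a x (Du2 x)) (Du2 x - Du1 x) else 0).
  rewrite /paired_flux !ger0_norm// [X in _ = _ + (if X then _ else _)]andbC.
  case: ifP => _; last by rewrite addr0.
  rewrite -(thetaN (u2 x - u1 x))// opprB -mulrDr; congr (_ * _).
  by rewrite dotBl !dotBr; ring.
by rewrite /error /ztail /C0; lra.
Qed.

Let window_L1 u Du b m : sol u Du b -> L1 mu Om (fun x => window_energy (a x) (n m) (u x) (Du x)).
Proof. by move=> [_ _ ed]; exact: (energy_window_L1 oO p1 ed (n2 m)). Qed.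

Let error_L1 m : L1 mu Om (error m).
Proof.
have Z := L1D mO (ztail_L1 m mu1) (ztail_L1 m mu2).
exact: (L1D mO Z (L1Z 2 mO (L1D mO (window_L1 m s1) (window_L1 m s2)))).
Qed.

Let error_cvg : \int[mu]_(x in Om) error m x @[m --> \oo] --> (0 : R).
Proof.
rewrite (_ : (fun m : nat => _) = (fun m : nat =>
    \int[mu]_(x in Om) ztail u1 m x + \int[mu]_(x in Om) ztail u2 m x +
    2 * (\int[mu]_(x in Om) window_energy (a x) (n m) (u1 x) (Du1 x) +
         \int[mu]_(x in Om) window_energy (a x) (n m) (u2 x) (Du2 x)))).
  rewrite [X in _ --> X](_ : 0 = 0 + 0 + 2 * (0 + 0)); last by rewrite !addr0 mulr0 addr0.
  apply: cvgD; first by apply: cvgD; exact: ztail_cvg.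
  by apply: cvgM; [exact: cvg_cst|apply: cvgD; [exact: energy_cvg s1|exact: energy_cvg s2]].
apply/funext => m; have Z1 := ztail_L1 m mu1; have Z2 := ztail_L1 m mu2.
have W1 := window_L1 m s1; have W2 := window_L1 m s2.
by rewrite (RintegralD mO (L1D mO Z1 Z2) (L1Z 2 mO (L1D mO W1 W2))) (RintegralD mO Z1 Z2)
  (RintegralZl _ mO (L1D mO W1 W2)) (RintegralD mO W1 W2).
Qed.

Definition boundary_gap y := (absorbed lambda sigma b1 y - absorbed lambda sigma b2 y -
  (emitted h g b1 y - emitted h g b2 y)) * trunc 1 (b1 y - b2 y).

Let mb1 : measurable_fun (boundary Om : set (hausdorff_space R N N.-1)) b1.
Proof. by case: s1 => _ _ [[_ []]]. Qed.

Let mb2 : measurable_fun (boundary Om : set (hausdorff_space R N N.-1)) b2.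
Proof. by case: s2 => _ _ [[_ []]]. Qed.

Let gap_coef_L1 : L1 nu (boundary Om) (fun y => absorbed lambda sigma b1 y - absorbed lambda sigma b2 y -
  (emitted h g b1 y - emitted h g b2 y)).
Proof.
have [_ _ ed1] := s1; have [_ _ ed2] := s2.
have [_ _ A1 _ _] := ed1; have [_ _ A2 _ _] := ed2.
exact: (L1B mB (L1B mB A1 A2) (L1B mB (emitted_L1 ed1) (emitted_L1 ed2))).
Qed.

Lemma boundary_gap_L1 : L1 nu (boundary Om) boundary_gap.
Proof.
have mt := measurable_comp_continuous (trunc_continuous (@ler01 R)) (measurable_funB mb1 mb2).
rewrite (_ : boundary_gap = (fun y => trunc 1 (b1 y - b2 y) *
  (absorbed lambda sigma b1 y - absorbed lambda sigma b2 y - (emitted h g b1 y - emitted h g b2 y)))).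
  by apply: (L1_mul (M := 1) mB mt _ gap_coef_L1) => y _; exact: trunc_norm (@ler01 R).
by apply/funext => y; rewrite mulrC.
Qed.

Let L1_trunc1 d (T : measurableType d) (rho : {measure set T -> \bar R}) (D : set T) (F w : T -> R) :
  measurable D -> measurable_fun D w -> L1 rho D F -> L1 rho D (fun x => F x * trunc 1 (w x)).
Proof.
move=> mD mw IF; under eq_fun do rewrite mulrC.
have mt := measurable_comp_continuous (trunc_continuous (@ler01 R)) mw.
by apply: (L1_mul (M := 1) mD mt _ IF) => y _; exact: trunc_norm (@ler01 R).
Qed.

Let Rint_trunc_neg d (T : measurableType d) (rho : {measure set T -> \bar R}) (D : set T)
    (F w1 w2 : T -> R) : measurable D -> L1 rho D (fun x => F x * trunc 1 (w1 x - w2 x)) ->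
  \int[rho]_(x in D) (F x * trunc 1 (w2 x - w1 x)) = - \int[rho]_(x in D) (F x * trunc 1 (w1 x - w2 x)).
Proof.
move=> mD IF; rewrite -mulN1r -(RintegralZl _ mD IF); congr Rintegral; apply/funext => x.
by rewrite -(opprB (w1 x)) trunc1_opp mulrN mulN1r.
Qed.

Let Rint_gap d (T : measurableType d) (rho : {measure set T -> \bar R}) (D : set T)
    (A1 A2 E1 E2 w1 w2 : T -> R) : measurable D -> measurable_fun D w1 -> measurable_fun D w2 ->
  L1 rho D A1 -> L1 rho D A2 -> L1 rho D E1 -> L1 rho D E2 ->
  \int[rho]_(x in D) (E1 x * trunc 1 (w1 x - w2 x)) - \int[rho]_(x in D) (A1 x * trunc 1 (w1 x - w2 x)) +
  (\int[rho]_(x in D) (E2 x * trunc 1 (w2 x - w1 x)) - \int[rho]_(x in D) (A2 x * trunc 1 (w2 x - w1 x))) =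
  - \int[rho]_(x in D) ((A1 x - A2 x - (E1 x - E2 x)) * trunc 1 (w1 x - w2 x)).
Proof.
move=> mD m1 m2 IA1 IA2 IE1 IE2.
have mw := measurable_funB m1 m2.
have J1 := L1_trunc1 mD mw IA1; have J2 := L1_trunc1 mD mw IA2.
have J3 := L1_trunc1 mD mw IE1; have J4 := L1_trunc1 mD mw IE2.
have neg := Rint_trunc_neg (w1 := w1) (w2 := w2) mD.
rewrite (neg rho A2 J2) (neg rho E2 J4).
have -> : (fun x => (A1 x - A2 x - (E1 x - E2 x)) * trunc 1 (w1 x - w2 x)) = (fun x =>
    A1 x * trunc 1 (w1 x - w2 x) - A2 x * trunc 1 (w1 x - w2 x) -
    (E1 x * trunc 1 (w1 x - w2 x) - E2 x * trunc 1 (w1 x - w2 x))).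
  by apply/funext => x; ring.
rewrite (RintegralB mD (L1B mD J1 J2) (L1B mD J3 J4)) (RintegralB mD J1 J2) (RintegralB mD J3 J4).
by ring.
Qed.

Let flux_sum_L1 m : L1 mu Om (flux m).
Proof. exact: (L1D mO (flux_L1 oO bO N0 p1 (n0 m) s1 s2) (flux_L1 oO bO N0 p1 (n0 m) s2 s1)). Qed.

(** As [trunc 1] is odd, the terms with [f] cancel and the boundary terms combine into
    [boundary_gap]. *)
Let flux_sum_cvg : \int[mu]_(x in Om) flux m x @[m --> \oo] --> - \int[nu]_(y in boundary Om) boundary_gap y.
Proof.
have c1 := flux_cvg oO bO N0 p1 fL1 s1 s2; have c2 := flux_cvg oO bO N0 p1 fL1 s2 s1.
have [_ _ ed1] := s1; have [_ _ ed2] := s2.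
have [_ _ A1 _ _] := ed1; have [_ _ A2 _ _] := ed2.
have IF : L1 mu Om f := in_Lp_L1 (lexx 1) mO (leb_bounded bO) fL1.
have G := Rint_gap mB mb1 mb2 A1 A2 (emitted_L1 ed1) (emitted_L1 ed2).
have Nf := Rint_trunc_neg mO (L1_trunc1 mO (measurable_funB mu1 mu2) IF).
rewrite (_ : (fun m : nat => _) = (fun m : nat =>
   \int[mu]_(x in Om) dot (a x (Du1 x)) (gradient (n m) u1 Du1 u2 Du2 x) +
   \int[mu]_(x in Om) dot (a x (Du2 x)) (gradient (n m) u2 Du2 u1 Du1 x))); last first.
  by apply/funext => m; exact: (RintegralD mO (flux_L1 oO bO N0 p1 (n0 m) s1 s2) (flux_L1 oO bO N0 p1 (n0 m) s2 s1)).
suff -> : - (\int[nu]_(y in boundary Om) boundary_gap y) =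
  \int[mu]_(x in Om) (f x * trunc 1 (u1 x - u2 x)) +
  \int[nu]_(x in boundary Om) (emitted h g b1 x * trunc 1 (b1 x - b2 x)) -
  \int[nu]_(x in boundary Om) (absorbed lambda sigma b1 x * trunc 1 (b1 x - b2 x)) +
  (\int[mu]_(x in Om) (f x * trunc 1 (u2 x - u1 x)) +
  \int[nu]_(x in boundary Om) (emitted h g b2 x * trunc 1 (b2 x - b1 x)) -
  \int[nu]_(x in boundary Om) (absorbed lambda sigma b2 x * trunc 1 (b2 x - b1 x))).
  by apply: cvgD; [exact: c1|exact: c2].
by rewrite Nf /boundary_gap -G; ring.
Qed.

Hypothesis gap_ge0 : {ae nu, forall y, boundary Om y -> 0 <= boundary_gap y}.

(** The nonnegative paired flux increases with its level, so that of level [l] is below the bound of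
    every later level [m], and [m] can tend to infinity with [l] fixed. *)
Let paired_int_le l : \int[mu]_(x in Om) paired_flux l x <= - \int[nu]_(y in boundary Om) boundary_gap y.
Proof.
have cv : \int[mu]_(x in Om) flux m x + C0 * \int[mu]_(x in Om) error m x @[m --> \oo] -->
    - \int[nu]_(y in boundary Om) boundary_gap y.
  rewrite -[X in _ --> X]addr0 -[X in _ --> _ + X](mulr0 C0).
  by apply: cvgD; [exact: flux_sum_cvg|apply: cvgM; [exact: cvg_cst|exact: error_cvg]].
apply: (cvgr_to_ge cv); exists l => // m /= lm.
rewrite -(RintegralZl _ mO (error_L1 m)) -(RintegralD mO (flux_sum_L1 m) (L1Z _ mO (error_L1 m))).
apply: (ae_le_Rintegral mO (paired_flux_L1 l) (L1D mO (flux_sum_L1 m) (L1Z C0 mO (error_L1 m)))).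
apply: ae_imp2 (flux_lower m) (paired_flux_ge0 m) => x k1 k2 Ox; apply: le_trans (k1 Ox).
move: (k2 Ox); rewrite /paired_flux.
case: (boolP ((`|u1 x| <= n l) && (`|u2 x| <= n l))) => [/andP[l1 l2] _|_ //].
have nlm : n l <= n m by rewrite ler_nat leq_add2r.
by rewrite (le_trans l1 nlm) (le_trans l2 nlm).
Qed.

(** A nonnegative integral is bounded by the opposite of another one, so both vanish; the paired
    flux is treated in [gradients_agree]. *)
Lemma boundary_gap_eq0 : {ae nu, forall y, boundary Om y -> boundary_gap y = 0}.
Proof.
apply: (Rint_eq0_ae mB boundary_gap_L1 gap_ge0).
have := paired_int_le 0; have := Rint_ge0_ae mO (paired_flux_L1 0) (paired_flux_ge0 0).
by move=> k1 k2; have := le_trans k1 k2; rewrite oppr_ge0.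
Qed.

Lemma gradients_agree : {ae mu, forall x, Om x -> `|u1 x - u2 x| <= 1 -> Du1 x = Du2 x}.
Proof.
have gap0 := Rint_ge0_ae mB boundary_gap_L1 gap_ge0.
have Q0 m : {ae mu, forall x, Om x -> paired_flux m x = 0}.
  apply: (Rint_eq0_ae mO (paired_flux_L1 m) (paired_flux_ge0 m)).
  by apply: le_trans (paired_int_le m) _; rewrite oppr_le0.
apply: ae_imp2 (ae_all Q0) a_struct => x Qx st Ox d1.
have [m0 _ /(_ m0 (leqnn m0)) hm] := near_natr_ge (Num.max `|u1 x| `|u2 x|).
have nm : m0%:R <= n m0 by rewrite /n natrD lerDl.
have := Qx m0 Ox; rewrite /paired_flux.
move: hm => /=; rewrite ge_max => /andP[k1 k2]; rewrite (le_trans k1 nm) (le_trans k2 nm)/=.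
(* The factor [theta] is 1 where [|u1 - u2| < 1] and still 1/2 where [|u1 - u2| = 1], so the
   monotonicity term itself is 0. *)
move/eqP; rewrite mulf_eq0 => /orP[|/eqP]; last exact: (struct_strict (st Ox)).
rewrite thetaE//; move: d1; rewrite le_eqVlt => /orP[/eqP ->|->]; rewrite ?ltxx ?eqxx ?oner_eq0//.
by rewrite invr_eq0 pnatr_eq0.
Qed.

End comparison.

Lemma noninc_at0 (R : realType) (h : R -> \bar R) : h s @[s --> 0^'+] --> h 0 ->
  (forall s t, 0 < s -> s <= t -> (h t <= h s)%E) -> forall s t, 0 <= s -> s <= t -> (h t <= h s)%E.
Proof.
move=> h0 hn s t; rewrite le_eqVlt => /orP[/eqP <-|]; last exact: hn.
rewrite le_eqVlt => /orP[/eqP <-//|t0].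
apply: (cvge_to_ge h0); near=> r; apply: hn; first by near: r; exact: nbhs_right_gt.
by apply: ltW; near: r; exact: nbhs_right_lt.
Unshelve. all: by end_near. Qed.

(** Up to zeros, [trunc 1 (s - t)], the difference of the [sigma] terms and minus that of the
    emitted terms all have the sign of [s - t]. The [sigma] term is nonzero if [s != t] and
    [l != 0]. *)
Lemma gap_pointwise (R : realType) (sigma : R -> R) (l e1 e2 s t : R) : 0 <= l -> 0 <= s -> 0 <= t ->
  (forall r q, 0 <= r -> r < q -> sigma r < sigma q) ->
  (s <= t -> e2 <= e1) -> (t <= s -> e1 <= e2) ->
  0 <= (l * sigma s - l * sigma t - (e1 - e2)) * trunc 1 (s - t) /\
  (l != 0 -> (l * sigma s - l * sigma t - (e1 - e2)) * trunc 1 (s - t) = 0 -> s = t).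
Proof.
move=> l0 s0 t0 si e12 e21; rewrite -mulrBr.
have [st|ts|->] := ltgtP s t.
- have st0 : trunc 1 (s - t) < 0 by apply: trunc1_lt0; rewrite subr_lt0.
  have c1 : sigma s - sigma t < 0 by rewrite subr_lt0 si.
  have c2 := e12 (ltW st); split.
    by rewrite mulr_le0 ?(ltW st0)//; have := mulr_ge0_le0 l0 (ltW c1); lra.
  move=> ln0 /eqP; rewrite mulf_eq0 (lt_eqF st0) orbF => /eqP E.
  have lp : 0 < l by rewrite lt_def ln0.
  by exfalso; move: E; have : l * (sigma s - sigma t) < 0; [rewrite pmulr_rlt0|lra].
- have st0 : 0 < trunc 1 (s - t) by apply: trunc1_gt0; rewrite subr_gt0.
  have c1 : 0 < sigma s - sigma t by rewrite subr_gt0 si.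
  have c2 := e21 (ltW ts); split.
    by rewrite mulr_ge0 ?(ltW st0)//; have := mulr_ge0 l0 (ltW c1); lra.
  move=> ln0 /eqP; rewrite mulf_eq0 (gt_eqF st0) orbF => /eqP E.
  have lp : 0 < l by rewrite lt_def ln0.
  by exfalso; move: E; have : 0 < l * (sigma s - sigma t); [rewrite pmulr_rgt0|lra].
- by rewrite (_ : trunc 1 (t - t) = 0) ?mulr0; [split|rewrite subrr trunc_id ?normr0].
Qed.

Lemma share_le (R : realFieldType) (e M : R) : 0 <= e -> 0 <= M -> e / (M + 1) * M <= e.
Proof. by move=> e0 M0; rewrite mulrAC ler_pdivrMr ?ltr_wpDl// ler_wpM2l// lerDl. Qed.

Lemma integrable_fin_ae d (T : measurableType d) (R : realType) (mu : {measure set T -> \bar R})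
  (D : set T) (phi : T -> \bar R) : measurable D -> mu.-integrable D phi ->
  {ae mu, forall x, D x -> phi x \is a fin_num}.
Proof. by move=> mD I; have := integrable_ae mD I. Qed.

(** * Conclusion *)

Section uniqueness.
Context {R : realType} {N : nat}.
Local Notation V := 'rV[R]_N.
Local Notation S := (lebesgue_space R N).
Local Notation mu := (leb R N).
Local Notation nu := (surf R N).
Hypothesis cube_pos : forall r, 0 < r -> (0 < mu (cube 0 r))%E.
Variables (Om : set V) (Olip : bounded_lipschitz_open Om) (N0 : (0 < N)%N) (p : R) (p1 : 1 < p).
Variables (a : V -> V -> V) (alpha beta : R) (z lambda : V -> R) (sigma : R -> R) (h : R -> \bar R) (f g : V -> R).
Implicit Types (u v tau b : V -> R) (Du W G : V -> V).

Let oO : open Om. Proof. by case: Olip. Qed.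
Let bO : bounded_set Om. Proof. by case: Olip. Qed.
Let mO : measurable (Om : set S) := measurable_open_om leb_half oO.
Let mB : measurable (boundary Om : set (hausdorff_space R N N.-1)) := measurable_boundary _ Om.
Let Ofin : (mu Om < +oo)%E := leb_bounded bO.

Hypotheses (alpha0 : 0 < alpha) (beta0 : 0 < beta).
Hypothesis z_ge0 : {ae mu, forall x, Om x -> 0 <= z x}.
Hypothesis z_Lp : in_Lp mu Om (p / (p - 1)) z.
Hypothesis a_struct : {ae mu, forall x, Om x -> forall xi xi' : V, xi != xi' ->
    [/\ alpha * enorm xi `^ p <= dot (a x xi) xi,
        enorm (a x xi) <= beta * (z x + enorm xi `^ (p - 1)) &
        0 < dot (a x xi - a x xi') (xi - xi')]}.
Hypothesis fL1 : in_Lp mu Om 1 f.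
Hypothesis lambda_ge0 : {ae nu, forall x, boundary Om x -> 0 <= lambda x}.
Hypothesis lambda_comp : nonnull_on_components Om lambda.
Hypothesis g_ge0 : {ae nu, forall x, boundary Om x -> 0 <= g x}.
Hypothesis h_noninc : forall s t, 0 <= s -> s <= t -> (h t <= h s)%E.
Hypothesis sigma_incr : forall s t, 0 <= s -> s < t -> sigma s < sigma t.

Local Notation sol := (solution Om p a lambda sigma h f g).

(** Only truncations have traces, but [trunc 1 b] has the sign of [b]. *)
Lemma boundary_ge0 u Du b : sol u Du b -> {ae nu, forall y, boundary Om y -> 0 <= b y}.
Proof.
move=> [mu_u u0 [[[_ gu] [_ vu]] _ _ _ _]].
have av := appr_trace oO bO N0 p1 (gu _ ltr01) (vu _ ltr01).
have T0 : {ae mu, forall x, Om x -> 0 <= (trunc 1 \o u) x}.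
  apply: ae_imp u0 => x ux Ox /=; rewrite truncE//.
  by have := ux Ox; case: ifPn => k1; [lra|case: ifPn].
apply: ae_imp (trace_ge0 cube_pos N0 Olip av T0) => y ty By.
by rewrite leNgt; apply/negP => /trunc1_lt0; rewrite ltNge (ty By).
Qed.

Lemma emitted_fin u Du b : sol u Du b ->
  {ae nu, forall y, boundary Om y -> (h (b y) * (g y)%:E)%E \is a fin_num}.
Proof. by move=> [_ _ [_ _ _ HI _]]; exact: (integrable_fin_ae mB HI). Qed.

Variables (u1 : V -> R) (Du1 : V -> V) (b1 u2 : V -> R) (Du2 : V -> V) (b2 : V -> R).
Hypotheses (s1 : sol u1 Du1 b1) (s2 : sol u2 Du2 b2).

Let pointwise_gap : {ae nu, forall y, boundary Om y ->
  0 <= boundary_gap lambda sigma h g b1 b2 y /\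
  (lambda y != 0 -> boundary_gap lambda sigma h g b1 b2 y = 0 -> b1 y = b2 y)}.
Proof.
have E : {ae nu, forall y, boundary Om y ->
    (h (b1 y) * (g y)%:E)%E \is a fin_num /\ (h (b2 y) * (g y)%:E)%E \is a fin_num}.
  by apply: ae_imp2 (emitted_fin s1) (emitted_fin s2) => y k1 k2 By; split; [exact: k1|exact: k2].
have B : {ae nu, forall y, boundary Om y -> 0 <= b1 y /\ 0 <= b2 y}.
  by apply: ae_imp2 (boundary_ge0 s1) (boundary_ge0 s2) => y k1 k2 By; split; [exact: k1|exact: k2].
have L : {ae nu, forall y, boundary Om y -> 0 <= lambda y /\ 0 <= g y}.
  by apply: ae_imp2 lambda_ge0 g_ge0 => y k1 k2 By; split; [exact: k1|exact: k2].
apply: ae_imp3 E B L => y Ey By Ly yB.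
have [f1 f2] := Ey yB; have [b10 b20] := By yB; have [l0 g0] := Ly yB.
by apply: gap_pointwise => // bb; rewrite /emitted fine_le// lee_wpmul2r ?lee_fin// h_noninc.
Qed.

Let gap_ge0 : {ae nu, forall y, boundary Om y -> 0 <= boundary_gap lambda sigma h g b1 b2 y}.
Proof. by apply: ae_imp pointwise_gap => y k By; case: (k By). Qed.

Let traces_agree : {ae nu, forall y, boundary Om y -> lambda y != 0 -> trunc 1 (b1 y - b2 y) = 0}.
Proof.
have G0 := boundary_gap_eq0 oO bO N0 p1 alpha0 beta0 z_ge0 z_Lp a_struct fL1 s1 s2 gap_ge0.
apply: ae_imp2 pointwise_gap G0 => y k1 k2 By ly.
have [_ ->//] := k1 By; last exact: k2.
by rewrite subrr trunc_id ?normr0.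
Qed.

Let agree := gradients_agree oO bO N0 p1 alpha0 beta0 z_ge0 z_Lp a_struct fL1 s1 s2 gap_ge0.

Let n m : R := (m + 3)%:R.

Let gradient_small e : 0 < e -> \forall m \near \oo, forall i,
  \int[mu]_(x in Om) `|gradient (n m) u1 Du1 u2 Du2 x ord0 i| <= e.
Proof.
move=> e0; pose M := fine (mu Om); have M0 : 0 <= M by rewrite fine_ge0.
(* [d] is the constant part of the pointwise bound and contributes at most [e / 2]; it fixes the
   factor [c] of the energy, which is then made small by taking [m] large. *)
pose d := e / 2 / (M + 1); have d0 : 0 < d by rewrite !divr_gt0// ltr_wpDl.
pose c := d `^ (1 - p) / alpha; have c0 : 0 <= c by rewrite divr_ge0 ?powR_ge0// ltW.
have [mu1 u10 ed1] := s1; have [_ u20 _] := s2.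
have W := energy_window_cvg oO bO N0 p1 fL1 mu1 ed1.
have c10 : 0 < e / 2 / (c + 1) by rewrite !divr_gt0// ltr_wpDl.
have Wn : \forall m \near \oo, \int[mu]_(x in Om) window_energy (a x) m.+3%:R (u1 x) (Du1 x) <= e / 2 / (c + 1).
  have /cvgrPdist_le/(_ _ c10) := W; apply: filterS => m; rewrite sub0r normrN.
  exact: le_trans (ler_norm _).
apply: filterS Wn => m Wm i.
have nE : n m = m.+3%:R by rewrite /n addn3.
have n2 : 2 < n m by rewrite ltr_nat addn3.
have n0 : 0 < n m by rewrite ltr0n addn3.
have IW := energy_window_L1 oO p1 ed1 n2.
have [_ IG _] := trunc_diff_appr oO bO N0 p1 n0 s1 s2.
have Id : L1 mu Om (fun=> d) by apply: (@L1_bounded _ _ _ _ _ _ `|d|).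
have us : {ae mu, forall x, Om x -> 0 <= u1 x /\ 0 <= u2 x}.
  by apply: ae_imp2 u10 u20 => x k1 k2 Ox; split; [exact: k1|exact: k2].
have dom : {ae mu, forall x, Om x -> `|gradient (n m) u1 Du1 u2 Du2 x ord0 i| <=
    d + c * window_energy (a x) (n m) (u1 x) (Du1 x)}.
  apply: ae_imp3 us agree a_struct => x k1 k2 st Ox; have [t1 t2] := k1 Ox.
  exact: (trunc_diff_grad_bound N0 p1 alpha0 (st Ox) (ltW n2) t1 t2 i d0 (k2 Ox)).
apply: le_trans (ae_le_Rintegral mO (L1_norm (IG i)) (L1D mO Id (L1Z c mO IW)) dom) _.
rewrite (RintegralD mO Id (L1Z c mO IW)) (RintegralZl _ mO IW) Rintegral_cst// -/M (splitr e) lerD//.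
  by apply: share_le => //; rewrite divr_ge0 ?(ltW e0).
rewrite nE; apply: le_trans (ler_wpM2l c0 Wm) _.
by rewrite mulrC share_le// divr_ge0 ?(ltW e0).
Qed.

(** On this set the truncation of [b2] is inactive from the level [j] on, so the traces of the
    approximants are eventually equal to [trunc 1 (b1 - b2)]. *)
Let bounded_part (j : nat) : set V := [set y | `|b2 y| <= j%:R].

Let diff_appr j : appr Om (boundary Om `&` bounded_part j) (fun x => trunc 1 (u1 x - u2 x)) (fun=> 0)
  (fun y => trunc 1 (b1 y - b2 y)).
Proof.
have [mu1 _ _] := s1; have [mu2 _ _] := s2.
have c1 := @trunc_continuous R 1 ler01.
have T1 (r : R) : `|trunc 1 r| <= 1 by exact: trunc_norm.
have md := measurable_comp_continuous c1 (measurable_funB mu1 mu2).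
have I1 : L1 mu Om (fun=> 1 : R) by apply: (@L1_bounded _ _ _ _ _ _ 1) => // x _; rewrite normr1.
apply: appr_closed => //.
- by apply: (@L1_bounded _ _ _ _ _ _ 1).
- by move=> i; apply: (@L1_bounded _ _ _ _ _ _ 0) => // x _; rewrite mxE normr0.
move=> e e0.
have mt m : measurable_fun (Om : set S) (fun x => trunc 1 (u1 x - trunc (m + 3)%:R (u2 x))).
  apply: (measurable_comp_continuous c1); apply: (measurable_funB mu1).
  exact: (measurable_comp_continuous (trunc_continuous (ler0n _ _)) mu2).
have cv x : Om x -> trunc 1 (u1 x - trunc (m + 3)%:R (u2 x)) @[m --> \oo] --> trunc 1 (u1 x - u2 x).
  move=> _; apply/cvgrPdist_le => e' e'0; apply: filterS (near_natr_ge `|u2 x|) => m um.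
  rewrite (trunc_id (k := (m + 3)%:R)); last by rewrite (le_trans um)// ler_nat leq_addr.
  by rewrite subrr normr0 ltW.
have [_ nv] := Rint_dominated_near mO mt I1 cv (fun m x _ => T1 _) e0.
have nG := gradient_small e0.
near \oo => m.
have n0 : 0 < n m by rewrite ltr0n addn3.
exists (fun x => trunc 1 (u1 x - trunc (n m) (u2 x))), (gradient (n m) u1 Du1 u2 Du2),
  (fun y => trunc 1 (b1 y - trunc (n m) (b2 y))); split.
- by apply: apprS (trunc_diff_appr oO bO N0 p1 n0 s1 s2) => y [].
- by near: m.
- have Gm : forall i, \int[mu]_(x in Om) `|gradient (n m) u1 Du1 u2 Du2 x ord0 i| <= e by near: m.
  by move=> i; under eq_Rintegral do rewrite mxE subr0; exact: Gm.
- rewrite (_ : _ `&` _ = set0) ?outer_measure0 ?lee_fin ?ltW//.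
  apply/seteqP; split=> // y [[_ by2]] /=.
  have jm : (j <= m)%N by near: m; exact: nbhs_infty_ge.
  rewrite (trunc_id (k := n m)) ?subrr ?normr0 ?ltNge ?(ltW e0)//.
  by apply: le_trans by2 _; rewrite ler_nat (leq_trans jm)// leq_addr.
Unshelve. all: by end_near. Qed.

Lemma solutions_agree : {ae mu, forall x, Om x -> u1 x = u2 x}.
Proof.
have cov y : boundary Om y -> exists j, bounded_part j y.
  by move=> _; have [j _ /(_ j (leqnn j))] := near_natr_ge `|b2 y|; exists j.
have := zero_from_boundary cube_pos N0 Olip cov diff_appr traces_agree lambda_comp.
apply: ae_imp => x k Ox; apply/eqP; rewrite -subr_eq0; apply: contraT => nz.
have := k Ox; move: nz; rewrite neq_lt => /orP[/trunc1_lt0|/trunc1_gt0] /[swap] ->; by rewrite ltxx.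
Qed.

End uniqueness.

Theorem theorem3p6 (R : realType) (N : nat) (p : R) (Omega : set 'rV[R]_N)
  (a : 'rV[R]_N -> 'rV[R]_N -> 'rV[R]_N) (alpha beta : R) (z : 'rV[R]_N -> R)
  (f lambda g : 'rV[R]_N -> R) (h : R -> \bar R) (eta c1 s1 : R)
  (sigma : R -> R)
  (N_ge2 : (2 <= N)%N) (p_gt1 : 1 < p) (p_ltN : p < N%:R)
  (Omega_lip : bounded_lipschitz_open Omega)
  (* assumptions on a *)
  (a_cara : caratheodory_fun Omega a)
  (alpha_gt0 : 0 < alpha) (beta_gt0 : 0 < beta)
  (z_ge0 : {ae leb R N, forall x, Omega x -> 0 <= z x})
  (z_Lp : in_Lp (leb R N) Omega (p / (p - 1)) z)
  (a_struct : {ae leb R N, forall x, Omega x ->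
    forall xi xi' : 'rV[R]_N, xi != xi' ->
    [/\ alpha * enorm xi `^ p <= dot (a x xi) xi,
        enorm (a x xi) <= beta * (z x + enorm xi `^ (p - 1)) &
        0 < dot (a x xi - a x xi') (xi - xi')]})
  (* data *)
  (f_ge0 : {ae leb R N, forall x, Omega x -> 0 <= f x})
  (f_L1 : in_Lp (leb R N) Omega 1 f)
  (lambda_L1 : in_Lp (surf R N) (boundary Omega) 1 lambda)
  (lambda_ge0 : {ae surf R N, forall x, boundary Omega x -> 0 <= lambda x})
  (lambda_neq0 :
    ~ {ae surf R N, forall x, boundary Omega x -> lambda x = 0})
  (lambda_comp : nonnull_on_components Omega lambda)
  (g_L1 : in_Lp (surf R N) (boundary Omega) 1 g)
  (g_ge0 : {ae surf R N, forall x, boundary Omega x -> 0 <= g x})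
  (* assumptions on h *)
  (h_fin : forall s, 0 < s -> h s \is a fin_num)
  (h_cont : forall s, 0 < s -> {for s, continuous h})
  (h_at0 : h s @[s --> 0^'+] --> h 0)
  (eta_ge0 : 0 <= eta) (c1_gt0 : 0 < c1) (s1_gt0 : 0 < s1)
  (h_near0 : forall s, 0 < s -> s <= s1 -> (h s <= (c1 * s `^ (- eta))%:E)%E)
  (h_limsup : (limf_esup h (pinfty_nbhs R) < +oo)%E)
  (h_noninc : forall s t, 0 < s -> s <= t -> (h t <= h s)%E)
  (* assumptions on sigma *)
  (sigma_cont : {within `[0, +oo[, continuous sigma})
  (sigma0 : sigma 0 = 0)
  (sigma_ge : forall s, 0 <= s -> s `^ (p - 1) <= sigma s)
  (sigma_incr : forall s t, 0 <= s -> s < t -> sigma s < sigma t)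
  (u1 u2 : 'rV[R]_N -> R) :
  entropy_solution Omega p a lambda sigma h f g u1 ->
  entropy_solution Omega p a lambda sigma h f g u2 ->
  {ae leb R N, forall x, Omega x -> u1 x = u2 x}.
Proof.
have N0 : (0 < N)%N by exact: leq_trans N_ge2.
move=> [mu1 u10 [Du1 [b1 ed1]]] [mu2 u20 [Du2 [b2 ed2]]].
have [null|cube_pos] := @leb_null_or_pos R N.
  exact: (proj2 (negligible_om _ _) (null _)).
exact: (@solutions_agree R N cube_pos Omega Omega_lip N0 p p_gt1 a alpha beta z lambda sigma h f g
  alpha_gt0 beta_gt0 z_ge0 z_Lp a_struct f_L1 lambda_ge0 lambda_comp g_ge0
  (noninc_at0 h_at0 h_noninc) sigma_incr u1 Du1 b1 u2 Du2 b2 (And3 mu1 u10 ed1) (And3 mu2 u20 ed2)).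
Qed.
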